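(* Let $m\ge 2$ be an integer, let $P\in\mathcal{P}_m$ and let $V>0$. Then there exists a function $u\in C^\infty(\mathbb{R}^{2m})$ such that $$(-\Delta)^m u=-(2m-1)!\,e^{2mu}\ \text{ in }\mathbb{R}^{2m},\qquad \int_{\mathbb{R}^{2m}}e^{2mu}\,dx=V,$$ and such that, with $\alpha=-\frac{2V}{\mathrm{vol}(S^{2m})}$ and for some constant $C\in\mathbb{R}$, $$u(x)=-\alpha\log|x|-P(x)+C+o(1),\qquad o(1)\to0\ \text{ as }|x|\to\infty.$$
   Context: $\mathrm{vol}(S^{2m})$ is the volume of the unit round sphere $S^{2m}\subset\mathbb{R}^{2m+1}$. $\mathcal{P}_m$ denotes the set of all real polynomials $P$ on $\mathbb{R}^{2m}$ with $\deg P\le 2m-2$ and $\lim_{|x|\to\infty}x\cdot\nabla P(x)=+\infty$. *)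

(* Defs.v *)
From HB Require Import structures.
From mathcomp Require Import all_boot all_order all_algebra.
From mathcomp Require Import -(notations) mpoly.
From mathcomp Require Import all_classical all_reals all_analysis.
From mathcomp Require Import ring lra.

Set Implicit Arguments.
Unset Strict Implicit.
Unset Printing Implicit Defensive.

Import Order.TTheory GRing.Theory Num.Theory.
Import numFieldNormedType.Exports.

Local Open Scope classical_set_scope.
Local Open Scope ring_scope.

Section euclidean_space.
Context {R : realType}.
Implicit Type n : nat.

(* The norm `|x| on 'rV[R]_n is the maximum norm, hence this definition. *)
Definition enorm n (x : 'rV[R]_n) : R := Num.sqrt (\sum_i x 0 i ^+ 2).

Definition at_infinity (n : nat) : set_system 'rV[R]_n :=
  filter_from setT (fun M : R => [set x : 'rV[R]_n | M < enorm x]).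
Arguments at_infinity n : clear implicits.

Global Instance at_infinity_filter n : Filter (at_infinity n).
Proof.
apply: filter_from_filter; first by exists 0.
move=> M N _ _; exists (Num.max M N) => // x /=.
by rewrite gt_max => /andP[].
Qed.

Lemma at_infinity_proper n : (0 < n)%N -> ProperFilter (at_infinity n).
Proof.
move=> n0; apply: filter_from_proper => M _.
pose x : 'rV[R]_n := \row_i (`|M| + 1).
exists x => /=; apply: (le_lt_trans (ler_norm M)).
apply: (lt_le_trans (y := `|M| + 1)); first by rewrite ltrDl.
rewrite -[leLHS]ger0_norm ?addr_ge0// -sqrtr_sqr /enorm ler_wsqrtr//.
rewrite (bigD1 (Ordinal n0))//= mxE lerDl sumr_ge0// => i _.
exact: sqr_ge0.
Qed.

Definition partial n (i : 'I_n) (f : 'rV[R]_n -> R) : 'rV[R]_n -> R :=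
  fun x => 'D_(delta_mx 0 i) f x.

Definition iter_partial n (s : seq 'I_n) (f : 'rV[R]_n -> R) :
  'rV[R]_n -> R := foldr (@partial n) f s.

Definition smooth n (f : 'rV[R]_n -> R) : Prop :=
  forall s : seq 'I_n, continuous (iter_partial s f) /\
    forall (i : 'I_n) x, derivable (iter_partial s f) x (delta_mx 0 i).

Definition laplacian n (f : 'rV[R]_n -> R) : 'rV[R]_n -> R :=
  fun x => \sum_i partial i (partial i f) x.

(* [polylaplacian m f] is (- Delta)^m f. *)
Definition polylaplacian n (m : nat) (f : 'rV[R]_n -> R) : 'rV[R]_n -> R :=
  iter m (fun g x => - laplacian g x) f.

End euclidean_space.
Arguments at_infinity R n : clear implicits.

Section lebesgue_measure_tuple.
Context (R : realType).
Local Notation RT := (measurableTypeR R).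

Definition tcons n (p : RT * n.-tuple RT) : n.+1.-tuple RT :=
  [tuple of p.1 :: p.2].

Lemma measurable_tcons n : measurable_fun setT (@tcons n).
Proof. by apply: (@measurable_cons _ _ _ _ fst n snd). Qed.

Lemma tcons_inj n : injective (@tcons n).
Proof.
by move=> [a s] [b t] /(congr1 val)/= [-> st]; congr pair; exact: val_inj.
Qed.

Lemma measurable_tuncons n :
  measurable_fun setT (fun t : n.+1.-tuple RT => (thead t, [tuple of behead t])).
Proof.
apply: measurable_fun_pair => /=; last exact: measurable_behead.
exact: measurable_tnth.
Qed.

Lemma image_tcons n (A : set (RT * n.-tuple RT)) :
  @tcons n @` A = (fun t => (thead t, [tuple of behead t])) @^-1` A.
Proof.
have K t : tcons (thead t, [tuple of behead t]) = t.
  by rewrite [RHS]tuple_eta; apply/val_inj.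
have K' p : (thead (@tcons n p), [tuple of behead (tcons p)]) = p.
  by case: p => a s; congr pair; exact: val_inj.
apply/seteqP; split=> [_ [p Ap <-]/=|t /= At].
  by rewrite K'.
by exists (thead t, [tuple of behead t]); [exact: At|exact: K].
Qed.

Section lebesgue_succ.
Context (n : nat) (mu : {sigma_finite_measure set (n.-tuple RT) -> \bar R}).

Definition lebesgue_succ : set (n.+1.-tuple RT) -> \bar R :=
  pushforward (@lebesgue_measure R \x mu)%E (@tcons n).

Let lebesgue_succ0 : lebesgue_succ set0 = 0%E.
Proof. by rewrite /lebesgue_succ /pushforward preimage_set0 measure0. Qed.

Let lebesgue_succ_ge0 A : (0 <= lebesgue_succ A)%E.
Proof. by rewrite /lebesgue_succ /pushforward measure_ge0. Qed.

Let lebesgue_succ_sigma_additive : semi_sigma_additive lebesgue_succ.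
Proof.
move=> F mF tF mUF; rewrite /lebesgue_succ /pushforward preimage_bigcup.
apply: measure_semi_sigma_additive.
- by move=> k; rewrite -[X in measurable X]setTI; exact: measurable_tcons.
- apply/trivIsetP => /= i j _ _ ij; rewrite -preimage_setI.
  by move/trivIsetP : tF => /(_ _ _ _ _ ij) ->//; rewrite preimage_set0.
- by rewrite -preimage_bigcup -[X in measurable X]setTI; exact: measurable_tcons.
Qed.

HB.instance Definition _ := isMeasure.Build _ _ _ lebesgue_succ
  lebesgue_succ0 lebesgue_succ_ge0 lebesgue_succ_sigma_additive.

Let lebesgue_succ_sigma_finite : sigma_finite setT lebesgue_succ.
Proof.
have [F TF Foo] : sigma_finite setT (@lebesgue_measure R \x mu)%E.
  have /sigma_finiteP[F [TF ndF Foo]] := sigma_finiteT (@lebesgue_measure R).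
  have /sigma_finiteP[G [TG ndG Goo]] := sigma_finiteT mu.
  exists (fun k => F k `*` G k).
    rewrite -setXTT TF TG predeqE => -[x y]; split.
      move=> [/= [k _ Fkx] [l _ Gly]]; exists (maxn k l) => //; split.
      - by move: x Fkx; exact/subsetPset/ndF/leq_maxl.
      - by move: y Gly; exact/subsetPset/ndG/leq_maxr.
    by move=> [k _ []/= ? ?]; split; exists k.
  move=> k; have [? ?] := Foo k; have [? ?] := Goo k.
  split; first exact: measurableX.
  by rewrite product_measure1E// lte_mul_pinfty// ge0_fin_numE.
exists (fun k => @tcons n @` F k).
  rewrite -image_bigcup -TF image_tcons.
  by rewrite preimage_setT.
move=> k; have [mF Fk] := Foo k; split.
  rewrite image_tcons -[X in measurable X]setTI.
  exact: measurable_tuncons.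
rewrite /lebesgue_succ /pushforward (_ : _ @^-1` _ = F k)//.
apply/seteqP; split=> [p [q Fq /tcons_inj <-]//|p Fp].
by exists p.
Qed.

HB.instance Definition _ := Measure_isSigmaFinite.Build _ _ _ lebesgue_succ
  lebesgue_succ_sigma_finite.

End lebesgue_succ.

Fixpoint lebesgue_tuple (n : nat) :
    {sigma_finite_measure set (n.-tuple RT) -> \bar R} :=
  match n with
  | 0 => dirac ([tuple] : 0.-tuple RT)
  | n'.+1 => lebesgue_succ (lebesgue_tuple n')
  end.

Lemma lebesgue_tuple_box n (A : 'I_n -> set RT) :
  (forall i, measurable (A i)) ->
  lebesgue_tuple n [set t | forall i, A i (tnth t i)] =
  (\prod_(i < n) lebesgue_measure (A i))%E.
Proof.
elim: n A => [|n IHn] A mA.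
  rewrite big_ord0/= diracE mem_set//; first by case.
rewrite big_ord_recl -IHn//= /lebesgue_succ /pushforward.
rewrite -product_measure1E//.
  congr (product_measure1 _ _ _); apply/seteqP;
      split=> [[a s]/= As|[a s]/= [Aa As] i].
    split; first exact: (As ord0).
    by move=> i; have := As (lift ord0 i); rewrite tnthS.
  by have [j ->|->//] := unliftP ord0 i; rewrite tnthS.
rewrite (_ : mkset _ = \bigcap_(i in [set: 'I_n])
    ((@tnth _ RT ^~ i) @^-1` A (lift ord0 i))); last first.
  by apply/seteqP; split=> t /= At i => [_|]; exact: At.
apply: fin_bigcap_measurable => // i _; rewrite -[X in measurable X]setTI.
exact: measurable_tnth.
Qed.

End lebesgue_measure_tuple.

Section integration.
Context {R : realType}.
Implicit Type n : nat.

(* n-tuples carry the product sigma-algebra, row vectors the topology and the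
   differential calculus; the two are identified entrywise. *)
Definition row_of_tuple n (t : n.-tuple (measurableTypeR R)) : 'rV[R]_n :=
  \row_i tnth t i.

Definition integral_Rn n (f : 'rV[R]_n -> \bar R) : \bar R :=
  (\int[lebesgue_tuple R n]_t f (row_of_tuple t))%E.

(* Riemannian volume of the image of an injective immersion phi of R^n into
   R^k, for the metric induced by the Euclidean one. *)
Definition param_volume n k (phi : 'rV[R]_n -> 'rV[R]_k) : \bar R :=
  integral_Rn (fun x => (Num.sqrt (\det ('J phi x *m ('J phi x)^T)))%:E).

(* Inverse stereographic projection; the last coordinate is the one of the
   pole. *)
Definition stereo n (x : 'rV[R]_n) : 'rV[R]_(n + 1) :=
  (1 + enorm x ^+ 2)^-1 *: row_mx (2 *: x) (const_mx (enorm x ^+ 2 - 1)).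

Lemma enorm_sqr n (x : 'rV[R]_n) : enorm x ^+ 2 = \sum_i x 0 i ^+ 2.
Proof. by rewrite sqr_sqrtr// sumr_ge0// => i _; exact: sqr_ge0. Qed.

Lemma enorm_row_mx_sqr n (x : 'rV[R]_n) (y : R) :
  enorm (row_mx x (const_mx y : 'rV_1)) ^+ 2 = enorm x ^+ 2 + y ^+ 2.
Proof.
rewrite !enorm_sqr big_split_ord/= big_ord1 row_mxEr mxE; congr (_ + _).
by apply: eq_bigr => i _; rewrite row_mxEl.
Qed.

Lemma enormZ_sqr n (a : R) (x : 'rV[R]_n) :
  enorm (a *: x) ^+ 2 = a ^+ 2 * enorm x ^+ 2.
Proof.
by rewrite !enorm_sqr mulr_sumr; apply: eq_bigr => i _; rewrite mxE exprMn.
Qed.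

Lemma stereo_onto n :
  [set y : 'rV[R]_(n + 1) | enorm y = 1] `\ row_mx 0 (const_mx 1) =
  range (@stereo n).
Proof.
apply/seteqP; split=> [y [/= y1 yN]|_ [x _ <-]/=].
  pose z := lsubmx y; pose h := rsubmx y 0 0.
  have yE : y = row_mx z (const_mx h).
    rewrite -[LHS]hsubmxK; congr row_mx.
    by apply/rowP => i; rewrite !ord1 [RHS]mxE.
  have zh : enorm z ^+ 2 + h ^+ 2 = 1.
    by rewrite -enorm_row_mx_sqr -yE y1 expr1n.
  have h1 : 1 - h != 0.
    apply/negP => /eqP h1; apply: yN; rewrite yE.
    have {}h1 : h = 1 by lra.
    rewrite h1; congr row_mx; apply/rowP => i; rewrite [RHS]mxE.
    have /eqP : enorm z ^+ 2 = 0 by rewrite h1 in zh; lra.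
    rewrite enorm_sqr psumr_eq0; last by move=> ? _; exact: sqr_ge0.
    by move=> /allP/(_ i (mem_index_enum _))/=; rewrite sqrf_eq0 => /eqP.
  exists ((1 - h)^-1 *: z) => //.
  rewrite /stereo enormZ_sqr (_ : enorm z ^+ 2 = 1 - h ^+ 2); last lra.
  rewrite (_ : 1 + _ = 2 / (1 - h)); last by field.
  rewrite yE scale_row_mx !scalerA; congr row_mx.
    by rewrite (_ : _ * _ * _ = 1) ?scale1r//; field.
  by apply/rowP => i; rewrite !mxE; field.
have D0 : 1 + enorm x ^+ 2 != 0 by rewrite gt_eqF// ltr_pwDl// sqr_ge0.
split.
  apply/eqP; rewrite -(@eqrXn2 _ 2)//; last exact: sqrtr_ge0.
  rewrite enormZ_sqr enorm_row_mx_sqr enormZ_sqr expr1n; apply/eqP.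
  by field.
rewrite /stereo scale_row_mx => /eq_row_mx[_ /rowP/(_ 0)]; rewrite !mxE.
move=> /(congr1 ( *%R (1 + enorm x ^+ 2))); rewrite mulrA divff// mul1r mulr1.
lra.
Qed.

Lemma stereo_inj n : injective (@stereo n).
Proof.
move=> x y.
have D0 (z : 'rV[R]_n) : 1 + enorm z ^+ 2 != 0.
  by rewrite gt_eqF// ltr_pwDl// sqr_ge0.
rewrite /stereo !scale_row_mx => /eq_row_mx[+ /rowP/(_ 0)]; rewrite !mxE => E H.
have {}H : (1 + enorm x ^+ 2)^-1 = (1 + enorm y ^+ 2)^-1.
  have F (z : 'rV[R]_n) : (1 + enorm z ^+ 2)^-1 * (enorm z ^+ 2 - 1) =
      1 - 2 * (1 + enorm z ^+ 2)^-1 by field.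
  by move: H; rewrite !F; lra.
move: E; rewrite H => /(scalerI _) E.
by apply: (scalerI (a := 2)); rewrite ?pnatr_eq0//; apply: E; rewrite invr_eq0.
Qed.

(* [stereo] is a diffeomorphism of R^n onto S^n minus a point, a null set. *)
Definition sphere_volume n : R := fine (param_volume (@stereo n)).

End integration.

Section polynomials.
Context {R : realType}.

Definition mpoly_fun n (P : mpoly.mpoly n R) : 'rV[R]_n -> R :=
  fun x => mpoly.meval (fun i => x 0 i) P.

(* [mpoly.msize P] is deg P + 1, and 0 for P = 0. *)
Definition admissible_poly (m : nat) (P : mpoly.mpoly (2 * m) R) : Prop :=
  ((mpoly.msize P).-1 <= 2 * m - 2)%N /\
  (fun x : 'rV[R]_(2 * m) => \sum_i x 0 i * partial i (mpoly_fun P) x)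
    @ at_infinity R (2 * m) --> +oo.

End polynomials.

(* Main.v *)
(* Let S be the volume of the sphere, beta = 2 V / S and L = log |.|. We look for
   u = beta L * rho - P + const, where rho = e^(2 m u) / V is a probability density:
   rho = exp (2 m (beta L * rho - P) + c). Factoring out the weight
   W = (1 + |x|^2)^(m beta) e^(-2 m P), which decays faster than any power, this is
   ln h + K h = c for h = rho / W, where K has the kernel
     k(x, y) = m beta ln ((1 + |x|^2) (1 + |y|^2) / |x - y|^2) = - m beta ln (1 - s)
   with respect to W dy. Here 1 - s is a multiple of the squared distance of the
   stereographic images of x and y, so that s is a Gram kernel, and
   - ln (1 - s) = sum_j s^j / j makes K positive semidefinite. Hence, for every c,
   a truncated gradient descent contracts in L^2(W) to a solution h_c; its mass
   depends continuously on c, and the intermediate value theorem gives mass 1.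
   Convolution with L gains one derivative, so rho is smooth by bootstrapping.
   The polyharmonic equation follows by approximating L with
   L_e = 1/2 ln (e^2 + |x|^2): (-Delta)^m L_e is - (2 m - 1)! / 2 times the Jacobian
   (2 e / (e^2 + |x|^2))^(2 m) of the stereographic projection, an approximation of
   S times the Dirac mass, while (-Delta)^m P = 0 because deg P < 2 m. *)
Require Import Defs.
From HB Require Import structures.
From mathcomp Require Import all_boot all_order all_algebra.
From mathcomp Require Import -(notations) mpoly.
From mathcomp Require Import all_classical all_reals all_analysis.
From mathcomp Require Import measurable_realfun ring lra.
Set Implicit Arguments.
Unset Strict Implicit.
Unset Printing Implicit Defensive.
Import Order.TTheory GRing.Theory Num.Theory.
Import numFieldNormedType.Exports.
Local Open Scope classical_set_scope.
Local Open Scope ring_scope.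

(** * Lebesgue measure on tuples *)

Section lebesgue_tuple_theory.
Context {R : realType}.
Local Notation RT := (measurableTypeR R).
Local Notation mu := (@lebesgue_measure R).

(** Almost every estimate goes back to one majorant, [sing x y], equal to (1 + |x-y|^-2) (1 +
    |y|^2)^-n. The logarithm, its square, its gradient and the errors made in passing from L to L_e
    are at most of order |z|^-2 near 0, and the fast decay of the density absorbs polynomial growth.
    Dimension 2 m >= 4 lets a product of one-dimensional weights |x_i - y_i|^(-1/2) dominate
    |x-y|^-2, so integrability reduces to one variable. The sign of the equation puts +K beside ln
    h. Hence ln h + K h is strongly monotone on bounded sets, which replaces compactness and leaves
    no threshold on V. Monotonicity gives only L^2 contraction; pointwise limits come from K mapping
    L^2(W) into bounded functions. The factor (1 + |x|^2)^(m beta) of W cancels against the kernel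
    exactly when rho has mass 1, so the normalization has to precede the return to rho. The growth
    assumption on P enters once: beyond some radius x . grad P exceeds any given constant, and
    integration along rays makes P exceed any multiple of ln (1 + |x|^2), up to a constant. *)

Lemma measurable_affine (x a : R) :
  measurable_fun [set: RT] (fun t : RT => x + a * t : RT).
Proof.
apply: measurable_funD => //; exact: measurable_funM.
Qed.

(** Uniqueness of Lebesgue measure: the pushforward under the affine map, scaled by [|a|], is a
    measure, so it suffices to compare both sides on intervals []u, v]]. *)
Lemma lebesgue_measure_affine (x a : R) (A : set RT) : a != 0 -> measurable A ->
  (`|a|%:E * mu ((fun t => (x + a * t)%R) @^-1` A) = mu A)%E.
Proof.
move=> a0 mA.
have k0 : 0 <= `|a| by [].
pose f : RT -> RT := fun t => x + a * t.
pose m := mscale (NngNum k0) (measure_function_pushforward__canonical__measure_function_Measure mu (measurable_affine x a)).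
suff -> : mu A = m A by rewrite /m /mscale.
apply: (@lebesgue_measure_unique _ m) => //= _ [[u v] _ <-]/=.
rewrite /m /mscale/= /pushforward/=.
(* A negative [a] exchanges the closed and the open end of the interval; the length is the same in
   both cases. *)
have -> : (fun t => x + a * t) @^-1` [set y | y \in `]u, v]] =
  if 0 < a then [set` `](u - x) / a, (v - x) / a]]
  else [set` `[(v - x) / a, (u - x) / a[].
  apply/seteqP; split => t /=; rewrite ?in_itv/=.
    case: ifPn => a_; rewrite /= in_itv/= => /andP[? ?].
      by rewrite ltr_pdivrMr// ler_pdivlMr// ltrBlDl lerBrDl !(mulrC _ a); apply/andP.
    have {a_}a_ : a < 0 by rewrite lt_neqAle a0 leNgt.
    rewrite ler_ndivrMr// ltr_ndivlMr// !(mulrC _ a) ltrBlDl lerBrDl.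
    exact/andP.
  case: ifPn => a_; rewrite /= in_itv/=.
    by rewrite ltr_pdivrMr// ler_pdivlMr// ltrBlDl lerBrDl !(mulrC _ a).
  have {a_}a_ : a < 0 by rewrite lt_neqAle a0 leNgt.
  by rewrite ler_ndivrMr// ltr_ndivlMr// !(mulrC _ a) ltrBlDl lerBrDl andbC.
have leb (i : interval R) := lebesgue_measure_itv i.
rewrite [LHS]leb/= lte_fin.
have [a_|a_] := boolP (0 < a); rewrite [X in (_ * X)%E]leb/= lte_fin.
  rewrite ltr_pM2r ?invr_gt0// ltrD2r; case: ifPn => // uv.
    by rewrite -!EFinB -EFinM gtr0_norm//; congr EFin; field.
  by rewrite mule0.
have {a_}a_ : a < 0 by rewrite lt_neqAle a0 leNgt.
rewrite ltr_nM2r ?invr_lt0// ltrD2r; case: ifPn => // uv.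
  by rewrite -!EFinB -EFinM ltr0_norm//; congr EFin; field.
by rewrite mule0.
Qed.

Lemma ge0_integral_affine (x a : R) (F : RT -> \bar R) : a != 0 ->
  measurable_fun [set: RT] F -> (forall t, 0 <= F t)%E ->
  (\int[mu]_t F t = `|a|%:E * \int[mu]_t F (x + a * t)%R)%E.
Proof.
move=> a0 mF F0.
have k0 : 0 <= `|a| by [].
pose m := mscale (NngNum k0) (measure_function_pushforward__canonical__measure_function_Measure mu (measurable_affine x a)).
rewrite (@eq_measure_integral _ _ _ setT m); last first.
  by move=> A mA _; exact/esym/(lebesgue_measure_affine x a0 mA).
rewrite ge0_integral_mscale//=; congr (_ * _)%E.
rewrite ge0_integral_pushforward//.
exact: measurable_affine.
Qed.

Lemma ge0_integral_lebesgue_tupleS n (F : n.+1.-tuple RT -> \bar R) :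
  measurable_fun setT F -> (forall t, 0 <= F t)%E ->
  (\int[lebesgue_tuple R n.+1]_t F t =
   \int[mu]_a \int[lebesgue_tuple R n]_t F (tcons (a, t)))%E.
Proof.
move=> mF F0.
rewrite -[LHS]/(\int[pushforward (mu \x lebesgue_tuple R n) (@tcons R n)]_t F t)%E.
have mc := @measurable_tcons R n.
rewrite ge0_integral_pushforward//.
rewrite preimage_setT fubini_tonelli1//; last by move=> x; exact: F0.
exact: (measurableT_comp mF mc).
Qed.

Lemma measurable_tcons2 n (a : RT) :
  measurable_fun setT (fun t : n.-tuple RT => tcons (a, t)).
Proof. by apply: measurable_cons => //; exact: measurable_id. Qed.

Lemma measurable_integral_tcons n (F : n.+1.-tuple RT -> \bar R) :
  measurable_fun setT F -> (forall t, 0 <= F t)%E ->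
  measurable_fun setT
    (fun a : RT => \int[lebesgue_tuple R n]_t F (tcons (a, t)))%E.
Proof.
move=> mF F0.
have mc := @measurable_tcons R n.
apply: (@measurable_fun_fubini_tonelli_F _ _ _ _ R (lebesgue_tuple R n)
  (F \o @tcons R n)); first exact: (measurableT_comp mF mc).
by move=> x; exact: F0.
Qed.

Definition affine_tuple n (x : 'rV[R]_n) (a : R) (t : n.-tuple RT) : n.-tuple RT :=
  [tuple (x ord0 i + a * tnth t i : RT) | i < n].

Lemma measurable_affine_tuple n (x : 'rV[R]_n) (a : R) :
  measurable_fun setT (affine_tuple x a).
Proof.
apply/measurable_fun_tnthP => i.
rewrite (_ : _ \o _ = (fun s => x ord0 i + a * s) \o (@tnth _ RT ^~ i)).
  apply: measurableT_comp; [exact: measurable_affine|exact: measurable_tnth].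
by apply/funext => t/=; rewrite tnth_mktuple.
Qed.

Lemma affine_tcons n (x : 'rV[R]_n.+1) (a b : R) (t : n.-tuple RT) :
  affine_tuple x a (tcons (b, t)) =
  tcons (x ord0 ord0 + a * b : RT, affine_tuple (\row_i x ord0 (lift ord0 i)) a t).
Proof.
apply/eq_from_tnth => i; rewrite tnth_mktuple.
have [j ->|->] := unliftP ord0 i; last by [].
by rewrite !tnthS tnth_mktuple mxE.
Qed.

(** Induction on the dimension: Tonelli splits off the first coordinate, whose change of variables
    supplies one factor [|a|]. The instances of later use are reflections and dilations. *)
Lemma ge0_integral_affine_tuple n (x : 'rV[R]_n) (a : R)
    (F : n.-tuple RT -> \bar R) : a != 0 ->
  measurable_fun setT F -> (forall t, 0 <= F t)%E ->
  (\int[lebesgue_tuple R n]_t F t =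
   (`|a| ^+ n)%:E * \int[lebesgue_tuple R n]_t F (affine_tuple x a t))%E.
Proof.
move=> a0; elim: n x F => [x F mF F0|n IHn x F mF F0].
  rewrite expr0 mul1e; apply: eq_integral => t _.
  by congr F; apply: eq_from_tnth => -[].
have mG : measurable_fun setT (F \o affine_tuple x a).
  by apply: measurableT_comp => //; exact: measurable_affine_tuple.
have G0 t : (0 <= (F \o affine_tuple x a) t)%E by exact: F0.
rewrite ge0_integral_lebesgue_tupleS//.
rewrite (ge0_integral_affine (x ord0 ord0) a0); last 2 first.
- exact: measurable_integral_tcons.
- by move=> t; exact: integral_ge0.
rewrite (@ge0_integral_lebesgue_tupleS _ (F \o affine_tuple x a))//.
rewrite exprS EFinM -muleA; congr (_ * _)%E.
rewrite -ge0_integralZl//; last 2 first.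
- exact: (@measurable_integral_tcons _ (F \o affine_tuple x a)).
- by move=> t _; apply: integral_ge0 => s _; exact: F0.
apply: eq_integral => b _.
rewrite (IHn (\row_i x ord0 (lift ord0 i))) //; last first.
  by apply: (measurableT_comp mF); exact: measurable_tcons2.
by congr (_ * _)%E; apply: eq_integral => t _; rewrite /= affine_tcons.
Qed.

Lemma lebesgue_tuple_set1 n (x : n.-tuple RT) : (0 < n)%N ->
  lebesgue_tuple R n [set x] = 0%E.
Proof.
move=> n0.
rewrite (_ : [set x] = [set t | forall i, [set tnth x i] (tnth t i)]); last first.
  apply/seteqP; split => [_ -> //|t /= xt].
  by apply: eq_from_tnth => i; rewrite xt.
rewrite [LHS](@lebesgue_tuple_box R n (fun i => [set tnth x i])); last first.
  by move=> i; exact: measurable_set1.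
rewrite (bigD1 (Ordinal n0))//=.
by rewrite [X in (X * _)%E]lebesgue_measure_set1 mul0e.
Qed.

Lemma ge0_integral_prod_tnth n (g : 'I_n -> RT -> \bar R) :
  (forall i, measurable_fun setT (g i)) -> (forall i t, 0 <= g i t)%E ->
  (\int[lebesgue_tuple R n]_t \prod_(i < n) g i (tnth t i) =
   \prod_(i < n) \int[mu]_s g i s)%E.
Proof.
elim: n g => [g mg g0|n IHn g mg g0].
  rewrite big_ord0; under eq_integral do rewrite big_ord0.
  rewrite integral_cst//= mul1e diracE mem_set//.
have mp k (h : 'I_k -> RT -> \bar R) : (forall i, measurable_fun setT (h i)) ->
    measurable_fun setT (fun t : k.-tuple RT => \prod_(i < k) h i (tnth t i))%E.
  move=> mh.
  have mpseq s : measurable_fun setT (fun t : k.-tuple RT => \prod_(i <- s) h i (tnth t i))%E; last exact: mpseq.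
  elim: s => [|i s ih].
    by under eq_fun do rewrite big_nil; exact: measurable_cst.
  under eq_fun do rewrite big_cons.
  apply: emeasurable_funM => //.
  apply: (measurableT_comp (mh i)); exact: measurable_tnth.
rewrite ge0_integral_lebesgue_tupleS//; last 2 first.
- exact: mp.
- by move=> t; apply: prode_ge0 => *.
rewrite big_ord_recl -IHn//.
rewrite muleC -ge0_integralZl//; last first.
  by apply: integral_ge0 => t _; apply: prode_ge0 => *.
apply: eq_integral => a _.
rewrite (eq_integral (fun t : n.-tuple RT =>
  g ord0 a * \prod_(i < n) g (lift ord0 i) (tnth t i))%E); last first.
  move=> t _; rewrite big_ord_recl; congr (_ * _)%E.
  by apply: eq_bigr => i _; rewrite tnthS.
rewrite ge0_integralZl//; last 2 first.
- exact: (mp _ (fun i => g (lift ord0 i))).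
- by move=> t _; apply: prode_ge0 => *.
by rewrite muleC.
Qed.

End lebesgue_tuple_theory.

(** * One-variable integrals behind the singular majorant *)

Section one_dimensional_weights.
Context {R : realType}.
Local Notation RT := (measurableTypeR R).
Local Notation mu := (@lebesgue_measure R).

(** Inversion is discontinuous at 0, where its value is 0 by convention. The product of x and the
    power -1 of x^2 has the same value there and is measurable factor by factor. *)
Lemma measurable_invr : measurable_fun [set: RT] (fun x : RT => x^-1 : RT).
Proof.
rewrite (_ : (fun x => _) = (fun x : RT => x * (x ^+ 2) `^ (-1))); last first.
  apply/funext => x; rewrite powR_inv1 ?sqr_ge0//.
  have [->|x0] := eqVneq x 0; first by rewrite invr0 mul0r.
  by rewrite expr2 invfM mulrA divff// mul1r.
apply: measurable_funM => //.
apply: (measurableT_comp (measurable_powR (-1))).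
exact: exprn_measurable.
Qed.

Lemma measurable_sqrtr : measurable_fun [set: RT] (@Num.sqrt R : RT -> RT).
Proof. by apply: continuous_measurable_fun; exact: sqrt_continuous. Qed.

(** On [1/(k+1), 1] the primitive 2 sqrt x is regular and gives at most 2; monotone convergence in k
    reaches the singular end point. *)
Lemma integral_invsqrt_le :
  (\int[mu]_(x in `]0%R, 1%R]) ((Num.sqrt x)^-1)%:E <= 2%:E)%E.
Proof.
have F k : {in `[k.+1%:R^-1, 1], forall x, x > (0 : R)}.
  by move=> x; rewrite in_itv/= => /andP[+ _]; apply: lt_le_trans; rewrite invr_gt0.
have mi : measurable_fun setT (fun x : RT => ((Num.sqrt x)^-1)%:E).
  apply/measurable_EFinP; apply: (measurableT_comp measurable_invr).
  exact: measurable_sqrtr.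
have I0 (x : R) : (0 <= ((Num.sqrt x)^-1)%:E)%E.
  by rewrite lee_fin invr_ge0 sqrtr_ge0.
rewrite itv_open_bnd_bigcup.
have ndF : nondecreasing_seq (fun k : nat => `[0 + k.+1%:R^-1, 1 : R]%classic).
  move=> i j ij; rewrite subsetEset => x/=; rewrite !add0r !in_itv/= => /andP[ix ->].
  rewrite andbT (le_trans _ ix)// lef_pV2 ?posrE// ler_nat ltnS//.
pose D (i : nat) : set RT := `[(0 + i.+1%:R^-1)%R, 1%R]%classic.
have mD i : measurable (D i) by exact: measurable_itv.
have : (\int[mu]_(x in D i) ((Num.sqrt x)^-1)%:E @[i --> \oo] -->
    \int[mu]_(x in \bigcup_i D i) ((Num.sqrt x)^-1)%:E)%E.
  apply: ge0_nondecreasing_set_cvg_integral => //.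
- by move=> i; exact: measurable_funTS.
move/cvg_lim => <-//; apply: lime_le.
  apply: ereal_nondecreasing_is_cvgn => i j ij; apply: ge0_subset_integral => //.
  - exact: measurable_funTS.
  - by rewrite -subsetEset; exact: ndF.
near=> k.
have k1 : (0 + k.+1%:R^-1 < 1 :> R).
  rewrite add0r invf_lt1// ltr1n; near: k; exists 1%N => //.
rewrite (@continuous_FTC2 _ _ (fun x => 2 * Num.sqrt x) _ _ k1).
- rewrite -EFinB lee_fin sqrtr1 mulr1 gerBl mulr_ge0 ?sqrtr_ge0//.
- apply: continuous_in_subspaceT => x; rewrite add0r inE => /F x0.
  apply: cvgV; last exact: sqrt_continuous.
  by rewrite gt_eqF// sqrtr_gt0.
- split.
  + move=> x /subset_itv_oo_cc; rewrite add0r => /F x0.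
    apply: derivableM => //.
    by case: (is_derive1_sqrt x0).
  + by apply: cvg_at_right_filter; apply: cvgM; [exact: cvg_cst|exact: sqrt_continuous].
  + by apply: cvg_at_left_filter; apply: cvgM; [exact: cvg_cst|exact: sqrt_continuous].
- move=> x /subset_itv_oo_cc; rewrite add0r => /F x0.
  rewrite derive1E deriveMl; last by case: (is_derive1_sqrt x0).
  rewrite derive_sqrt// invfM mulrA divff ?mul1r//.
Unshelve. all: by end_near. Qed.

(** One coordinate of the product that dominates [sing]: the n factors 1 + |a-s|^(-1/2) together
    control |x-y|^-2, and the factors (1 + s^2)^-1 control (1 + |y|^2)^-n. *)
Definition sing_weight (a s : R) : R :=
  (1 + (Num.sqrt `|a - s|)^-1) / (1 + s ^+ 2).

Lemma measurable_sing_weight a : measurable_fun [set: RT] (sing_weight a : RT -> RT).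
Proof.
apply: measurable_funM.
  apply: measurable_funD => //; apply: (measurableT_comp measurable_invr).
  apply: (measurableT_comp measurable_sqrtr).
  apply: measurableT_comp => //; exact: measurable_funB.
apply: (measurableT_comp measurable_invr); apply: measurable_funD => //.
Qed.

Lemma sing_weight_ge0 a s : 0 <= sing_weight a s.
Proof.
by rewrite divr_ge0// addr_ge0 ?invr_ge0 ?sqrtr_ge0 ?sqr_ge0.
Qed.

Lemma integral_sing_weight :
  exists C : R, forall a, (\int[mu]_s (sing_weight a s)%:E <= C%:E)%E.
Proof.
(* [h] carries the singularity and [k] one half of the tail. At negative arguments [h] is 0, since
   [sqrt] vanishes there and [0^-1 = 0]; thus [h (a - s) + h (s - a)] serves both sides of [a]. *)
pose h (s : R) : R := if s <= 1 then (Num.sqrt s)^-1 else 0.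
pose k (s : R) : R := if 0 <= s then (oneDsqr s)^-1 else 0.
have k0 s : 0 <= k s by rewrite /k; case: ifP => // _; rewrite invr_ge0.
have h0 s : 0 <= h s by rewrite /h; case: ifP => // _; rewrite invr_ge0 sqrtr_ge0.
have mk : measurable_fun [set: RT] (k : RT -> RT).
  apply: measurable_fun_ifT => //=.
    exact: measurable_fun_ler.
  exact: continuous_measurable_fun continuous_oneDsqrV.
have mh : measurable_fun [set: RT] (h : RT -> RT).
  apply: measurable_fun_ifT => //=.
    exact: measurable_fun_ler.
  apply: (measurableT_comp measurable_invr); exact: measurable_sqrtr.
have Ik : (\int[mu]_s (k s)%:E = (pi / 2)%:E)%E.
  rewrite -integral0y_oneDsqr [RHS]integral_mkcond; apply: eq_integral => s _.
  rewrite /k patchE mem_setE in_itv/= andbT.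
  by case: ifP.
have Ih : (\int[mu]_s (h s)%:E <= 2%:E)%E.
  apply: le_trans integral_invsqrt_le; rewrite [leRHS]integral_mkcond.
  apply: ge0_le_integral => //.
  - by move=> s _; rewrite lee_fin.
  - exact/measurable_EFinP.
  - apply: (iffLR (measurable_restrictT _ _)) => //.
    apply/measurable_EFinP; apply: measurable_funTS.
    apply: (measurableT_comp measurable_invr); exact: measurable_sqrtr.
  - move=> s _; rewrite patchE mem_setE in_itv/= /h.
    case: (leP s 0) => [s0|s0]/=; last by case: ifP.
    by case: ifP => //; rewrite ler0_sqrtr// invr0.
exists (pi / 2 + pi / 2 + (pi / 2 + pi / 2) + (2 + 2)) => a.
have aff x b (f : R -> R) : b != 0 -> measurable_fun [set: RT] (f : RT -> RT) ->
    measurable_fun [set: RT] (fun s : RT => (f (x + b * s))%:E).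
  move=> b0 mf; apply/measurable_EFinP; apply: (measurableT_comp mf).
  exact: measurable_affine.
have affI x b (f : R -> R) : b != 0 -> `|b| = 1 -> (forall s, 0 <= f s) ->
    measurable_fun [set: RT] (f : RT -> RT) ->
    (\int[mu]_s (f (x + b * s)%R)%:E = \int[mu]_s (f s)%:E)%E.
  move=> b0 b1 f0 mf; rewrite (ge0_integral_affine x b0 (F := EFin \o f)) ?b1 ?mul1e//.
    exact/measurable_EFinP.
have N10 : -1 != 0 :> R by rewrite oppr_eq0 oner_eq0.
have mkN : measurable_fun setT (fun s : RT => (k (0 + -1 * s))%:E) by exact: aff.
have mh1 : measurable_fun setT (fun s : RT => (h (a + -1 * s))%:E) by exact: aff.
have mh2 : measurable_fun setT (fun s : RT => (h (- a + 1 * s))%:E) by exact: aff.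
have mkE : measurable_fun setT (fun s : RT => (k s)%:E) by exact/measurable_EFinP.
(* The regular part is below [k s + k (- s)]. The singular part is below the [h] terms when |a - s|
   <= 1, and below a second copy of the [k] terms otherwise, the inverse root then being at most 1.
   Translation invariance removes [a] from the bound. *)
apply: (@le_trans _ _ (\int[mu]_s ((k s)%:E + (k (0 + -1 * s))%:E +
   ((k s)%:E + (k (0 + -1 * s))%:E) + ((h (a + -1 * s))%:E + (h (- a + 1 * s))%:E)))%E).
  apply: ge0_le_integral => //.
  - by move=> s _; rewrite lee_fin sing_weight_ge0.
  - by apply/measurable_EFinP; exact: measurable_sing_weight.
  - by repeat apply: emeasurable_funD.
  - move=> s _; rewrite -!EFinD lee_fin add0r !mulN1r mul1r (addrC (- a)).
    have kk : k s + k (- s) >= (1 + s ^+ 2)^-1.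
      have [s0|s0] := leP 0 s; first by rewrite ler_wpDr// /k s0.
      have Ns : 0 <= - s by rewrite oppr_ge0 ltW.
      by rewrite ler_wpDl// /k Ns /oneDsqr sqrrN.
    have s21 : 0 < 1 + s ^+ 2 by rewrite ltr_pwDl// sqr_ge0.
    have i1 : (1 + s ^+ 2)^-1 <= 1 by rewrite invf_le1// lerDl sqr_ge0.
    have i0 : 0 <= (1 + s ^+ 2)^-1 by rewrite invr_ge0 ltW.
    have hh : `|a - s| <= 1 -> (Num.sqrt `|a - s|)^-1 <= h (a - s) + h (s - a).
      move=> as1; have [as0|as0] := leP 0 (a - s).
        by rewrite ger0_norm in as1 *; rewrite // ler_wpDr// /h as1.
      rewrite ltr0_norm// opprB in as1 *.
      by rewrite ler_wpDl// /h as1.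
    rewrite /sing_weight mulrDl mul1r.
    have kk0 : 0 <= k s + k (- s) by rewrite addr_ge0.
    have hh0 : 0 <= h (a - s) + h (s - a) by rewrite addr_ge0.
    have [as1|as1] := leP `|a - s| 1.
      have : (Num.sqrt `|a - s|)^-1 / (1 + s ^+ 2) <= h (a - s) + h (s - a).
        apply: le_trans (hh as1).
        by rewrite ler_piMr// invr_ge0 sqrtr_ge0.
      by move: kk kk0; lra.
    have : (Num.sqrt `|a - s|)^-1 / (1 + s ^+ 2) <= k s + k (- s).
      apply: le_trans kk.
      rewrite ler_piMl// invf_le1 ?sqrtr_gt0 ?(lt_trans _ as1)//.
      by rewrite -[leLHS]sqrtr1 ler_sqrt ltW// (lt_trans _ as1).
    by move: kk kk0 hh0; lra.
rewrite !ge0_integralD//; (try by move=> *; rewrite ?adde_ge0 ?lee_fin//);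
  (try by repeat apply: emeasurable_funD).
rewrite !(affI _ _ _ _ _ k0)// ?normrN1//.
rewrite (affI _ _ _ _ _ h0)// ?normrN1// (affI _ _ _ _ _ h0)// ?normr1//.
have Ik' : (\int[mu]_s (k s)%:E <= (pi / 2)%:E)%E by rewrite Ik.
rewrite [in leRHS]EFinD; apply: leeD; last by rewrite EFinD; apply: leeD; exact: Ih.
by rewrite EFinD; apply: leeD; rewrite EFinD; apply: leeD; exact: Ik'.
Qed.

End one_dimensional_weights.

(** * Integration over row vectors *)

Section functions_on_rV.
Context {R : realType}.
Local Notation RT := (measurableTypeR R).
Implicit Type n : nat.

Definition sqn n (x : 'rV[R]_n) : R := \sum_i x 0 i ^+ 2.

Definition mble n (f : 'rV[R]_n -> R) : Prop :=
  measurable_fun setT (fun t : n.-tuple RT => f (row_of_tuple t) : RT).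

Definition itgble n (f : 'rV[R]_n -> R) : Prop :=
  (lebesgue_tuple R n).-integrable setT (fun t => (f (row_of_tuple t))%:E).

Definition itg n (f : 'rV[R]_n -> R) : R :=
  \int[lebesgue_tuple R n]_t f (row_of_tuple t).

Lemma sqn_ge0 n (x : 'rV[R]_n) : 0 <= sqn x.
Proof. by apply: sumr_ge0 => i _; exact: sqr_ge0. Qed.

Lemma sqn_gt0 n (x : 'rV[R]_n) : x != 0 -> 0 < sqn x.
Proof.
move=> x0; rewrite lt_neqAle sqn_ge0 andbT eq_sym; apply: contra x0.
rewrite psumr_eq0; last by move=> i _; exact: sqr_ge0.
move=> /allP x0; apply/eqP/rowP => i; rewrite mxE.
by have := x0 i (mem_index_enum _); rewrite /= sqrf_eq0 => /eqP.
Qed.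

Lemma sqn0 n : sqn (0 : 'rV[R]_n) = 0.
Proof. by rewrite /sqn big1// => i _; rewrite mxE expr0n. Qed.

Lemma sqnN n (x : 'rV[R]_n) : sqn (- x) = sqn x.
Proof. by apply: eq_bigr => i _; rewrite mxE sqrrN. Qed.

Lemma sqnZ n (a : R) (x : 'rV[R]_n) : sqn (a *: x) = a ^+ 2 * sqn x.
Proof. by rewrite mulr_sumr; apply: eq_bigr => i _; rewrite mxE exprMn. Qed.

Lemma sqnD_le n (x y : 'rV[R]_n) : sqn (x + y) <= 2 * sqn x + 2 * sqn y.
Proof.
rewrite !mulr_sumr -big_split/=; apply: ler_sum => i _; rewrite mxE.
by have := sqr_ge0 (x 0 i - y 0 i); rewrite !expr2; nra.
Qed.

Lemma sqn_coord n (x : 'rV[R]_n) i : x 0 i ^+ 2 <= sqn x.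
Proof.
by rewrite /sqn (bigD1 i)//= lerDl sumr_ge0// => j _; exact: sqr_ge0.
Qed.

(** Peetre's inequality. It carries polynomial weights from one variable to another inside a
    convolution, at the cost of a polynomial in the third. *)
Lemma peetre n (x y : 'rV[R]_n) :
  1 + sqn y <= 2 * (1 + sqn x) * (1 + sqn (x - y)).
Proof.
have := sqnD_le x (- (x - y)); rewrite opprB addrC subrK.
rewrite -[y - x]opprB sqnN.
have := sqn_ge0 x; have := sqn_ge0 (x - y); nra.
Qed.

Definition tuple_of_row n (x : 'rV[R]_n) : n.-tuple RT := [tuple x 0 i : RT | i < n].

Lemma row_of_tupleK n (t : n.-tuple RT) : tuple_of_row (row_of_tuple t) = t.
Proof. by apply: eq_from_tnth => i; rewrite tnth_mktuple mxE. Qed.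

Lemma row_of_affine_tuple n (x : 'rV[R]_n) a (t : n.-tuple RT) :
  row_of_tuple (affine_tuple x a t) = x + a *: row_of_tuple t.
Proof. by apply/rowP => i; rewrite !mxE tnth_mktuple. Qed.

Lemma mble_coord n i : mble (fun x : 'rV[R]_n => x 0 i).
Proof.
rewrite /mble (_ : (fun t => _) = (@tnth _ RT ^~ i)).
  exact: measurable_tnth.
by apply/funext => t; rewrite mxE.
Qed.

Lemma mble_comp n (g : R -> R) (f : 'rV[R]_n -> R) :
  measurable_fun [set: RT] (g : RT -> RT) -> mble f -> mble (fun x => g (f x)).
Proof. by move=> mg mf; apply: (measurableT_comp mg mf). Qed.

Lemma mble_cst n (c : R) : mble (fun _ : 'rV[R]_n => c).
Proof. exact: measurable_cst. Qed.

Lemma mbleD n (f g : 'rV[R]_n -> R) : mble f -> mble g -> mble (fun x => f x + g x).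
Proof. by move=> mf mg; apply: measurable_funD. Qed.

Lemma mbleB n (f g : 'rV[R]_n -> R) : mble f -> mble g -> mble (fun x => f x - g x).
Proof. by move=> mf mg; apply: measurable_funB. Qed.

Lemma mbleM n (f g : 'rV[R]_n -> R) : mble f -> mble g -> mble (fun x => f x * g x).
Proof. by move=> mf mg; apply: measurable_funM. Qed.

(** Links the topology of row vectors to the product sigma-algebra of tuples: an open set is a
    countable union of cubes with rational centre and half-side 1/(k+1), and each cube is a finite
    intersection of conditions on single coordinates. *)
Lemma mble_continuous n (f : 'rV[R]_n -> R) : continuous f -> mble f.
Proof.
move=> cf; apply: (measurability _ (RGenOpens.measurableE R)).
move=> _ [_ [a [b ->] <-]]; rewrite setTI.
have oO : open (f @^-1` `]a, b[%classic).
  by move/continuousP : cf; apply; exact: interval_open.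
pose box (c : n.-tuple rat) (k : nat) : set 'rV[R]_n :=
  [set x | forall i, `|x 0 i - ratr (tnth c i)| < k.+1%:R^-1].
have -> : (fun t : n.-tuple RT => f (row_of_tuple t)) @^-1` `]a, b[%classic =
    \bigcup_(u : n.-tuple rat * nat)
      (* Cubes that are not contained in the preimage are replaced by the empty set, so that the
         union runs over a fixed countable type. *)
      (if `[< box u.1 u.2 `<=` f @^-1` `]a, b[%classic >]
       then [set t | box u.1 u.2 (row_of_tuple t)] else set0).
  apply/seteqP; split => [t ft|t [u _]]; last first.
    by case: asboolP => // bO /bO.
  move: oO; rewrite openE => /(_ _ ft); rewrite /interior => /nbhs_ballP[e /= e0 be].
  have [k ke] : exists k, k.+1%:R^-1 < e / 2.
    have := near_infty_natSinv_lt (PosNum (divr_gt0 e0 (ltr0n R 2))).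
    by case=> N _ /(_ N (leqnn N)) /= ?; exists N.
  have k0 : 0 < k.+1%:R^-1 :> R by rewrite invr_gt0.
  have cP i : exists c : rat, `|tnth t i - ratr c| < k.+1%:R^-1.
    pose ti : R := tnth t i; rewrite -/ti.
    have /rat_in_itvoo[c] : ti - k.+1%:R^-1 < ti + k.+1%:R^-1.
      by rewrite ltrBlDr -addrA ltrDl addr_gt0.
    rewrite in_itv/= => /andP[c1 c2]; exists c.
    by rewrite ltr_distlC c1.
  pose c := [tuple xchoose (cP i) | i < n].
  exists (c, k) => //=; case: asboolP => [_ /= i|].
    by rewrite tnth_mktuple mxE; exact: xchooseP (cP i).
  case => x /= xc; apply: be; rewrite -ball_normE/=.
  have : ball (row_of_tuple t) e x.
    split => // i j; rewrite ord1 -ball_normE/= mxE.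
    have := xc j; rewrite tnth_mktuple => h1.
    have := xchooseP (cP j) => h2.
    have := ler_normB (tnth t j - ratr (xchoose (cP j))) (x 0 j - ratr (xchoose (cP j))).
    rewrite opprB addrA subrK => /le_lt_trans; apply.
    apply: (lt_trans (ltrD h2 h1)); rewrite (_ : e = e / 2 + e / 2); last by field.
    exact: ltrD.
  by rewrite -ball_normE.
apply: countable_bigcupT_measurable; first exact: countableP.
move=> [c k] /=; case: asboolP => // _.
rewrite (_ : mkset _ = \bigcap_(i in [set: 'I_n])
  ((fun t : n.-tuple RT => `|tnth t i - ratr (tnth c i)|) @^-1` `]-oo, k.+1%:R^-1[%classic)).
  apply: fin_bigcap_measurable => // i _; rewrite -[X in measurable X]setTI.
  apply: (_ : measurable_fun setT (fun t : n.-tuple RT => `|tnth t i - ratr (tnth c i)| : RT)) => //.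
  apply: measurableT_comp => //; apply: measurable_funB => //.
  exact: measurable_tnth.
apply/seteqP; split => t /= bt i.
  by move=> _; have := bt i; rewrite /= mxE in_itv.
by have := bt i I; rewrite /= mxE in_itv.
Qed.

Lemma mbleX n (f : 'rV[R]_n -> R) k : mble f -> mble (fun x => f x ^+ k).
Proof. by apply: (mble_comp (g := fun s => s ^+ k)); exact: exprn_measurable. Qed.

Lemma mbleV n (f : 'rV[R]_n -> R) : mble f -> mble (fun x => (f x)^-1).
Proof. by apply: (mble_comp (g := fun s => s^-1)); exact: measurable_invr. Qed.

Lemma mble_abs n (f : 'rV[R]_n -> R) : mble f -> mble (fun x => `|f x|).
Proof. by apply: (mble_comp (g := fun s => `|s|)); exact: normr_measurable. Qed.

Lemma mble_expR n (f : 'rV[R]_n -> R) : mble f -> mble (fun x => expR (f x)).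
Proof. by apply: (mble_comp (g := expR)); exact: measurable_expR. Qed.

Lemma mble_ln n (f : 'rV[R]_n -> R) : mble f -> mble (fun x => ln (f x)).
Proof. by apply: (mble_comp (g := @ln R)); exact: measurable_ln. Qed.

Lemma mble_affine n (f : 'rV[R]_n -> R) x a : mble f -> mble (fun z => f (x + a *: z)).
Proof.
move=> mf.
have := measurableT_comp mf (measurable_affine_tuple x a).
by rewrite /mble; under [X in _ -> measurable_fun _ X]eq_fun do
  rewrite -row_of_affine_tuple.
Qed.

Lemma mble_sum n k (F : 'I_k -> 'rV[R]_n -> R) : (forall i, mble (F i)) ->
  mble (fun x => \sum_i F i x).
Proof.
move=> mF; rewrite /mble.
exact: (@measurable_sum _ _ R _ _ _ (fun i t => F i (row_of_tuple t))).
Qed.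

Lemma mble_sqn n : mble (@sqn n).
Proof. by apply: mble_sum => i; apply: mbleX; exact: mble_coord. Qed.

Lemma itgble_mble n (f : 'rV[R]_n -> R) : itgble f -> mble f.
Proof. by move=> /integrableP[/measurable_EFinP]. Qed.

Lemma itgble_le n (f g : 'rV[R]_n -> R) : mble f -> itgble g ->
  (forall x, `|f x| <= g x) -> itgble f.
Proof.
move=> mf ig fg; apply: le_integrable ig => //; first exact/measurable_EFinP.
by move=> t _; rewrite lee_fin (le_trans (fg _))// ler_norm.
Qed.

Lemma itgbleD n (f g : 'rV[R]_n -> R) : itgble f -> itgble g ->
  itgble (fun x => f x + g x).
Proof.
move=> fi gi; rewrite /itgble; under eq_fun do rewrite EFinD.
exact: integrableD.
Qed.

Lemma itgbleB n (f g : 'rV[R]_n -> R) : itgble f -> itgble g ->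
  itgble (fun x => f x - g x).
Proof.
move=> fi gi; rewrite /itgble; under eq_fun do rewrite EFinB.
exact: integrableB.
Qed.

Lemma itgbleZ n (f : 'rV[R]_n -> R) c : itgble f -> itgble (fun x => c * f x).
Proof.
move=> fi; rewrite /itgble; under eq_fun do rewrite EFinM.
exact: integrableZl.
Qed.

Lemma itgble_abs n (f : 'rV[R]_n -> R) : itgble f -> itgble (fun x => `|f x|).
Proof. by move=> fi; exact: integrable_abse fi. Qed.

Lemma itgD n (f g : 'rV[R]_n -> R) : itgble f -> itgble g ->
  itg (fun x => f x + g x) = itg f + itg g.
Proof. by move=> fi gi; apply: RintegralD. Qed.

Lemma itgB n (f g : 'rV[R]_n -> R) : itgble f -> itgble g ->
  itg (fun x => f x - g x) = itg f - itg g.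
Proof. by move=> fi gi; apply: RintegralB. Qed.

Lemma itgZ n (f : 'rV[R]_n -> R) c : itgble f -> itg (fun x => c * f x) = c * itg f.
Proof. by move=> fi; apply: RintegralZl. Qed.

Lemma itg_ge0 n (f : 'rV[R]_n -> R) : (forall x, 0 <= f x) -> 0 <= itg f.
Proof. by move=> f0; apply: Rintegral_ge0. Qed.

Lemma le_itg n (f g : 'rV[R]_n -> R) : itgble f -> itgble g ->
  (forall x, f x <= g x) -> itg f <= itg g.
Proof. by move=> fi gi fg; apply: le_Rintegral. Qed.

Lemma itgE n (f : 'rV[R]_n -> R) : itgble f ->
  integral_Rn (fun x => (f x)%:E) = (itg f)%:E.
Proof. by move=> fi; rewrite /itg /Rintegral fineK//; exact: integrable_fin_num. Qed.

Lemma le_normr_itg n (f g : 'rV[R]_n -> R) : mble f -> itgble g ->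
  (forall x, `|f x| <= g x) -> `|itg f| <= itg g.
Proof.
move=> mf gi fg; have fi := itgble_le mf gi fg.
apply: (le_trans (le_normr_Rintegral _ _)) => //.
apply: (@le_itg _ (fun x => `|f x|)) => //; exact: itgble_abs.
Qed.

Lemma negligible_point n (p : 'rV[R]_n) : (0 < n)%N ->
  (lebesgue_tuple R n).-negligible [set t | row_of_tuple t = p].
Proof.
move=> n0; exists [set tuple_of_row p]; split.
- rewrite (_ : [set _] = \bigcap_(i in [set: 'I_n]) ((@tnth _ RT ^~ i) @^-1` [set p 0 i])).
    apply: fin_bigcap_measurable => // i _; rewrite -[X in measurable X]setTI.
    by apply: measurable_tnth => //; exact: measurable_set1.
  apply/seteqP; split => [_ -> i _ /=|t /= tp]; first by rewrite tnth_mktuple.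
  by apply: eq_from_tnth => i; rewrite tnth_mktuple; exact: tp.
- exact: lebesgue_tuple_set1.
- by move=> t /= <-; rewrite row_of_tupleK.
Qed.

(** The kernels take the conventional values [ln 0 = 0] and [0^-1 = 0] at their singularity, where
    pointwise bounds may fail. This and the next three lemmas discard that single point. *)
Lemma ae_off_point n (p : 'rV[R]_n) (P : 'rV[R]_n -> Prop) : (0 < n)%N ->
  (forall x, x != p -> P x) -> {ae lebesgue_tuple R n, forall t, P (row_of_tuple t)}.
Proof.
move=> n0 pP; apply: negligibleS (negligible_point p n0) => t /= /contra_notP; apply.
by move/eqP/pP.
Qed.

Lemma itgble_le_off n (p : 'rV[R]_n) (f g : 'rV[R]_n -> R) : (0 < n)%N ->
  mble f -> itgble g -> (forall x, x != p -> `|f x| <= g x) -> itgble f.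
Proof.
move=> n0 mf ig fg; apply/integrableP; split; first exact/measurable_EFinP.
have /integrableP[mg] := ig; apply: le_lt_trans; apply: ae_ge0_le_integral => //.
- by apply: measurableT_comp => //; exact/measurable_EFinP.
- exact: measurableT_comp.
- have : {ae lebesgue_tuple R n, forall t,
      `|f (row_of_tuple t)| <= g (row_of_tuple t)} by exact: ae_off_point fg.
  apply: filterS => t fgt _.
  by rewrite lee_fin (le_trans fgt)// ler_norm.
Qed.

Lemma le_itg_off n (p : 'rV[R]_n) (f g : 'rV[R]_n -> R) : (0 < n)%N ->
  itgble f -> itgble g -> (forall x, x != p -> f x <= g x) -> itg f <= itg g.
Proof.
move=> n0 fi gi fg.
rewrite -subr_ge0 -itgB// /itg /Rintegral fine_ge0//.
rewrite -(@ae_eq_integral _ _ _ (lebesgue_tuple R n) setT _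
  (fun t => `|g (row_of_tuple t) - f (row_of_tuple t)|%:E))//.
- by apply: integral_ge0 => t _; rewrite lee_fin.
- apply/measurable_EFinP.
  by apply: (mble_abs (f := fun x => g x - f x)); apply: mbleB; exact: itgble_mble.
- apply/measurable_EFinP.
  by apply: (mbleB (f := g) (g := f)); exact: itgble_mble.
- have : {ae lebesgue_tuple R n, forall t,
      f (row_of_tuple t) <= g (row_of_tuple t)} by exact: ae_off_point fg.
  apply: filterS => t fgt _.
  by rewrite ger0_norm// subr_ge0.
Qed.

Lemma le_normr_itg_off n (p : 'rV[R]_n) (f g : 'rV[R]_n -> R) : (0 < n)%N ->
  mble f -> itgble g -> (forall x, x != p -> `|f x| <= g x) -> `|itg f| <= itg g.
Proof.
move=> n0 mf gi fg; have fi := itgble_le_off n0 mf gi fg.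
apply: (le_trans (le_normr_Rintegral _ _)) => //.
apply: (@le_itg_off _ p (fun x => `|f x|)) => //; exact: itgble_abs.
Qed.

Lemma itgble_affine n (f : 'rV[R]_n -> R) x a : a != 0 -> itgble f ->
  itgble (fun z => f (x + a *: z)).
Proof.
move=> a0 fi; have mf := itgble_mble fi.
have /integrableP[_] := fi.
rewrite (ge0_integral_affine_tuple x a0) //; last first.
  by apply: measurableT_comp => //; exact/measurable_EFinP.
move=> foo; apply/integrableP; split.
  by apply/measurable_EFinP; exact: mble_affine.
have an : 0 < `|a| ^+ n by rewrite exprn_gt0 ?normr_gt0.
have E : (fun t => `|(f (row_of_tuple (affine_tuple x a t)))%:E|%E) =
    (fun t => `|(f (x + a *: row_of_tuple t))%:E|%E).
  by apply/funext => t; rewrite row_of_affine_tuple.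
rewrite ltNge leye_eq; apply/negP => /eqP Ioo; move: foo.
by rewrite E Ioo gt0_muley// ltxx.
Qed.

Lemma itg_affine n (f : 'rV[R]_n -> R) x a : a != 0 -> itgble f ->
  itg f = `|a| ^+ n * itg (fun z => f (x + a *: z)).
Proof.
move=> a0 fi; have fai := itgble_affine x a0 fi; have mf := itgble_mble fi.
pose p f (x : 'rV[R]_n) : R := (`|f x| + f x) / 2.
pose m f (x : 'rV[R]_n) : R := (`|f x| - f x) / 2.
suff [E1 E2] : itg (p f) = `|a| ^+ n * itg (fun z => p f (x + a *: z)) /\
           itg (m f) = `|a| ^+ n * itg (fun z => m f (x + a *: z)).
  have H (g : 'rV[R]_n -> R) : itgble g -> itg g = itg (p g) - itg (m g).
    move=> gi; rewrite -itgB; first by congr itg; apply/funext => z; rewrite /p /m; field.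
    - rewrite /p; under eq_fun do rewrite mulrC.
      by apply: itgbleZ; apply: itgbleD => //; exact: itgble_abs.
    - rewrite /m; under eq_fun do rewrite mulrC.
      by apply: itgbleZ; apply: itgbleB => //; exact: itgble_abs.
  by rewrite (H _ fi) (H _ fai) E1 E2 -mulrBr.
suff H (g : 'rV[R]_n -> R) : mble g -> (forall x, 0 <= g x) ->
    itg g = `|a| ^+ n * itg (fun z => g (x + a *: z)).
  split; apply: H.
  - by apply: mbleM; [apply: mbleD => //; exact: mble_abs|exact: mble_cst].
  - by move=> z; rewrite /p divr_ge0// -lerBlDr sub0r -normrN ler_norm.
  - by apply: mbleM; [apply: mbleB => //; exact: mble_abs|exact: mble_cst].
  - by move=> z; rewrite /m divr_ge0// subr_ge0 ler_norm.
move=> mg g0; rewrite /itg /Rintegral (ge0_integral_affine_tuple x a0)//; last 2 first.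
- exact/measurable_EFinP.
- by move=> t; rewrite lee_fin.
have E : (fun t => (g (row_of_tuple (affine_tuple x a t)))%:E) =
    (fun t => (g (x + a *: row_of_tuple t))%:E).
  by apply/funext => t; rewrite row_of_affine_tuple.
rewrite E.
have : (0 <= \int[lebesgue_tuple R n]_t (g (x + a *: row_of_tuple t))%:E)%E.
  by apply: integral_ge0 => t _; rewrite lee_fin.
(* When the integral is infinite, [fine] sends both sides to 0. *)
case: (\int[_]_t _)%E => [r||]//= _.
by rewrite gt0_muley ?mulr0// lte_fin exprn_gt0// normr_gt0.
Qed.

(** The exponent n leaves one factor 1 + |x|^2 per coordinate, each of which is then bounded below
    by 1 + x_i^2. *)
Definition wgt n (x : 'rV[R]_n) : R := (1 + sqn x) ^- n.

Lemma wgt_gt0 n (x : 'rV[R]_n) : 0 < wgt x.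
Proof. by rewrite invr_gt0 exprn_gt0// ltr_pwDl// sqn_ge0. Qed.

Lemma mble_wgt n : mble (@wgt n).
Proof.
apply: mbleV; apply: mbleX; apply: mbleD; [exact: mble_cst|exact: mble_sqn].
Qed.

Lemma prodr_ge1 k (F : 'I_k -> R) : (forall i, 1 <= F i) -> 1 <= \prod_i F i.
Proof. by move=> F1; elim/big_rec: _ => // i y _ y1; exact: mulr_ege1. Qed.

(** If |z| < 1, let r = |z|^(1/2). Since |z_i| <= |z|, every factor is at least 1/r, and r^-n >=
    r^-4 = |z|^-2 because n >= 4. If |z| >= 1, both sides are separated by 1. *)
Lemma sqnV_le_prod n (z : 'rV[R]_n) : (4 <= n)%N -> (forall i, z 0 i != 0) ->
  (sqn z)^-1 <= \prod_i (1 + (Num.sqrt `|z 0 i|)^-1).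
Proof.
move=> n4 z0.
have n0 : (0 < n)%N by apply: leq_trans n4.
have zp : 0 < sqn z.
  apply: sqn_gt0; apply: contraNneq (z0 (Ordinal n0)) => ->; by rewrite mxE.
have [z1|z1] := leP 1 (sqn z).
  apply: (@le_trans _ _ 1); first by rewrite invf_le1.
  by apply: prodr_ge1 => i; rewrite lerDl invr_ge0 sqrtr_ge0.
pose r := Num.sqrt (Num.sqrt (sqn z)).
have r4 : r ^+ 4 = sqn z.
  by rewrite (exprM _ 2 2) !sqr_sqrtr ?sqrtr_ge0// ltW.
have r0 : 0 < r by rewrite !sqrtr_gt0.
have r1 : r <= 1.
  by rewrite -[leRHS]sqrtr1 ler_wsqrtr// -[leRHS]sqrtr1 ler_wsqrtr// ltW.
apply: (@le_trans _ _ (\prod_(i < n) r^-1)).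
  rewrite prodr_const card_ord -r4 -exprVn ler_weXn2l//.
  by rewrite invf_ge1.
apply: ler_prod => i _; rewrite invr_ge0 (ltW r0)/=.
rewrite ler_wpDl// lef_pV2 ?posrE ?sqrtr_gt0 ?normr_gt0//.
by rewrite ler_wsqrtr// -sqrtr_sqr ler_wsqrtr// sqn_coord.
Qed.

Lemma wgt_le_prod n (x : 'rV[R]_n) : wgt x <= \prod_i (1 + x 0 i ^+ 2)^-1.
Proof.
rewrite (_ : wgt x = \prod_(i < n) (1 + sqn x)^-1); last first.
  by rewrite prodr_const card_ord exprVn.
apply: ler_prod => i _; rewrite invr_ge0 addr_ge0 ?sqn_ge0//=.
rewrite lef_pV2 ?posrE ?ltr_pwDl ?sqr_ge0 ?sqn_ge0//.
by rewrite lerD2l sqn_coord.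
Qed.

(** The universal majorant: a singularity of order |x-y|^-2 on the diagonal and integrable decay in
    [y], with an integral bounded uniformly in [x]. *)
Definition sing n (x y : 'rV[R]_n) : R := (1 + (sqn (x - y))^-1) * wgt y.

Lemma sing_ge0 n (x y : 'rV[R]_n) : 0 <= sing x y.
Proof. by rewrite mulr_ge0 ?(ltW (wgt_gt0 _))// addr_ge0// invr_ge0 sqn_ge0. Qed.

Lemma mble_subl n (f : 'rV[R]_n -> R) x : mble f -> mble (fun z => f (x - z)).
Proof.
move=> /(mble_affine x (-1)).
by rewrite /mble; under eq_fun do rewrite scaleN1r.
Qed.

Lemma mble_sing n (x : 'rV[R]_n) : mble (sing x).
Proof.
apply: mbleM; last exact: mble_wgt.
apply: mbleD; first exact: mble_cst.
by apply: (mbleV (f := fun z => sqn (x - z))); apply: mble_subl; exact: mble_sqn.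
Qed.

Lemma itgble_sing n : (4 <= n)%N ->
  exists C : R, forall x : 'rV[R]_n, itgble (sing x) /\ itg (sing x) <= C.
Proof.
move=> n4; have [C HC] := @integral_sing_weight R.
have n0 : (0 < n)%N by apply: leq_trans n4.
exists (2 * C ^+ n) => x.
pose G (t : n.-tuple RT) : \bar R := (\prod_(i < n) (sing_weight (x ord0 i) (tnth t i))%:E)%E.
have mG : measurable_fun setT G.
  have mpseq s : measurable_fun setT (fun t : n.-tuple RT =>
      \prod_(i <- s) (sing_weight (x ord0 i) (tnth t i))%:E)%E; last exact: mpseq.
  elim: s => [|i s ih].
    by under eq_fun do rewrite big_nil; exact: measurable_cst.
  under eq_fun do rewrite big_cons.
  apply: emeasurable_funM => //; apply/measurable_EFinP.
  apply: (measurableT_comp (measurable_sing_weight _)); exact: measurable_tnth.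
have G0 t : (0 <= G t)%E by apply: prode_ge0 => i _; rewrite lee_fin sing_weight_ge0.
have IG : (\int[lebesgue_tuple R n]_t G t <= (C ^+ n)%:E)%E.
  rewrite (ge0_integral_prod_tnth (g := fun i s => (sing_weight (x ord0 i) s)%:E)); last 2 first.
  - by move=> i; apply/measurable_EFinP; exact: measurable_sing_weight.
  - by move=> i s; rewrite lee_fin sing_weight_ge0.
  have I0 i : (0 <= \int[lebesgue_measure]_s (sing_weight (x ord0 i) s)%:E)%E.
    by apply: integral_ge0 => s _; rewrite lee_fin sing_weight_ge0.
  have If i : (\int[lebesgue_measure]_s (sing_weight (x ord0 i) s)%:E \is a fin_num)%E.
    by rewrite ge0_fin_numE//; apply: le_lt_trans (HC _) _; exact: ltry.
  rewrite (eq_bigr (fun i => (fine (\int[lebesgue_measure]_s (sing_weight (x ord0 i) s)%:E)%E)%:E)); last first.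
    by move=> i _; rewrite fineK.
  rewrite prodEFin lee_fin (_ : C ^+ n = \prod_(i < n) C); last first.
    by rewrite prodr_const card_ord.
  by apply: ler_prod => i _; rewrite fine_ge0//= -lee_fin fineK.
have mS : measurable_fun setT (fun t : n.-tuple RT => (sing x (row_of_tuple t))%:E).
  by apply/measurable_EFinP; exact: mble_sing.
have S0 (t : n.-tuple RT) : (0 <= (sing x (row_of_tuple t))%:E)%E.
  by rewrite lee_fin sing_ge0.
have le2 : (\int[lebesgue_tuple R n]_t (sing x (row_of_tuple t))%:E <= (2 * C ^+ n)%:E)%E.
  rewrite EFinM; apply: le_trans (lee_pmul _ _ (lexx _) IG) => //; last first.
    exact: integral_ge0.
  rewrite -ge0_integralZl//; apply: ae_ge0_le_integral => //.
  - by move=> t _; rewrite mule_ge0.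
  - exact: measurable_funeM.
  (* On a hyperplane y_i = x_i the convention [0^-1 = 0] would lose a factor of the product bound;
     these n hyperplanes are null. *)
  have : {ae lebesgue_tuple R n, forall t, forall i, tnth t i != x ord0 i}.
    apply: filter_forall => i.
    have mA (j : 'I_n) : measurable (if j == i then [set x ord0 i : RT] else setT).
      by case: ifP => // _; exact: measurable_set1.
    exists [set t | forall j : 'I_n, (if j == i then [set x ord0 i : RT] else setT) (tnth t j)].
    split.
    - rewrite (_ : mkset _ = \bigcap_(j in [set: 'I_n]) ((@tnth _ RT ^~ j) @^-1` (if j == i then [set x ord0 i : RT] else setT))).
        apply: fin_bigcap_measurable => // j _; rewrite -[X in measurable X]setTI.
        exact: measurable_tnth.
      by apply/seteqP; split => [t tp j _ /=|t /= tp j]; [exact: tp|exact: tp].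
    - rewrite [LHS](@lebesgue_tuple_box R n (fun j => if j == i then [set x ord0 i : RT] else setT))//.
      by rewrite (bigD1 i)//= eqxx [X in (X * _)%E]lebesgue_measure_set1 mul0e.
    - move=> t /= /negP; rewrite negbK => /eqP tx j.
      by case: eqP => // ->; rewrite tx.
  apply: negligibleS => t /= + tx; apply => _; rewrite /G prodEFin -EFinM lee_fin.
  set y := row_of_tuple t.
  have z0 i : (x - y) 0 i != 0.
    by rewrite !mxE subr_eq0 eq_sym; exact: tx.
  have := sqnV_le_prod n4 z0; have := wgt_le_prod y.
  set A := \prod_i _; set B := \prod_i _ => wA sB.
  rewrite (_ : \prod_i _ = B * A); last first.
    rewrite -big_split/=; apply: eq_bigr => i _.
    by rewrite /sing_weight !mxE.
  have B1 : 1 <= B.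
    by apply: prodr_ge1 => i; rewrite lerDl invr_ge0 sqrtr_ge0.
  rewrite /sing mulrA; apply: ler_pM => //.
  - by rewrite addr_ge0// invr_ge0 sqn_ge0.
  - exact/ltW/wgt_gt0.
  - by move: sB B1; lra.
have iS : itgble (sing x).
  apply/integrableP; split => //.
  under eq_integral do rewrite gee0_abs//.
  by apply: le_lt_trans le2 _; exact: ltry.
split=> //; rewrite -lee_fin; apply: le_trans le2.
by rewrite -itgE.
Qed.

Lemma itgble_wgt n : (4 <= n)%N -> itgble (@wgt n).
Proof.
move=> n4; have [C HC] := itgble_sing n4; have [iS _] := HC 0.
apply: itgble_le iS _; first exact: mble_wgt.
move=> x; rewrite ger0_norm ?(ltW (wgt_gt0 _))// /sing ler_peMl ?(ltW (wgt_gt0 _))//.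
by rewrite lerDl invr_ge0 sqn_ge0.
Qed.

End functions_on_rV.

(** * The equation ln h + K h = c *)

Section scalar_lemmas.
Context {R : realType}.
Implicit Types a b x y z : R.

(** With the next lemma: on [a, b] the logarithm is Lipschitz with constant 1/a and strongly
    monotone with constant 1/b. The two constants fix the step size and the contraction rate of the
    descent. *)
Lemma ln_diff_le a x y : 0 < a -> a <= x -> a <= y -> `|ln x - ln y| <= `|x - y| / a.
Proof.
move=> a0; wlog xy : x y / y <= x => [H|] ax ay.
  have [yx|/ltW xy] := leP y x; first exact: H.
  by rewrite distrC (distrC x); exact: H.
have x0 : 0 < x by apply: lt_le_trans ax.
have y0 : 0 < y by apply: lt_le_trans ay.
rewrite ger0_norm ?subr_ge0 ?ler_ln// ger0_norm ?subr_ge0// -ln_div//.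
have -> : x / y = 1 + (x - y) / y by field; rewrite gt_eqF.
apply: (le_trans (le_ln1Dx _)).
  by rewrite (lt_le_trans _ (divr_ge0 _ (ltW y0))) ?ltrN10// subr_ge0.
by rewrite ler_wpM2l ?subr_ge0// lef_pV2.
Qed.

Lemma ln_diff_ge b x y : 0 < x -> 0 < y -> x <= b -> y <= b ->
  (x - y) ^+ 2 / b <= (x - y) * (ln x - ln y).
Proof.
move=> x0 y0; wlog xy : x y x0 y0 / y <= x => [H|] xb yb.
  have [yx|/ltW xy] := leP y x; first exact: H.
  rewrite -sqrrN opprB -(opprB y x) -(opprB (ln y)) mulrNN; exact: H.
have b0 : 0 < b by apply: lt_le_trans xb.
rewrite expr2 -mulrA ler_wpM2l ?subr_ge0//.
have : ln (y / x) <= (y - x) / x.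
  have -> : y / x = 1 + (y - x) / x by field; rewrite gt_eqF.
  apply: le_ln1Dx; rewrite mulrBl divff ?gt_eqF// ltrBrDr addrC subrr.
  by rewrite divr_gt0.
rewrite ln_div// => h.
have : (x - y) / b <= (x - y) / x by rewrite ler_wpM2l ?subr_ge0// lef_pV2.
by rewrite -(opprB x y) mulNr in h; move: h; lra.
Qed.

Definition clip a b y := Num.max a (Num.min b y).

Lemma clip_lip a b y z : a <= b -> `|clip a b y - clip a b z| <= `|y - z|.
Proof.
move=> ab; wlog yz : y z / z <= y => [H|].
  have [zy|/ltW yz] := leP z y; first exact: H.
  by rewrite distrC (distrC y); exact: H.
rewrite (ger0_norm (x := y - z)) ?subr_ge0// /clip ler_norml.
by case: (leP b y); case: (leP b z) => ? ?;
  [case: (leP a b)|case: (leP a z); case: (leP a b)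
  |lra|case: (leP a z); case: (leP a y)] => *; apply/andP; split; lra.
Qed.

Lemma clip_ge a b y : a <= clip a b y.
Proof. by rewrite /clip le_max lexx. Qed.

Lemma clip_le a b y : a <= b -> clip a b y <= b.
Proof. by move=> ab; rewrite /clip ge_max ab/= ge_min lexx. Qed.

Lemma geometric_limit (u : nat -> R) (A r : R) : 0 <= r -> r < 1 ->
  (forall k, `|u k.+1 - u k| <= A * r ^+ k) ->
  u @ \oo --> limn u /\ forall k, `|limn u - u k| <= A * r ^+ k / (1 - r).
Proof.
move=> r0 r1 ur.
have A0 : 0 <= A by have := ur 0%N; rewrite expr0 mulr1; exact: le_trans.
have r1' : 0 < 1 - r by rewrite subr_gt0.
have H k j : `|u (k + j)%N - u k| <= A * r ^+ k / (1 - r) * (1 - r ^+ j).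
  elim: j => [|j IH]; first by rewrite addn0 subrr normr0 expr0 subrr mulr0.
  rewrite addnS; have := ler_normD (u (k + j).+1 - u (k + j)%N) (u (k + j)%N - u k).
  rewrite addrA subrK => /le_trans; apply.
  apply: (le_trans (lerD (ur _) IH)).
  rewrite exprD exprS le_eqVlt; apply/orP; left; apply/eqP; field.
  by rewrite gt_eqF.
have H' k j : (k <= j)%N -> `|u j - u k| <= A * r ^+ k / (1 - r).
  move=> kj; rewrite -(subnKC kj); apply: (le_trans (H _ _)).
  rewrite ler_piMr//; first by rewrite divr_ge0 ?mulr_ge0 ?exprn_ge0// ltW.
  by rewrite gerBl exprn_ge0.
have cu : cvgn u.
  apply/cauchy_cvgP/cauchy_ballP => e e0.
  have : A * r ^+ k / (1 - r) @[k --> \oo] --> A * 0 / (1 - r).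
    apply: cvgM; last exact: cvg_cst.
    apply: cvgM; first exact: cvg_cst.
    by apply: cvg_expr; rewrite ger0_norm.
  rewrite mulr0 mul0r => /cvgr0Pnorm_lt/(_ (e / 2)).
  rewrite divr_gt0// => /(_ isT)[N _ HN].
  near=> x; near: x.
  exists (u @` [set k | (N <= k)%N], u @` [set k | (N <= k)%N]) => /=.
    by split; exists N => // k/= Nk; exists k.
  move=> [x y] /= [[i Ni <-] [j Nj <-]]; rewrite -ball_normE/=.
  have := HN N (leqnn N) => /=; set B := A * _ / _ => HB.
  have := H' _ _ Ni; have := H' _ _ Nj; rewrite -/B.
  have := ler_norm B.
  have := ler_normB (u i - u N) (u j - u N); rewrite opprB addrA subrK.
  by move: HB; lra.
split=> // k.
have : `|u j - u k| @[j --> \oo] --> `|limn u - u k|.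
  by apply: cvg_norm; apply: cvgB => //; exact: cvg_cst.
move/cvg_lim => <-//; apply: limr_le.
  by apply: is_cvg_norm; apply: is_cvgB => //; exact: is_cvg_cst.
by exists k => // j /= kj; exact: H'.
Unshelve. all: by end_near. Qed.

End scalar_lemmas.

(** * Gradient descent for an abstract nonnegative, positive semidefinite kernel *)

Section fixed_point.
Context {R : realType} (n : nat) (W : 'rV[R]_n -> R) (k : 'rV[R]_n -> 'rV[R]_n -> R).
Implicit Types (f g h d : 'rV[R]_n -> R).

Definition wint f : R := itg (fun x => f x * W x).
Definition kop f x : R := wint (fun y => k x y * f y).
Definition bdd f : Prop := mble f /\ exists b, forall x, `|f x| <= b.

Context (mW : mble W) (W0 : forall x, 0 < W x) (iW : itgble W) (C1 C2 : R).
Context (C20 : 0 < C2).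
Context (mk : forall x, mble (k x)) (k0 : forall x y, 0 <= k x y).
Context (k2 : forall x, itgble (fun y => k x y ^+ 2 * W y)).
Context (k2C : forall x, itg (fun y => k x y ^+ 2 * W y) <= C2).
Context (k1C : forall x, kop (fun _ => 1) x <= C1).
Context (mB : forall h, bdd h -> (forall x, 0 <= h x) -> mble (kop h)).
Context (psd : forall d, bdd d -> 0 <= wint (fun x => d x * kop d x)).
Context (kop_mass : forall h, bdd h -> (forall x, 0 <= h x) ->
  wint (kop h) <= C1 * wint h).
Context (I1_gt0 : 0 < wint (fun _ => 1)).

Local Notation I1 := (wint (fun _ => 1)).

Let W0' x : 0 <= W x. Proof. exact/ltW. Qed.

Lemma bdd_cst c : bdd (fun _ => c).
Proof. by split; [exact: mble_cst|exists `|c|]. Qed.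

Lemma bddD f g : bdd f -> bdd g -> bdd (fun x => f x + g x).
Proof.
move=> [mf [a fa]] [mg [b gb]]; split; first exact: mbleD.
by exists (a + b) => x; rewrite (le_trans (ler_normD _ _))// lerD.
Qed.

Lemma bddM f g : bdd f -> bdd g -> bdd (fun x => f x * g x).
Proof.
move=> [mf [a fa]] [mg [b gb]]; split; first exact: mbleM.
by exists (a * b) => x; rewrite normrM ler_pM.
Qed.

Lemma bddZ c f : bdd f -> bdd (fun x => c * f x).
Proof. by apply: bddM; exact: bdd_cst. Qed.

Lemma bddB f g : bdd f -> bdd g -> bdd (fun x => f x - g x).
Proof.
move=> bf bg; rewrite (_ : (fun x => _) = fun x => f x + -1 * g x).
  by apply: bddD => //; exact: bddZ.
by apply/funext => x; rewrite mulN1r.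
Qed.

Lemma bdd_int f : bdd f -> itgble (fun x => f x * W x).
Proof.
move=> [mf [b fb]]; apply: (@itgble_le _ _ _ (fun x => b * W x)).
- exact: mbleM.
- exact: itgbleZ.
- by move=> x; rewrite normrM (ger0_norm (W0' x)) ler_wpM2r.
Qed.

Lemma wintD f g : bdd f -> bdd g -> wint (fun x => f x + g x) = wint f + wint g.
Proof.
move=> bf bg; rewrite /wint -itgD; [|exact: bdd_int..].
by congr itg; apply/funext => x; rewrite mulrDl.
Qed.

Lemma wintZ c f : bdd f -> wint (fun x => c * f x) = c * wint f.
Proof.
move=> bf; rewrite /wint -itgZ; last exact: bdd_int.
by congr itg; apply/funext => x; rewrite mulrA.
Qed.

Lemma wintB f g : bdd f -> bdd g -> wint (fun x => f x - g x) = wint f - wint g.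
Proof.
move=> bf bg; rewrite /wint -itgB; [|exact: bdd_int..].
by congr itg; apply/funext => x; rewrite mulrBl.
Qed.

Lemma le_wint f g : bdd f -> bdd g -> (forall x, f x <= g x) -> wint f <= wint g.
Proof.
move=> bf bg fg; apply: le_itg; [exact: bdd_int..|].
by move=> x; rewrite ler_wpM2r.
Qed.

Lemma wint_ge0 f : (forall x, 0 <= f x) -> 0 <= wint f.
Proof. by move=> f0; apply: itg_ge0 => x; rewrite mulr_ge0. Qed.

Lemma wint_cst c : wint (fun _ => c) = c * I1.
Proof.
by rewrite -(wintZ c (bdd_cst 1)); congr wint; apply/funext => x; rewrite mulr1.
Qed.

(** Since k <= 1 + k^2, the weighted square integrability of the kernel and the finite mass of [W]
    suffice. *)
Lemma kop_int f x : bdd f -> itgble (fun y => k x y * f y * W y).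
Proof.
move=> [mf [b fb]].
have b0 : 0 <= b by exact: le_trans (fb x).
apply: (@itgble_le _ _ _ (fun y => b * (k x y ^+ 2 * W y + W y))).
- by apply: mbleM => //; apply: mbleM.
- by apply: itgbleZ; apply: itgbleD.
- move=> y; rewrite !normrM (ger0_norm (W0' y)) (ger0_norm (k0 x y)).
  rewrite (_ : b * _ = (k x y ^+ 2 + 1) * b * W y); last by ring.
  rewrite ler_wpM2r//; apply: ler_pM => //.
  by have := sqr_ge0 (k x y - 1); have := k0 x y; rewrite !expr2; nra.
Qed.

Lemma kopD f g x : bdd f -> bdd g -> kop (fun x => f x + g x) x = kop f x + kop g x.
Proof.
move=> bf bg; rewrite /kop /wint -itgD; [|exact: kop_int..].
by congr itg; apply/funext => y; rewrite mulrDr mulrDl.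
Qed.

Lemma kopZ c f x : bdd f -> kop (fun x => c * f x) x = c * kop f x.
Proof.
move=> bf; rewrite /kop /wint -itgZ; last exact: kop_int.
by congr itg; apply/funext => y; rewrite mulrCA !mulrA.
Qed.

Lemma kopB f g x : bdd f -> bdd g -> kop (fun x => f x - g x) x = kop f x - kop g x.
Proof.
move=> bf bg; rewrite /kop /wint -itgB; [|exact: kop_int..].
by congr itg; apply/funext => y; rewrite mulrBr mulrBl.
Qed.

Lemma le_kop f g x : bdd f -> bdd g -> (forall y, f y <= g y) -> kop f x <= kop g x.
Proof.
move=> bf bg fg; apply: le_itg; [exact: kop_int..|].
by move=> y; rewrite ler_wpM2r// ler_wpM2l.
Qed.

Lemma kop_ge0 f x : (forall y, 0 <= f y) -> 0 <= kop f x.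
Proof. by move=> f0; apply: wint_ge0 => y; rewrite mulr_ge0. Qed.

Lemma kop_cst c x : kop (fun _ => c) x = c * kop (fun _ => 1) x.
Proof.
by rewrite -(kopZ c x (bdd_cst 1)); congr kop; apply/funext => y; rewrite mulr1.
Qed.

Lemma C1_ge0 : 0 <= C1.
Proof. by apply: le_trans (k1C 0); exact: kop_ge0. Qed.

Lemma kop_sup f b x : bdd f -> (forall y, `|f y| <= b) -> `|kop f x| <= b * C1.
Proof.
move=> bf fb.
have b0 : 0 <= b by exact: le_trans (fb x).
have kb : b * kop (fun _ => 1) x <= b * C1 by rewrite ler_wpM2l.
rewrite ler_norml; apply/andP; split.
  apply: (@le_trans _ _ (kop (fun _ => - b) x)); first by rewrite kop_cst mulNr lerN2.
  apply: le_kop => //; first exact: bdd_cst.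
  by move=> y; have := fb y; rewrite ler_norml => /andP[].
apply: le_trans kb; rewrite -kop_cst; apply: le_kop => //; first exact: bdd_cst.
by move=> y; have := fb y; rewrite ler_norml => /andP[].
Qed.

(** The hypothesis [mB] covers nonnegative functions only, as Tonelli does; adding a bound of [f]
    reduces to that case by linearity. *)
Lemma mble_kop f : bdd f -> mble (kop f).
Proof.
move=> bf; have [mf [b fb]] := bf.
have b0 : 0 <= b by exact: le_trans (fb 0).
have -> : kop f = fun x => kop (fun y => f y + b) x - kop (fun _ => b) x.
  by apply/funext => x; rewrite kopD ?addrK//; exact: bdd_cst.
apply: mbleB; apply: mB; try exact: bdd_cst; last by [].
  by apply: bddD => //; exact: bdd_cst.
by move=> x; have := fb x; rewrite ler_norml -lerBlDr sub0r => /andP[].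
Qed.

Lemma bdd_kop f : bdd f -> bdd (kop f).
Proof.
move=> bf; split; first exact: mble_kop.
by have [_ [b fb]] := bf; exists (b * C1) => x; exact: kop_sup.
Qed.

(** Cauchy-Schwarz, from the nonnegativity of the integral of (t k - f)^2 at t = K f / C2. It turns
    L^2 smallness into uniform smallness of K f. *)
Lemma kop_sqr f x : bdd f -> kop f x ^+ 2 <= C2 * wint (fun y => f y ^+ 2).
Proof.
move=> bf; pose t := kop f x / C2.
have bf2 : bdd (fun y => f y ^+ 2) by exact: bddM.
have : 0 <= itg (fun y => (t * k x y - f y) ^+ 2 * W y).
  by apply: itg_ge0 => y; rewrite mulr_ge0// sqr_ge0.
have -> : (fun y => (t * k x y - f y) ^+ 2 * W y) = (fun y => t ^+ 2 * (k x y ^+ 2 * W y) -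
    2 * t * (k x y * f y * W y) + f y ^+ 2 * W y).
  by apply/funext => y; ring.
rewrite itgD; last 2 first.
- by apply: itgbleB; apply: itgbleZ => //; exact: kop_int.
- exact: bdd_int.
rewrite itgB; last 2 first.
- exact: itgbleZ.
- by apply: itgbleZ; exact: kop_int.
rewrite !itgZ//; last exact: kop_int.
rewrite -/(wint (fun y => f y ^+ 2)) -/(wint (fun y => k x y * f y)) -/(kop f x).
move=> H.
have : t ^+ 2 * itg (fun y => k x y ^+ 2 * W y) <= t ^+ 2 * C2.
  by rewrite ler_wpM2l ?sqr_ge0.
have tC : t * C2 = kop f x by rewrite /t divfK// gt_eqF.
move=> H2; have H3 : 0 <= t ^+ 2 * C2 - 2 * t * kop f x + wint (fun y => f y ^+ 2).
  by move: H H2; lra.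
rewrite -tC in H3 *.
have : 0 <= C2 * (wint (fun y => f y ^+ 2) - t ^+ 2 * C2).
  rewrite mulr_ge0 ?(ltW C20)//; move: H3.
  by rewrite (_ : 2 * t * (t * C2) = 2 * (t ^+ 2 * C2)); [lra|ring].
move=> h; rewrite -subr_ge0; apply: (le_trans h).
by rewrite le_eqVlt; apply/orP; left; apply/eqP; ring.
Qed.

Section iteration.
Context (c : R).
Local Notation lam := (expR c).
(** A solution satisfies h <= e^c because K h >= 0, hence K h <= C1 e^c and h >= exp (c - C1 e^c).
    The further -1 makes the lower barrier strict, so that it cannot be attained by a fixed
    point. *)
Let a := expR (c - C1 * lam - 1).
(** The first bound gives tau <= a/2, which keeps t - tau ln t increasing on [a, lam]. The second
    makes the terms quadratic in tau at most s = tau / lam, half of the linear gain 2 s. *)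
Let tau := Num.min (a ^+ 2 / (2 * lam)) ((lam * (2 * (1 / a ^+ 2 + C2 * I1)))^-1).
Let s := tau / lam.

Let a0 : 0 < a. Proof. exact: expR_gt0. Qed.
Let lam0 : 0 < lam. Proof. exact: expR_gt0. Qed.

Let alam : a <= lam.
Proof.
rewrite ler_expR; have := mulr_ge0 C1_ge0 (ltW lam0); lra.
Qed.

Let M0 : 0 < 1 / a ^+ 2 + C2 * I1.
Proof. by rewrite addr_gt0 ?mulr_gt0// invr_gt0 exprn_gt0. Qed.

Let tau0 : 0 < tau.
Proof.
by rewrite lt_min divr_gt0 ?exprn_gt0 ?mulr_gt0//= invr_gt0 !mulr_gt0.
Qed.

Let s0 : 0 < s. Proof. by rewrite divr_gt0. Qed.

Let tau_a : tau <= a / 2.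
Proof.
apply: (@le_trans _ _ (a ^+ 2 / (2 * lam))); first by rewrite /tau ge_min lexx.
rewrite ler_pdivrMr ?mulr_gt0// (_ : a / 2 * (2 * lam) = a * lam); last by field.
by rewrite expr2 ler_wpM2l// ltW.
Qed.

Let s1 : s <= 2^-1.
Proof.
rewrite /s ler_pdivrMr//; apply: (le_trans tau_a).
by rewrite mulrC ler_wpM2l// invr_ge0.
Qed.

(* One step of gradient descent for the convex functional with gradient
   ln h + K h - c, truncated to [a, lam], which contains the solution. *)
Definition itstep h x : R := clip a lam (h x - tau * (ln (h x) + kop h x - c)).

Definition in_range h := mble h /\ forall x, a <= h x <= lam.

Lemma in_range_bdd h : in_range h -> bdd h.
Proof.
move=> [mh hr]; split=> //; exists lam => x; have /andP[ah hl] := hr x.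
by rewrite ger0_norm// (le_trans _ ah)// ltW.
Qed.

Lemma in_range_itstep h : in_range h -> in_range (itstep h).
Proof.
move=> hr; have bh := in_range_bdd hr; split; last first.
  by move=> x; rewrite clip_ge clip_le.
have mg : mble (fun x => h x - tau * (ln (h x) + kop h x - c)).
  have [mh _] := hr.
  apply: mbleB => //; apply: mbleM; first exact: mble_cst.
  apply: mbleB; last exact: mble_cst.
  apply: mbleD; [exact: mble_ln|exact: mble_kop].
apply: (mble_comp (g := clip a lam)) mg.
apply: measurable_maxr => //; exact: measurable_minr.
Qed.

(** The logarithm contributes the gain -2 s; its square and that of the K part are of order tau^2.
    The cross term has no pointwise sign and is kept, to be handled after integration. *)
Lemma itstep_sqr h g x : in_range h -> in_range g ->
  (itstep h x - itstep g x) ^+ 2 <=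
  (1 - 2 * s + 2 * tau ^+ 2 / a ^+ 2) * (h x - g x) ^+ 2 -
  2 * tau * ((h x - g x) * kop (fun y => h y - g y) x) +
  2 * tau ^+ 2 * C2 * wint (fun y => (h y - g y) ^+ 2).
Proof.
move=> hr gr; have bh := in_range_bdd hr; have bg := in_range_bdd gr.
have /andP[ah hl] := hr.2 x; have /andP[ag gl] := gr.2 x.
have bd := bddB bh bg.
set d := h x - g x; pose e := kop (fun y => h y - g y) x; rewrite -/e.
pose l := ln (h x) - ln (g x).
have : `|itstep h x - itstep g x| <= `|d - tau * (l + e)|.
  apply: (le_trans (clip_lip _ _ alam)); rewrite le_eqVlt; apply/orP; left.
  by apply/eqP; congr `|_|; rewrite /d /l /e kopB//; ring.
move=> H0; have {H0} := H0; rewrite -ler_sqr ?nnegrE// !real_normK ?num_real// => /le_trans; apply.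
have h0 : 0 < h x by apply: lt_le_trans ah.
have g0 : 0 < g x by apply: lt_le_trans ag.
have dl : d ^+ 2 / lam <= d * l by exact: ln_diff_ge.
have ll : l ^+ 2 <= d ^+ 2 / a ^+ 2.
  rewrite -expr_div_n -[leLHS]real_normK ?num_real// -[leRHS]real_normK ?num_real//.
  rewrite ler_sqr ?nnegrE// normf_div (gtr0_norm a0).
  exact: ln_diff_le.
have ee : e ^+ 2 <= C2 * wint (fun y => (h y - g y) ^+ 2) by exact: kop_sqr.
have t0 := ltW tau0.
have t2 : 0 <= 2 * tau ^+ 2 by rewrite mulr_ge0 ?exprn_ge0.
have H1 := ler_wpM2l t2 ll; have H2 := ler_wpM2l t2 ee.
have H3 := ler_wpM2l (mulr_ge0 (ler0n R 2) t0) dl.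
have H4 : 0 <= tau ^+ 2 * (l - e) ^+ 2 by rewrite mulr_ge0 ?sqr_ge0.
(* The square (l + e)^2 is written 2 l^2 + 2 e^2 - (l - e)^2, whose last term has a favourable
   sign. *)
have -> : (d - tau * (l + e)) ^+ 2 = d ^+ 2 - 2 * tau * (d * l) - 2 * tau * (d * e)
   + 2 * tau ^+ 2 * l ^+ 2 + 2 * tau ^+ 2 * e ^+ 2 - tau ^+ 2 * (l - e) ^+ 2 by ring.
have -> : (1 - 2 * s + 2 * tau ^+ 2 / a ^+ 2) * d ^+ 2 =
   d ^+ 2 - 2 * tau * (d ^+ 2 / lam) + 2 * tau ^+ 2 * (d ^+ 2 / a ^+ 2).
  by rewrite /s; ring.
by move: H1 H2 H3 H4; rewrite !mulrA; lra.
Qed.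

(** Integration makes the cross term nonnegative by [psd]. The choice of tau bounds the quadratic
    terms by s, so the factor 1 - 2 s becomes 1 - s. *)
Lemma itstep_contraction h g : in_range h -> in_range g ->
  wint (fun x => (itstep h x - itstep g x) ^+ 2) <=
  (1 - s) * wint (fun x => (h x - g x) ^+ 2).
Proof.
move=> hr gr; have bh := in_range_bdd hr; have bg := in_range_bdd gr.
have bd := bddB bh bg.
have bT := bddB (in_range_bdd (in_range_itstep hr)) (in_range_bdd (in_range_itstep gr)).
set E := wint (fun x => (h x - g x) ^+ 2).
have bd2 : bdd (fun x => (h x - g x) ^+ 2) by exact: (bddM bd bd).
have bdk : bdd (fun x => (h x - g x) * kop (fun y => h y - g y) x).
  by apply: bddM => //; exact: bdd_kop.
have := le_wint (bddM bT bT) _ (fun x => itstep_sqr x hr gr).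
rewrite wintD; last 2 first.
- by apply: bddB; exact: bddZ.
- exact: bdd_cst.
rewrite wintB; [|exact: bddZ..].
rewrite wint_cst !wintZ// -/E => H.
apply: (le_trans (H _)) => {H}.
  by apply: bddD; [apply: bddB; exact: bddZ|exact: bdd_cst].
have E0 : 0 <= E by apply: wint_ge0 => x; rewrite sqr_ge0.
have := psd bd; have := mulr_gt0 (ltr0n R 2) tau0.
set p := wint _ => t0 p0; have {p0} := mulr_ge0 (ltW t0) p0.
suff : (2 * tau ^+ 2 / a ^+ 2 + 2 * tau ^+ 2 * C2 * I1) * E <= s * E by lra.
apply: ler_wpM2r => //.
have -> : 2 * tau ^+ 2 / a ^+ 2 + 2 * tau ^+ 2 * C2 * I1 =
   tau * (tau * (2 * (1 / a ^+ 2 + C2 * I1))) by field; rewrite gt_eqF.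
rewrite /s ler_wpM2l ?(ltW tau0)//.
rewrite -ler_pdivlMr ?mulr_gt0// -invfM; by rewrite /tau ge_min lexx orbT.
Qed.

(** No positivity of K is available at a single point, so K stays as an error term. The rest is the
    map t - tau ln t, whose derivative on [a, lam] is nonnegative and at most 1 - tau / lam = 1 -
    s. *)
Lemma itstep_pointwise h g x : in_range h -> in_range g ->
  `|itstep h x - itstep g x| <=
  (1 - s) * `|h x - g x| + tau * `|kop (fun y => h y - g y) x|.
Proof.
move=> hr gr; have bh := in_range_bdd hr; have bg := in_range_bdd gr.
apply: (le_trans (clip_lip _ _ alam)).
rewrite kopB//.
have -> : h x - tau * (ln (h x) + kop h x - c) - (g x - tau * (ln (g x) + kop g x - c)) =
  (h x - g x - tau * (ln (h x) - ln (g x))) - tau * (kop h x - kop g x) by ring.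
apply: (le_trans (ler_normB _ _)); rewrite normrM (gtr0_norm tau0) lerD2r.
have /andP[ah hl] := hr.2 x; have /andP[ag gl] := gr.2 x.
wlog gh : h g {hr gr bh bg} ah hl ag gl / g x <= h x => [H|].
  have [gh|/ltW hg] := leP (g x) (h x); first exact: H.
  have := H g h ag gl ah hl hg; rewrite distrC (distrC (g x)).
  by congr (`|_| <= _); ring.
have h0 : 0 < h x by apply: lt_le_trans ah.
have g0 : 0 < g x by apply: lt_le_trans ag.
have d0 : 0 <= h x - g x by rewrite subr_ge0.
have ln0 : 0 <= ln (h x) - ln (g x) by rewrite subr_ge0 ler_ln.
have := ln_diff_le a0 ah ag; rewrite (ger0_norm d0) (ger0_norm ln0) => L1.
have L2 : (h x - g x) / lam <= ln (h x) - ln (g x).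
  have [->|hg] := eqVneq (h x) (g x); first by rewrite !subrr mul0r.
  have dp : 0 < h x - g x by rewrite subr_gt0 lt_neqAle eq_sym hg.
  by have := ln_diff_ge h0 g0 hl gl; rewrite expr2 -mulrA ler_pM2l.
have L3 : tau * (ln (h x) - ln (g x)) <= h x - g x.
  apply: (le_trans (ler_wpM2l (ltW tau0) L1)).
  rewrite mulrCA -[leRHS]mulr1 ler_wpM2l// ler_pdivrMr// mul1r.
  by apply: (le_trans tau_a); move: a0; lra.
rewrite ger0_norm ?subr_ge0// mulrBl mul1r lerD2l lerN2 /s -mulrA ler_wpM2l ?(ltW tau0)//.
by rewrite mulrC.
Qed.

Let r := Num.sqrt (1 - s).

Let r2 : r ^+ 2 = 1 - s.
Proof. by rewrite sqr_sqrtr// subr_ge0 (le_trans s1)// invf_le1// ler1n. Qed.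

Let r0 : 0 <= r. Proof. exact: sqrtr_ge0. Qed.

Let r1 : r < 1.
Proof. by rewrite -[ltRHS]sqrtr1 ltr_sqrt// gtrBl. Qed.

Let r1s : 1 - s < r.
Proof.
rewrite -r2 expr2 gtr_pMr//.
by rewrite sqrtr_gt0 subr_gt0 (le_lt_trans s1)// invf_lt1// ltr1n.
Qed.

Fixpoint itseq j : 'rV[R]_n -> R :=
  if j is j'.+1 then itstep (itseq j') else fun _ => lam.

Lemma in_range_itseq j : in_range (itseq j).
Proof.
elim: j => [|j ih] /=; last exact: in_range_itstep.
by split; [exact: mble_cst|move=> x; rewrite lexx andbT].
Qed.

Let E0 := wint (fun x => (itseq 1 x - itseq 0 x) ^+ 2).

Lemma itseq_L2 j : wint (fun x => (itseq j.+1 x - itseq j x) ^+ 2) <= E0 * (r ^+ j) ^+ 2.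
Proof.
elim: j => [|j ih]; first by rewrite expr0 expr1n mulr1.
apply: (le_trans (itstep_contraction (in_range_itseq j.+1) (in_range_itseq j))).
rewrite (_ : E0 * _ = r ^+ 2 * (E0 * (r ^+ j) ^+ 2)); last by rewrite (exprS r j) exprMn mulrCA.
by rewrite r2 ler_wpM2l// -r2 sqr_ge0.
Qed.

(** By [kop_sqr] the L^2 decay r^j of the increments bounds the error term by tau D r^j. As 1 - s <
    r, the recursion closes once A (r - (1 - s)) >= tau D; the other member of the maximum, 2 lam,
    covers j = 0. *)
Lemma itseq_pointwise : exists A, forall j x,
  `|itseq j.+1 x - itseq j x| <= A * r ^+ j.
Proof.
have E00 : 0 <= E0 by apply: wint_ge0 => x; exact: sqr_ge0.
pose D := Num.sqrt (C2 * E0).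
pose A := Num.max (2 * lam) (tau * D / (r - (1 - s))).
have rs : 0 < r - (1 - s) by rewrite subr_gt0.
have AD : tau * D <= A * (r - (1 - s)).
  by rewrite -ler_pdivrMr// /A le_max lexx orbT.
exists A => j x; elim: j => [|j ih].
  rewrite expr0 mulr1 /A le_max; apply/orP; left.
  have /andP[? ?] := (in_range_itseq 1).2 x; have /andP[? ?] := (in_range_itseq 0).2 x.
  rewrite ler_norml; apply/andP; split; move: a0; lra.
apply: (le_trans (itstep_pointwise x (in_range_itseq j.+1) (in_range_itseq j))).
have bd := bddB (in_range_bdd (in_range_itseq j.+1)) (in_range_bdd (in_range_itseq j)).
have kD : `|kop (fun y => itseq j.+1 y - itseq j y) x| <= D * r ^+ j.
  rewrite -ler_sqr ?nnegrE ?mulr_ge0 ?sqrtr_ge0 ?exprn_ge0// real_normK ?num_real//.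
  apply: (le_trans (kop_sqr x bd)).
  rewrite exprMn sqr_sqrtr; last by rewrite mulr_ge0// ltW.
  by rewrite -mulrA ler_wpM2l ?(ltW C20)//; exact: itseq_L2.
have s2 : 0 <= 1 - s by rewrite subr_ge0 (le_trans s1)// invf_le1// ler1n.
have H1 := ler_wpM2l s2 ih; have H2 := ler_wpM2l (ltW tau0) kD.
have rj : 0 <= r ^+ j by rewrite exprn_ge0.
have H3 := ler_wpM2r rj AD.
rewrite exprS; move: H1 H2 H3; rewrite /=; nra.
Qed.

(** The iterates converge uniformly, so [itstep_pointwise] shows that the limit is fixed by the
    truncated step. It remains to see that the truncation is inactive there. *)
Lemma fixed_point_exists : exists h, [/\ mble h, (forall x, 0 < h x <= lam) &
  forall x, ln (h x) + kop h x = c].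
Proof.
have [A HA] := itseq_pointwise.
pose h x := limn (fun j => itseq j x).
have Hh x := geometric_limit r0 r1 (fun j => HA j x).
pose eps j := A * r ^+ j / (1 - r).
have eps0 : eps j @[j --> \oo] --> 0.
  have : A * r ^+ j / (1 - r) @[j --> \oo] --> A * 0 / (1 - r).
    apply: cvgM; last exact: cvg_cst.
    apply: cvgM; first exact: cvg_cst.
    by apply: cvg_expr; rewrite ger0_norm.
  by rewrite mulr0 mul0r.
have mh : mble h.
  apply: (measurable_fun_cvg (h := fun j t => itseq j (row_of_tuple t))).
    by move=> j; have [] := in_range_itseq j.
  by move=> t _; have [] := Hh (row_of_tuple t).
have hr : in_range h.
  split=> // x; have [cv _] := Hh x; apply/andP; split.
    apply: (limr_ge (cvgP _ cv)); apply: nearW => j.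
    by have /andP[] := (in_range_itseq j).2 x.
  apply: (limr_le (cvgP _ cv)); apply: nearW => j.
  by have /andP[] := (in_range_itseq j).2 x.
have bh := in_range_bdd hr.
have hT x : itstep h x = h x.
  apply/eqP; rewrite -subr_eq0 -normr_le0.
  have cv0 : (1 - s) * eps j + tau * (eps j * C1) + eps j.+1 @[j --> \oo] -->
      (1 - s) * 0 + tau * (0 * C1) + 0.
    apply: cvgD; last by rewrite (cvg_shiftS eps).
    apply: cvgD; first by apply: cvgM => //; exact: cvg_cst.
    apply: cvgM; first exact: cvg_cst.
    by apply: cvgM => //; exact: cvg_cst.
  rewrite !(mul0r, mulr0, addr0) in cv0.
  rewrite -(cvg_lim _ cv0)//; apply: limr_ge; first exact: cvgP cv0.
  apply: nearW => j.
  have -> : itstep h x - h x = (itstep h x - itstep (itseq j) x) + (itseq j.+1 x - h x).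
    by rewrite /= addrA subrK.
  apply: (le_trans (ler_normD _ _)); apply: lerD; last first.
    by rewrite distrC; have [_] := Hh x; exact.
  apply: (le_trans (itstep_pointwise x hr (in_range_itseq j))).
  have s2 : 0 <= 1 - s by rewrite subr_ge0 (le_trans s1)// invf_le1// ler1n.
  apply: lerD; first by rewrite ler_wpM2l//; have [_] := Hh x; exact.
  rewrite ler_wpM2l ?(ltW tau0)//; apply: kop_sup.
    exact: bddB (in_range_bdd (in_range_itseq j)).
  by move=> y; have [_] := Hh y; exact.
exists h; split => //.
  by move=> x; have /andP[ah ->] := hr.2 x; rewrite (lt_le_trans a0).
move=> x; have /andP[ah hl] := hr.2 x.
have kh0 : 0 <= kop h x.
  by apply: kop_ge0 => y; have /andP[ay _] := hr.2 y; rewrite (le_trans _ ay)// ltW.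
have khC : kop h x <= lam * C1.
  rewrite -[leLHS]ger0_norm//; apply: kop_sup => // y.
  have /andP[ay yl] := hr.2 y; rewrite ger0_norm//.
  by rewrite (le_trans _ ay)// ltW.
have := hT x; rewrite /itstep; set g := ln (h x) + kop h x - c.
move=> hc; apply/eqP; rewrite -subr_eq0 -/g; apply/eqP.
(* If g < 0, fixedness forces h x = lam, where ln h = c and g = K h >= 0. If g > 0 it forces h x =
   a, where g = K h - C1 lam - 1 <= -1. Both are absurd. *)
have [g0|g0|//] := ltgtP g 0.
  have tg : tau * g < 0 by rewrite pmulr_rlt0.
  have hlam : h x = lam.
    apply/eqP; rewrite eq_le hl leNgt; apply/negP => hlt.
    have : h x < clip a lam (h x - tau * g).
      by rewrite /clip lt_max lt_min hlt ltrBrDr gtrDl tg orbT.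
    by rewrite hc ltxx.
  by move: g0; rewrite /g hlam expRK; lra.
have tg : 0 < tau * g by rewrite mulr_gt0.
have hla : h x = a.
  apply/eqP; rewrite eq_le ah andbT leNgt; apply/negP => hlt.
  have : clip a lam (h x - tau * g) < h x.
    by rewrite /clip gt_max hlt gt_min gtrBl tg orbT.
  by rewrite hc ltxx.
by move: g0; rewrite /g hla expRK; move: khC; rewrite mulrC; lra.
Qed.

End iteration.

(** The difference of the two equations is tested against h1 - h2: strong monotonicity of ln and
    [psd] bound the squared L^2 distance by e^cm (c1 - c2) D, with D the difference of masses, and
    Cauchy-Schwarz bounds D^2 by that distance. The estimate does not depend on how the solutions
    were selected, so a choice function for them has continuous mass. *)
Lemma mass_lipschitz cm c1 c2 h1 h2 : c1 <= cm -> c2 <= cm ->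
  mble h1 -> mble h2 ->
  (forall x, 0 < h1 x <= expR c1) -> (forall x, 0 < h2 x <= expR c2) ->
  (forall x, ln (h1 x) + kop h1 x = c1) -> (forall x, ln (h2 x) + kop h2 x = c2) ->
  `|wint h1 - wint h2| <= I1 * expR cm * `|c1 - c2|.
Proof.
move=> c1m c2m mh1 mh2 r1 r2 e1 e2.
have bb c h : mble h -> (forall x, 0 < h x <= expR c) -> bdd h.
  move=> mh hr; split=> //; exists (expR c) => x; have /andP[? ?] := hr x.
  by rewrite gtr0_norm.
have b1 := bb _ _ mh1 r1; have b2 := bb _ _ mh2 r2; have bd := bddB b1 b2.
have bd2 : bdd (fun x => (h1 x - h2 x) ^+ 2) by exact: (bddM bd bd).
have lam0 := expR_gt0 cm.
set D := wint h1 - wint h2; pose E := wint (fun x => (h1 x - h2 x) ^+ 2).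
have DE : wint (fun x => h1 x - h2 x) = D by rewrite wintB.
have E1 : E <= expR cm * ((c1 - c2) * D).
  have := psd bd => p0.
  have bdk : bdd (fun x => (h1 x - h2 x) * kop (fun y => h1 y - h2 y) x).
    by apply: bddM => //; exact: bdd_kop.
  have : wint (fun x => (expR cm)^-1 * (h1 x - h2 x) ^+ 2) <=
      wint (fun x => (c1 - c2) * (h1 x - h2 x) - (h1 x - h2 x) * kop (fun y => h1 y - h2 y) x).
    apply: le_wint; [exact: bddZ|by apply: bddB => //; exact: bddZ|].
    move=> x; have /andP[p1 l1] := r1 x; have /andP[p2 l2] := r2 x.
    have l1' : h1 x <= expR cm by apply: (le_trans l1); rewrite ler_expR.
    have l2' : h2 x <= expR cm by apply: (le_trans l2); rewrite ler_expR.
    rewrite mulrC; apply: (le_trans (ln_diff_ge p1 p2 l1' l2')).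
    have -> : ln (h1 x) - ln (h2 x) = c1 - c2 - (kop h1 x - kop h2 x).
      by have := e1 x; have := e2 x; lra.
    rewrite kopB//.
    by rewrite le_eqVlt; apply/orP; left; apply/eqP; ring.
  rewrite wintZ// wintB//; last exact: bddZ.
  rewrite wintZ// DE -/E => H.
  rewrite -ler_pdivrMl//; apply: (le_trans H); move: p0; lra.
have E2 : D ^+ 2 <= I1 * E.
  pose t := D / I1.
  have : 0 <= wint (fun x => (h1 x - h2 x - t) ^+ 2).
    by apply: wint_ge0 => x; exact: sqr_ge0.
  have -> : (fun x => (h1 x - h2 x - t) ^+ 2) =
      (fun x => (h1 x - h2 x) ^+ 2 - 2 * t * (h1 x - h2 x) + t ^+ 2).
    by apply/funext => x; ring.
  rewrite wintD; [|by apply: bddB => //; exact: bddZ|exact: bdd_cst].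
  rewrite wintB//; last exact: bddZ.
  rewrite wintZ// DE wint_cst -/E.
  have tI : t * I1 = D by rewrite /t divfK// gt_eqF.
  rewrite -tI => H.
  have := mulr_ge0 (ltW I1_gt0) H.
  suff -> : (t * I1) ^+ 2 = I1 * E - I1 * (E - 2 * t * (t * I1) + t ^+ 2 * I1) by lra.
  ring.
have E3 : D ^+ 2 <= I1 * expR cm * `|c1 - c2| * `|D|.
  apply: (le_trans E2); rewrite -!mulrA ler_wpM2l ?(ltW I1_gt0)//.
  apply: (le_trans E1); rewrite ler_wpM2l ?(ltW lam0)//.
  by rewrite -normrM ler_norm.
have [->|D0] := eqVneq D 0.
  by rewrite normr0 !mulr_ge0// ltW.
have Dp : 0 < `|D| by rewrite normr_gt0.
by rewrite -(ler_pM2r Dp) -expr2 real_normK ?num_real.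
Qed.

Lemma normalized_fixed_point : exists c h, [/\ mble h,
  (forall x, 0 < h x <= expR c), (forall x, ln (h x) + kop h x = c) & wint h = 1].
Proof.
have [H HH] := choice fixed_point_exists.
pose M c := wint (H c).
pose t := C1 / I1.
have t0 : 0 <= t by rewrite divr_ge0 ?C1_ge0// ltW.
(* At [u] the bound h <= e^u = 1 / I1 gives mass at most 1. The shift t = C1 / I1 in [v] compensates
   the largest possible average of K h. *)
pose u := - ln I1; pose v := t - ln I1.
have uv : u <= v by rewrite /u /v; move: t0; lra.
have bb c : bdd (H c).
  have [mh hr _] := HH c; split=> //; exists (expR c) => x; have /andP[? ?] := hr x.
  by rewrite gtr0_norm.
have Mu : M u <= 1.
  have [mh hr _] := HH u.
  apply: (@le_trans _ _ (wint (fun _ => expR u))).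
    apply: le_wint => //; first exact: bdd_cst.
    by move=> x; have /andP[] := hr x.
  by rewrite wint_cst /u expRN lnK ?posrE// mulVf// gt_eqF.
have Mv : 1 <= M v.
  rewrite leNgt; apply/negP => M1.
  have [mh hr he] := HH v.
  have h0 x : 0 <= H v x by have /andP[/ltW] := hr x.
  have kI : wint (kop (H v)) <= C1.
    apply: (le_trans (kop_mass (bb v) h0)); rewrite ler_piMr ?C1_ge0//.
    exact/ltW.
  (* Since h = e^(v-t) e^(t - K h), convexity of exp gives a bound linear in K h, whose integral is
     at most C1 as long as the mass is below 1. The result is mass at least 1, a contradiction. *)
  have : wint (fun x => expR (v - t) * (1 + t - kop (H v) x)) <= M v.
    apply: le_wint => //.
      by apply: bddZ; apply: bddB; [exact: bdd_cst|exact: bdd_kop].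
    move=> x; have -> : H v x = expR (v - t) * expR (t - kop (H v) x).
      have /andP[hp _] := hr x.
      rewrite -expRD -[LHS]lnK ?posrE//; congr expR.
      by have := he x; lra.
    rewrite ler_wpM2l ?expR_ge0//.
    apply: (le_trans _ (expR_ge1Dx _)); lra.
  rewrite wintZ; last by apply: bddB; [exact: bdd_cst|exact: bdd_kop].
  rewrite wintB; [|exact: bdd_cst|exact: bdd_kop].
  rewrite wint_cst (_ : v - t = - ln I1); last by rewrite /v; ring.
  rewrite expRN lnK ?posrE// => H1.
  have : 1 <= I1^-1 * ((1 + t) * I1 - wint (kop (H v))).
    rewrite -[leLHS](mulVf (lt0r_neq0 I1_gt0)) ler_wpM2l ?invr_ge0 ?(ltW I1_gt0)//.
    rewrite mulrDl mul1r /t divfK ?lt0r_neq0//; move: kI; lra.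
  by move: M1 H1; lra.
have [c cin Mc] : exists2 c, c \in `[u, v] & M c = 1.
  apply: IVT => //; last by rewrite ge_min Mu le_max Mv orbT.
  apply: continuous_subspaceT => /= c.
  apply/cvgrPdist_lt => e e0.
  pose L := I1 * expR (c + 1) + 1.
  have L0 : 0 < L by rewrite addr_gt0// mulr_gt0// expR_gt0.
  near=> c'.
  have c1 : `|c - c'| < 1 by near: c'; apply: cvgr_dist_lt.
  have c2 : `|c - c'| < e / L.
    by near: c'; apply: cvgr_dist_lt => //; rewrite divr_gt0.
  have [m1 p1 e1] := HH c; have [m2 p2 e2] := HH c'.
  have cc : c <= c + 1 by lra.
  have cc' : c' <= c + 1.
    by move: c1; rewrite ltr_distlC => /andP[_ /ltW].
  apply: (le_lt_trans (mass_lipschitz cc cc' m1 m2 p1 p2 e1 e2)).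
  rewrite ltr_pdivlMr// mulrC in c2.
  apply: le_lt_trans c2; rewrite ler_wpM2r//.
  by rewrite lerDl.
have [mh hr he] := HH c.
by exists c, (H c).
Unshelve. all: by end_near. Qed.

End fixed_point.

(** * Partial derivatives and growth classes *)

Section partial_derivatives.
Context {R : realType} {n : nat}.
Implicit Types (f g : 'rV[R]_n -> R) (i : 'I_n) (x : 'rV[R]_n).

Lemma is_derive_line f x (v : 'rV[R]_n) (t df : R) :
  is_derive (t *: v + x) v f df -> is_derive t 1 (fun s : R => f (s *: v + x)) df.
Proof.
move=> [fd <-].
have E : (fun h : R => h^-1 *: ((f \o shift (t *: v + x)) (h *: v) - f (t *: v + x))) =
  (fun h : R => h^-1 *: (((fun s : R => f (s *: v + x)) \o shift t) (h *: 1) - f (t *: v + x))).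
  apply/funext => h /=; congr (_ *: (f _ - _)).
  by rewrite (_ : h *: 1 = h :> R) ?scalerDl ?addrA//; exact: mulr1.
split.
  by rewrite /derivable -E.
by rewrite /derive -E.
Qed.

Lemma is_derive_of_line f x (v : 'rV[R]_n) (df : R) :
  is_derive (0 : R) 1 (fun s : R => f (s *: v + x)) df -> is_derive x v f df.
Proof.
move=> [fd <-].
have E : (fun h : R => h^-1 *: ((f \o shift x) (h *: v) - f x)) =
  (fun h : R => h^-1 *: (((fun s : R => f (s *: v + x)) \o shift 0) (h *: 1) - f (0 *: v + x))).
  apply/funext => h /=; congr (_ *: (f _ - f _)); last by rewrite scale0r add0r.
  by rewrite addr0 (_ : h *: 1 = h :> R)//; exact: mulr1.
split.
  by rewrite /derivable E.
by rewrite /derive E.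
Qed.

(** The derivative is an argument because [partial] is total: an equation about it would not imply
    derivability. *)
Definition pder i f g := forall x, is_derive x (delta_mx 0 i) f (g x).

Lemma pder_partial i f g : pder i f g -> partial i f = g.
Proof. by move=> fg; apply/funext => x; have [] := fg x. Qed.

Lemma pder_derivable i f g x : pder i f g -> derivable f x (delta_mx 0 i).
Proof. by move=> fg; have [] := fg x. Qed.

Lemma pder_line i f g x (t : R) : pder i f g ->
  is_derive t 1 (fun s : R => f (s *: delta_mx 0 i + x)) (g (t *: delta_mx 0 i + x)).
Proof. by move=> fg; exact: is_derive_line. Qed.

Lemma pder_cst i (c : R) : pder i (fun _ => c) (fun _ => 0).
Proof. by move=> x; exact: is_derive_cst. Qed.

Lemma pderD i f g f' g' : pder i f f' -> pder i g g' ->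
  pder i (fun x => f x + g x) (fun x => f' x + g' x).
Proof. by move=> ff gg x; apply: is_deriveD. Qed.

Lemma pderB i f g f' g' : pder i f f' -> pder i g g' ->
  pder i (fun x => f x - g x) (fun x => f' x - g' x).
Proof. by move=> ff gg x; apply: is_deriveB. Qed.

Lemma pderM i f g f' g' : pder i f f' -> pder i g g' ->
  pder i (fun x => f x * g x) (fun x => f' x * g x + f x * g' x).
Proof.
move=> ff gg x; apply: (is_derive_eq (is_deriveM (ff x) (gg x))).
by rewrite /GRing.scale/= addrC (mulrC (g x)).
Qed.

Lemma pderZ i c f f' : pder i f f' -> pder i (fun x => c * f x) (fun x => c * f' x).
Proof.
move=> ff; have := pderM (pder_cst i c) ff.
by rewrite /pder => H x; apply: (is_derive_eq (H x)); rewrite mul0r add0r.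
Qed.

Lemma pder_sum i k (F F' : 'I_k -> 'rV[R]_n -> R) : (forall j, pder i (F j) (F' j)) ->
  pder i (fun x => \sum_j F j x) (fun x => \sum_j F' j x).
Proof.
move=> FF x; rewrite (_ : (fun x => _) = \sum_j F j); last first.
  by apply/funext => y; rewrite fct_sumE.
exact: (is_derive_sum (fun j => FF j x)).
Qed.

Lemma pder_comp i f f' (phi phi' : R -> R) : pder i f f' ->
  (forall x, is_derive (f x) 1 phi (phi' (f x))) ->
  pder i (fun x => phi (f x)) (fun x => phi' (f x) * f' x).
Proof.
move=> ff pp x; apply: is_derive_of_line.
have := pder_line x 0 ff; rewrite scale0r add0r => fl.
apply: (is_derive1_comp (f := phi) (g := fun s : R => f (s *: delta_mx 0 i + x))) => //.
by rewrite scale0r add0r.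
Qed.

Lemma pder_coord i j : pder i (fun x => x 0 j) (fun _ => (i == j)%:R).
Proof.
move=> x; apply: is_derive_of_line.
rewrite (_ : (fun s => _) = (fun s : R => s * (i == j)%:R + x 0 j)); last first.
  by apply/funext => s; rewrite !mxE eqxx eq_sym.
apply: is_derive_eq; rewrite /GRing.scale/= addr0 mulr1 mulr0.
by rewrite ?add0r ?addr0.
Qed.

Lemma pder_expR i f f' : pder i f f' ->
  pder i (fun x => expR (f x)) (fun x => expR (f x) * f' x).
Proof. by move=> ff; apply: (pder_comp (phi := expR)). Qed.

Lemma pder_ln i f f' : (forall x, 0 < f x) -> pder i f f' ->
  pder i (fun x => ln (f x)) (fun x => (f x)^-1 * f' x).
Proof.
move=> f0 ff; apply: (pder_comp (phi := @ln R) (phi' := fun t => t^-1)) => // x.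
exact: is_derive1_ln.
Qed.

Lemma pder_inv i f f' : (forall x, f x != 0) -> pder i f f' ->
  pder i (fun x => (f x)^-1) (fun x => - ((f x)^-1 ^+ 2) * f' x).
Proof.
move=> f0 ff; apply: (pder_comp (phi := fun t => t^-1) (phi' := fun t => - (t^-1 ^+ 2))) => // x.
split; first by apply: derivableV => //; exact: derivable_id.
rewrite (deriveV (f := id))//.
by rewrite derive_id /GRing.scale/= mulr1 exprVn.
Qed.

Lemma pderX i k f f' : pder i f f' ->
  pder i (fun x => f x ^+ k.+1) (fun x => k.+1%:R * f x ^+ k * f' x).
Proof.
move=> ff; elim: k => [|k ih].
  by rewrite /pder => x; under eq_fun do rewrite expr1; apply: (is_derive_eq (ff x)); rewrite expr0 !mul1r.
have := pderM ff ih.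
rewrite /pder => H x; under eq_fun do rewrite exprS.
by apply: (is_derive_eq (H x)); rewrite -[in RHS]natr1 !exprS; ring.
Qed.

Lemma continuous_sqn : continuous (@sqn R n).
Proof.
rewrite /sqn => x; rewrite (_ : (fun x => _) = \sum_i (fun x : 'rV[R]_n => x 0 i ^+ 2)); last first.
  by apply/funext => y; rewrite fct_sumE.
apply: (big_rec (fun f : 'rV[R]_n -> R => {for x, continuous f})).
  exact: cst_continuous.
move=> i f _ cf; apply: continuousD => //.
apply: (continuous_comp (g := fun y : R => y ^+ 2)); first exact: coord_continuous.
exact: exprn_continuous.
Qed.

Lemma pder_sqn i : pder i (@sqn R n) (fun x => 2 * x 0 i).
Proof.
have := pder_sum (fun j => pderX 1 (pder_coord i j)).
rewrite /pder => H x; apply: (is_derive_eq (H x)).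
rewrite (bigD1 i)//= eqxx mulr1 expr1 big1 ?addr0// => j ji.
by rewrite eq_sym (negbTE ji) mulr0.
Qed.

Lemma laplacianE f (g h : 'I_n -> 'rV[R]_n -> R) :
  (forall i, pder i f (g i)) -> (forall i, pder i (g i) (h i)) ->
  laplacian f = fun x => \sum_i h i x.
Proof.
move=> fg gh; apply/funext => x; apply: eq_bigr => i _.
by rewrite (pder_partial (fg i)) (pder_partial (gh i)).
Qed.

(** The class [A] constrains every derivative up to order k, not only the top one. With a growth
    class for [A], the bounds needed to differentiate under an integral propagate by themselves. *)
Fixpoint Ck (A : ('rV[R]_n -> R) -> Prop) (k : nat) f : Prop :=
  A f /\ if k is k'.+1 then forall i, exists g, pder i f g /\ Ck A k' g else True.

Lemma Ck0 A k f : Ck A k f -> A f.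
Proof. by case: k => [[]|k []]. Qed.

Lemma CkS A k f : Ck A k.+1 f -> Ck A k f.
Proof.
elim: k f => [f [Af _]//|k ih f [Af fk]]; split=> // i.
by have [g [fg /ih gk]] := fk i; exists g.
Qed.

Lemma CkD A k f g : (forall f g, A f -> A g -> A (fun x => f x + g x)) ->
  Ck A k f -> Ck A k g -> Ck A k (fun x => f x + g x).
Proof.
move=> AD; elim: k f g => [f g [Af _] [Ag _]|k ih f g [Af fk] [Ag gk]].
  by split=> //; exact: AD.
split=> [|i]; first exact: AD.
have [f' [ff fk']] := fk i; have [g' [gg gk']] := gk i.
by exists (fun x => f' x + g' x); split; [exact: pderD|exact: ih].
Qed.

Lemma CkM A B C k f g : (forall f g, A f -> B g -> C (fun x => f x * g x)) ->
  (forall f g, C f -> C g -> C (fun x => f x + g x)) ->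
  Ck A k f -> Ck B k g -> Ck C k (fun x => f x * g x).
Proof.
move=> ABC CD; elim: k f g => [f g [Af _] [Bg _]|k ih f g [Af fk] [Bg gk]].
  by split=> //; exact: ABC.
split=> [|i]; first exact: ABC.
have [f' [ff fk']] := fk i; have [g' [gg gk']] := gk i.
exists (fun x => f' x * g x + f x * g' x); split; first exact: pderM.
by apply: CkD => //; apply: ih => //; apply: CkS; split.
Qed.

Lemma Ck_cst (A : ('rV[R]_n -> R) -> Prop) k c : (forall c, A (fun _ => c)) ->
  Ck A k (fun _ => c).
Proof.
move=> Ac; elim: k c => [|k ih] c; first by split.
by split=> // i; exists (fun _ => 0); split; [exact: pder_cst|exact: ih].
Qed.

Lemma Ck_iter_partial A j s f : Ck A (size s + j) f -> Ck A j (iter_partial s f).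
Proof.
elim: s j => [//|i s ih] j; rewrite [size _]/= addSnnS => /ih/= [_ /(_ i)[g [fg gk]]].
by rewrite (pder_partial fg).
Qed.

Lemma Ck_smooth A f : (forall f, A f -> continuous f) -> (forall k, Ck A k f) -> smooth f.
Proof.
move=> Ac fk s; split.
  by apply: Ac; apply: (@Ck0 _ 0); apply: Ck_iter_partial; exact: fk.
move=> i x; have /Ck_iter_partial/= [_ /(_ i)[g [fg _]]] := fk (size s + 1)%N.
exact: pder_derivable fg.
Qed.

Definition tbound f := exists N C, forall x, `|f x| <= C * (1 + sqn x) ^+ N.
(** Continuity is kept apart, in [decaying], because the density is at first known only to be
    measurable and rapidly decreasing. *)
Definition dbound f := forall N, exists C, forall x, `|f x| * (1 + sqn x) ^+ N <= C.
Definition tempered f := continuous f /\ tbound f.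
Definition decaying f := continuous f /\ dbound f.

Lemma sq1_ge1 x : 1 <= 1 + sqn x.
Proof. by rewrite lerDl sqn_ge0. Qed.

Lemma sq1_gt0 x : 0 < 1 + sqn x.
Proof. by apply: lt_le_trans (sq1_ge1 x). Qed.

Lemma sq1X_gt0 x N : 0 < (1 + sqn x) ^+ N.
Proof. by rewrite exprn_gt0// sq1_gt0. Qed.

Lemma tbound_ge0 f : tbound f ->
  exists N C, 0 <= C /\ forall x, `|f x| <= C * (1 + sqn x) ^+ N.
Proof.
move=> [N [C H]]; exists N, `|C|; split=> // x; apply: (le_trans (H x)).
by rewrite ler_wpM2r ?ler_norm// ltW// sq1X_gt0.
Qed.

Lemma tboundD f g : tbound f -> tbound g -> tbound (fun x => f x + g x).
Proof.
move=> /tbound_ge0[N [C [C0 fC]]] /tbound_ge0[M [D [D0 gD]]].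
exists (N + M)%N, (C + D) => x; apply: (le_trans (ler_normD _ _)).
rewrite mulrDl; apply: lerD.
  apply: (le_trans (fC x)); rewrite ler_wpM2l//.
  by rewrite ler_weXn2l ?sq1_ge1// leq_addr.
apply: (le_trans (gD x)); rewrite ler_wpM2l//.
by rewrite ler_weXn2l ?sq1_ge1// leq_addl.
Qed.

Lemma tboundM f g : tbound f -> tbound g -> tbound (fun x => f x * g x).
Proof.
move=> /tbound_ge0[N [C [C0 fC]]] /tbound_ge0[M [D [D0 gD]]].
exists (N + M)%N, (C * D) => x; rewrite normrM exprD mulrACA.
exact: ler_pM.
Qed.

Lemma dboundD f g : dbound f -> dbound g -> dbound (fun x => f x + g x).
Proof.
move=> fd gd N; have [C fC] := fd N; have [D gD] := gd N.
exists (C + D) => x; apply: (le_trans _ (lerD (fC x) (gD x))).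
by rewrite -mulrDl ler_wpM2r ?ler_normD// ltW// sq1X_gt0.
Qed.

Lemma dboundM f g : tbound f -> dbound g -> dbound (fun x => f x * g x).
Proof.
move=> /tbound_ge0[M [D [D0 fD]]] gd N; have [C gC] := gd (M + N)%N.
exists (D * C) => x; rewrite normrM.
apply: (@le_trans _ _ (D * (1 + sqn x) ^+ M * `|g x| * (1 + sqn x) ^+ N)).
  by rewrite -!mulrA !mulrA ler_wpM2r ?(ltW (sq1X_gt0 _ _))// ler_wpM2r.
rewrite -!mulrA ler_wpM2l//; apply: (le_trans _ (gC x)).
by rewrite exprD mulrCA.
Qed.

Lemma temperedD f g : tempered f -> tempered g -> tempered (fun x => f x + g x).
Proof.
move=> [cf tf] [cg tg]; split; last exact: tboundD.
by move=> x; apply: continuousD; [exact: cf|exact: cg].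
Qed.

Lemma temperedM f g : tempered f -> tempered g -> tempered (fun x => f x * g x).
Proof.
move=> [cf tf] [cg tg]; split; last exact: tboundM.
by move=> x; apply: continuousM; [exact: cf|exact: cg].
Qed.

Lemma temperedN f : tempered f -> tempered (fun x => - f x).
Proof.
move=> [cf [N [C HC]]]; split; first by move=> x; apply: continuousN; exact: cf.
by exists N, C => x; rewrite normrN.
Qed.

Lemma decayingD f g : decaying f -> decaying g -> decaying (fun x => f x + g x).
Proof.
move=> [cf tf] [cg tg]; split; last exact: dboundD.
by move=> x; apply: continuousD; [exact: cf|exact: cg].
Qed.

Lemma decayingM f g : tempered f -> decaying g -> decaying (fun x => f x * g x).
Proof.
move=> [cf tf] [cg tg]; split; last exact: dboundM.
by move=> x; apply: continuousM; [exact: cf|exact: cg].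
Qed.

Lemma tempered_cst c : tempered (fun _ => c).
Proof.
split; first exact: cst_continuous.
by exists 0%N, `|c| => x; rewrite expr0 mulr1.
Qed.

Lemma tempered_coord i : tempered (fun x => x 0 i).
Proof.
split; first exact: coord_continuous.
exists 1%N, 1 => x; rewrite mul1r expr1.
have := sqn_coord x i; have := sqr_ge0 (`|x 0 i| - 1).
rewrite -(real_normK (num_real (x 0 i))) => h1 h2.
have := normr_ge0 (x 0 i); move: h1 h2; rewrite !expr2; nra.
Qed.

Lemma Ck_coord k i : Ck tempered k (fun x => x 0 i).
Proof.
case: k => [|k]; first by split=> //; exact: tempered_coord.
split; first exact: tempered_coord.
move=> j; exists (fun _ => (j == i)%:R); split; first exact: pder_coord.
exact: (Ck_cst _ _ tempered_cst).
Qed.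

Lemma Ck_expR k f : Ck tempered k f -> decaying (fun x => expR (f x)) ->
  Ck decaying k (fun x => expR (f x)).
Proof.
move=> fk fd; elim: k fk => [|k ih] fk; first by split.
split=> // i; have [_ /(_ i)[g [fg gk]]] := fk.
exists (fun x => expR (f x) * g x); split; first exact: pder_expR.
rewrite (_ : (fun x => _) = fun x => g x * expR (f x)); last first.
  by apply/funext => x; rewrite mulrC.
apply: CkM gk (ih (CkS fk)); [exact: decayingM|exact: decayingD].
Qed.

End partial_derivatives.

(** * Convolutions *)

Section parametric_integrals.
Context {R : realType} {n : nat}.
Implicit Types (f g : 'rV[R]_n -> R) (Phi : 'rV[R]_n -> 'rV[R]_n -> R).

Lemma cvg_itg (f_ : nat -> 'rV[R]_n -> R) f g : (forall k, mble (f_ k)) ->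
  itgble g -> (forall x, f_ k x @[k --> \oo] --> f x) ->
  (forall k x, `|f_ k x| <= g x) -> itg (f_ k) @[k --> \oo] --> itg f.
Proof.
move=> mf gi ff fg.
have mf' : mble f.
  apply: (measurable_fun_cvg (h := fun k t => f_ k (row_of_tuple t))) => //.
have fi : itgble f.
  apply: itgble_le gi _ => // x.
  have : `|f_ k x| @[k --> \oo] --> `|f x| by apply: cvg_norm.
  move=> h; rewrite -(cvg_lim _ h)//; apply: limr_le; first exact: cvgP h.
  by apply: nearW => k; exact: fg.
rewrite /itg /Rintegral; apply: fine_cvg.
rewrite fineK; last exact: integrable_fin_num.
apply: (@dominated_cvg _ _ _ (lebesgue_tuple R n) setT measurableT
   (fun k t => (f_ k (row_of_tuple t))%:E) _ (fun t => (g (row_of_tuple t))%:E)) => //.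
- by move=> k; apply/measurable_EFinP; exact: mf.
- by move=> t _; apply: cvg_EFin; [exact: nearW|exact: ff].
- by move=> k t _; rewrite lee_fin; exact: fg.
Qed.

(** Reduces continuity to sequences, the form in which dominated convergence applies; the rate
    1/(k+1) keeps the whole sequence within distance 1, where the majorant is valid. *)
Lemma continuous_seqP f : (forall (x : 'rV[R]_n) (u : nat -> 'rV[R]_n),
  (forall k, `|x - u k| < k.+1%:R^-1) -> f (u k) @[k --> \oo] --> f x) -> continuous f.
Proof.
move=> H x; apply/(@cvgrPdist_lt _ _ _ (nbhs x)) => e e0.
apply: contrapT => nH.
have P k : exists y, `|x - y| < k.+1%:R^-1 /\ ~ `|f x - f y| < e.
  apply: contrapT => /forallNP nP; apply: nH.
  apply/nbhs_ballP; exists k.+1%:R^-1; first by rewrite /= invr_gt0.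
  move=> y /=; rewrite -ball_normE/= => xy.
  by apply: contrapT => fxy; apply: (nP y).
have [u Hu] := choice P.
have := H x u (fun k => (Hu k).1).
move/cvgrPdist_lt => /(_ _ e0)[N _ /(_ N (leqnn N))] /=.
by have [] := Hu N.
Qed.

Lemma continuous_itg Phi : (forall x, mble (Phi x)) ->
  (forall z, continuous (Phi ^~ z)) ->
  (forall x, exists H, itgble H /\ forall y, `|x - y| <= 1 -> forall z, `|Phi y z| <= H z) ->
  continuous (fun x => itg (Phi x)).
Proof.
move=> mP cP dP; apply: continuous_seqP => x u ux.
have [H [iH HP]] := dP x.
have cu : u k @[k --> \oo] --> x.
  apply/cvgrPdist_lt => e e0; near=> k.
  apply: (lt_trans (ux k)); near: k.
  by have := near_infty_natSinv_lt (PosNum e0).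
apply: (cvg_itg (g := H)) => //.
- by move=> z; apply: (cvg_comp u (Phi ^~ z) cu); exact: cP.
- move=> k z; apply: HP; apply: ltW; apply: (lt_le_trans (ux k)).
  by rewrite invf_le1// ler1n.
Unshelve. all: by end_near. Qed.

Lemma pder_itg (i : 'I_n) Phi Phi' : (forall x, itgble (Phi x)) ->
  (forall z, pder i (Phi ^~ z) (Phi' ^~ z)) ->
  (forall x, exists H, itgble H /\ forall t : R, `|t| <= 1 -> forall z,
     `|Phi' (t *: delta_mx 0 i + x) z| <= H z) ->
  pder i (fun x => itg (Phi x)) (fun x => itg (Phi' x)).
Proof.
move=> iP dP bP x; have [H [iH HP]] := bP x.
apply: is_derive_of_line.
pose f (h : R) (t : n.-tuple (measurableTypeR R)) : R :=
  Phi (h *: delta_mx 0 i + x) (row_of_tuple t).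
have d1 (h : R) t : is_derive h 1 (f ^~ t) (Phi' (h *: delta_mx 0 i + x) (row_of_tuple t)).
  exact: (pder_line x h (dP (row_of_tuple t))).
have d1E h t : partial1of2 f h t = Phi' (h *: delta_mx 0 i + x) (row_of_tuple t).
  by rewrite partial1of2E; have [_ ->] := d1 h t.
have I0 : (`]-1, 1[%classic : set R) 0.
  by rewrite /= in_itv/= ltrN10 ltr01.
have IP (h : R) : (`]-1, 1[%classic : set R) h -> `|h| <= 1.
  by rewrite /= in_itv/= => /andP[/ltW h1 /ltW h2]; rewrite ler_norml h1.
have Hi : (lebesgue_tuple R n).-integrable setT (EFin \o (fun t => H (row_of_tuple t))) by [].
have H0 y : 0 <= H (row_of_tuple y).
  by apply: le_trans (HP 0 _ (row_of_tuple y)); rewrite ?normr0.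
have A1 : forall h : R, (`]-1, 1[%classic : set R) h ->
   (lebesgue_tuple R n).-integrable setT (EFin \o f h) by move=> h _; exact: iP.
have A2 : forall (h : R) t, (`]-1, 1[%classic : set R) h -> setT t -> derivable (f ^~ t) h 1.
  by move=> h t _ _; have [] := d1 h t.
have A3 : forall (h : R) t, (`]-1, 1[%classic : set R) h -> setT t ->
    `|partial1of2 f h t| <= H (row_of_tuple t).
  by move=> h t /IP h1 _; rewrite d1E; exact: HP.
split.
  exact: (derivable_under_integral measurableT I0 A1 A2 H0 Hi A3).
have := differentiation_under_integral measurableT I0 A1 A2 H0 Hi A3.
rewrite derive1E => ->; apply: eq_Rintegral => t _.
by rewrite d1E scale0r add0r.
Qed.

Lemma sqn_shift_le (x : 'rV[R]_n) (t : R) i : `|t| <= 1 ->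
  1 + sqn (t *: delta_mx 0 i + x) <= 3 * (1 + sqn x).
Proof.
move=> t1; have := sqnD_le (t *: delta_mx 0 i) x; rewrite sqnZ.
have -> : sqn (delta_mx 0 i : 'rV[R]_n) = 1.
  rewrite /sqn (bigD1 i)//= mxE !eqxx expr1n big1 ?addr0// => j ji.
  by rewrite mxE (negbTE ji) andbF expr0n.
have : t ^+ 2 <= 1 by rewrite -real_normK ?num_real// expr_le1.
by have := sqn_ge0 x; lra.
Qed.

Lemma sqn_near_le (x y : 'rV[R]_n) : `|x - y| <= 1 ->
  1 + sqn y <= (2 + 2 * n%:R) * (1 + sqn x).
Proof.
move=> xy.
have S : sqn (x - y) <= n%:R.
  rewrite /sqn -[leRHS]mulr1 mulr_natl -[n in leRHS]card_ord -sumr_const.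
  apply: ler_sum => i _; rewrite -real_normK ?num_real// expr_le1//.
  by apply: (le_trans _ xy); rewrite [leRHS]mx_normrE;
    apply: (le_bigmax _ _ (ord0, i)).
apply: (le_trans (peetre x y)); have := sqn_ge0 x; nra.
Qed.

(** Uniform convergence of functions and derivatives along a unit segment of a coordinate line. The
    mean value theorem is applied to F_k(t) - t G(x), and k tends to infinity with the increment h
    fixed. *)
Lemma pder_limit (i : 'I_n) (F_ G_ : nat -> 'rV[R]_n -> R) F G (a : nat -> R) (K : 'rV[R]_n -> R) :
  (forall k, pder i (F_ k) (G_ k)) -> a k @[k --> \oo] --> 0 ->
  (forall x, exists2 M, 0 < M & forall t : R, `|t| <= 1 -> K (t *: delta_mx 0 i + x) <= M) ->
  (forall k, 0 <= a k) ->
  (forall k x, `|F_ k x - F x| <= a k * K x) ->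
  (forall k x, `|G_ k x - G x| <= a k * K x) -> continuous G ->
  pder i F G.
Proof.
move=> FG a0 KM ap FF GG cG x; apply: is_derive_of_line.
have [M M0 HM] := KM x.
pose L (t : R) := t *: delta_mx 0 i + x.
have cL : continuous L.
  move=> t; apply: (@continuousD _ _ _ (fun t : R => t *: delta_mx 0 i) (fun _ => x)).
    exact: scalel_continuous.
  exact: cst_continuous.
have cGL : (fun t => G (L t)) t @[t --> (0 : R)] --> G (L 0).
  apply: (@continuous_comp _ _ _ L G); [exact: cL|exact: cG].
have key : h^-1 *: (F (L (h *: 1 + 0)) - F (L 0)) @[h --> (0 : R)^'] --> G x.
  apply/cvgrPdist_le => e e0.
  have e4 : 0 < e / 2 by rewrite divr_gt0.
  move/cvgrPdist_lt : cGL => /(_ _ e4)[d /= d0 Hd].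
  near=> h.
  have h0 : h != 0 by near: h; exact: nbhs_dnbhs_neq.
  have hd : `|h| < d.
    near: h; apply: nbhs_dnbhs; apply/nbhs_ballP; exists d => // y.
    by rewrite /ball/= sub0r normrN.
  have h1 : `|h| <= 1.
    near: h; apply: nbhs_dnbhs; apply/nbhs_ballP; exists 1 => [|y]; first exact: ltr01.
    by rewrite /ball/= sub0r normrN => /ltW.
  have hp : 0 < `|h| by rewrite normr_gt0.
  (* mean value theorem for F_ k, then k -> oo *)
  have B k : `|F_ k (L h) - F_ k (L 0) - h * G x| <= `|h| * (a k * M + e / 2).
    pose phi (t : R) := F_ k (L t) - t * G x.
    have dphi (t : R) : is_derive t 1 phi (G_ k (L t) - G x).
      apply: is_deriveB; first exact: (pder_line x t (FG k)).
      have := is_deriveM (is_derive_id t (1 : R)) (is_derive_cst (G x) t (1 : R)).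
      move=> H; apply: (is_derive_eq H).
      by rewrite /GRing.scale/= mulr0 add0r mulr1.
    have cphi t : {for t, continuous phi}.
      apply: differentiable_continuous; apply/derivable1_diffP.
      by have [] := dphi t.
    have bnd c : `|c| <= `|h| -> `|G_ k (L c) - G x| <= a k * M + e / 2.
      move=> ch.
      rewrite -(subrK (G (L c)) (G_ k (L c))) -addrA.
      apply: (le_trans (ler_normD _ _)); apply: lerD.
        apply: (le_trans (GG k _)); rewrite ler_wpM2l//.
        by apply: HM; exact: le_trans ch h1.
      apply: ltW; rewrite distrC.
      have := Hd c; rewrite /ball/= sub0r normrN => /(_ (le_lt_trans ch hd)).
      by rewrite /L scale0r add0r.
    have -> : F_ k (L h) - F_ k (L 0) - h * G x = phi h - phi 0.
      by rewrite /phi mul0r subr0; ring.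
    have [hlt|hgt|/eqP] := ltgtP h 0; last by rewrite (negbTE h0).
      have [c cin Ec] := @MVT R phi (fun t => G_ k (L t) - G x) h 0 hlt (fun t _ => dphi t)
        (continuous_subspaceT cphi).
      rewrite distrC Ec normrM sub0r normrN mulrC ler_wpM2l//; apply: bnd.
      move: cin; rewrite in_itv/= => /andP[hc c0].
      by rewrite !ltr0_norm// lerN2 ltW.
    have [c cin Ec] := @MVT R phi (fun t => G_ k (L t) - G x) 0 h hgt (fun t _ => dphi t)
        (continuous_subspaceT cphi).
    rewrite Ec normrM subr0 mulrC ler_wpM2l//; apply: bnd.
    move: cin; rewrite in_itv/= => /andP[c0 ch].
    by rewrite !gtr0_norm// ltW.
  have B' : `|F (L h) - F (L 0) - h * G x| <= `|h| * (e / 2).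
    have cv : `|h| * (a k * M + e / 2) + (a k * M + a k * M) @[k --> \oo] -->
        `|h| * (0 * M + e / 2) + (0 * M + 0 * M).
      have aM : a k * M @[k --> \oo] --> 0 * M by apply: cvgM => //; exact: cvg_cst.
      apply: cvgD; last exact: cvgD.
      by apply: cvgM; [exact: cvg_cst|apply: cvgD => //; exact: cvg_cst].
    rewrite !mul0r add0r !addr0 in cv.
    rewrite -(cvg_lim _ cv)//; apply: limr_ge; first exact: cvgP cv.
    apply: nearW => k.
    have -> : F (L h) - F (L 0) - h * G x = (F_ k (L h) - F_ k (L 0) - h * G x) -
       ((F_ k (L h) - F (L h)) - (F_ k (L 0) - F (L 0))) by ring.
    apply: (le_trans (ler_normB _ _)); apply: lerD => //.
    apply: (le_trans (ler_normB _ _)); apply: lerD; apply: (le_trans (FF k _));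
      rewrite ler_wpM2l//; apply: HM => //.
    by rewrite normr0.
  rewrite addr0 (_ : h *: 1 = h); last exact: mulr1.
  have -> : G x - h^-1 *: (F (L h) - F (L 0)) = - (h^-1 * (F (L h) - F (L 0) - h * G x)).
    by rewrite /GRing.scale/=; field.
  rewrite normrN normrM normfV ler_pdivrMl//; apply: (le_trans B').
  by rewrite ler_wpM2l//; move: e0; lra.
split; first by apply/cvg_ex; exists (G x); exact: key.
by apply: cvg_lim => //; exact: key.
Unshelve. all: by end_near. Qed.

Lemma continuous_limit (F_ : nat -> 'rV[R]_n -> R) F (a : nat -> R) (K : 'rV[R]_n -> R) :
  (forall k, continuous (F_ k)) -> a k @[k --> \oo] --> 0 ->
  (forall x, exists M, forall y, `|x - y| <= 1 -> K y <= M) ->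
  (forall k, 0 <= a k) ->
  (forall k x, `|F_ k x - F x| <= a k * K x) -> continuous F.
Proof.
move=> cF a0 KM ap FF x; apply/(@cvgrPdist_lt _ _ _ (nbhs x)) => e e0.
have [M HM] := KM x.
have : a k * M @[k --> \oo] --> 0 * M by apply: cvgM => //; exact: cvg_cst.
rewrite mul0r => /cvgr0Pnorm_lt/(_ (e / 3)).
rewrite divr_gt0// => /(_ isT)[N _ /(_ N (leqnn N))/= aN].
have aN' : a N * M < e / 3 by apply: le_lt_trans aN; exact: ler_norm.
near=> y.
have xy : `|x - y| <= 1 by apply: ltW; near: y; apply: cvgr_dist_lt.
have FN : `|F_ N x - F_ N y| < e / 3.
  by near: y; apply: cvgr_dist_lt; [exact: cF|rewrite divr_gt0].
have b1 := le_trans (FF N x) (ler_wpM2l (ap N) (HM x _)).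
have b2 := le_trans (FF N y) (ler_wpM2l (ap N) (HM y xy)).
have {}b1 : `|F_ N x - F x| <= a N * M by apply: b1; rewrite subrr normr0.
have -> : F x - F y = (F_ N x - F_ N y) - ((F_ N x - F x) - (F_ N y - F y)) by ring.
apply: (le_lt_trans (ler_normB _ _)).
have := ler_normB (F_ N x - F x) (F_ N y - F y).
by move: FN b1 b2 aN'; lra.
Unshelve. all: by end_near. Qed.

End parametric_integrals.

(** * Convolutions under a common majorant *)

Section convolution.
Context {R : realType} {n : nat} (n4 : (4 <= n)%N).
Implicit Types (f g : 'rV[R]_n -> R) (x y z : 'rV[R]_n).

Let n0 : (0 < n)%N. Proof. exact: leq_trans n4. Qed.

Definition convol g f x : R := itg (fun z => g z * f (x - z)).

(* Admissible kernels: an integrable singularity at the origin and polynomial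
   growth; the value at the origin is unconstrained up to a constant. *)
Definition adm g := mble g /\ exists N C, forall z,
  `|g z| <= C * ((1 + (sqn z)^-1) * (1 + sqn z) ^+ N).

(** The dependence on [x] is a polynomial factor, hence locally bounded. One majorant thus yields
    integrability, continuity, differentiation under the integral and polynomial growth of the
    convolution. *)
Definition dom g f := exists M K H, [/\ itgble H, 0 <= K, forall z, 0 <= H z &
  forall x z, `|g z * f (x - z)| <= K * (1 + sqn x) ^+ M * H z].

Lemma sqnVD1_ge1 z : 1 <= 1 + (sqn z)^-1.
Proof. by rewrite lerDl invr_ge0 sqn_ge0. Qed.

Lemma tempered_adm g : tempered g -> adm g.
Proof.
move=> [cg /tbound_ge0[N [C [C0 gC]]]]; split; first exact: mble_continuous.
exists N, C => z; apply: (le_trans (gC z)); rewrite ler_wpM2l//.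
by rewrite ler_peMl ?sqnVD1_ge1// ltW// sq1X_gt0.
Qed.

Lemma peetreX x z N :
  (1 + sqn z) ^+ N <= 2 ^+ N * (1 + sqn x) ^+ N * (1 + sqn (x - z)) ^+ N.
Proof.
by rewrite -!exprMn lerXn2r ?nnegrE ?mulr_ge0// ?(ltW (sq1_gt0 _))// peetre.
Qed.

Lemma peetreX' x z N :
  (1 + sqn (x - z)) ^+ N <= 2 ^+ N * (1 + sqn x) ^+ N * (1 + sqn z) ^+ N.
Proof. by have := peetreX x (x - z) N; rewrite subKr. Qed.

(** The decay of [f] to order N + n is moved from x - z to z by Peetre's inequality: N powers absorb
    the growth of the kernel, and n powers form the weight in [sing 0]. *)
Lemma dom_adm g f : adm g -> dbound f -> dom g f.
Proof.
move=> [mg [N [C gC]]] df; have [D fD] := df (N + n)%N.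
have [CS HS] := itgble_sing (R := R) n4; have [iS _] := HS 0.
have D0 : 0 <= D.
  by apply: le_trans (fD 0); rewrite mulr_ge0// ltW// sq1X_gt0.
have C0 : 0 <= `|C| by [].
exists (N + n)%N, (`|C| * D * 2 ^+ (N + n)), (sing 0); split => //.
- by rewrite !mulr_ge0.
- by move=> z; exact: sing_ge0.
move=> x z; rewrite normrM.
set p := (1 + sqn x) ^+ (N + n).
have p0 : 0 < p by exact: sq1X_gt0.
have q0 := sq1X_gt0 (x - z) (N + n); have r0 := sq1X_gt0 z (N + n).
have f1 : `|f (x - z)| <= D * (2 ^+ (N + n) * p) / (1 + sqn z) ^+ (N + n).
  rewrite ler_pdivlMr//.
  apply: (le_trans (ler_wpM2l (normr_ge0 _) (peetreX x z (N + n)))).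
  rewrite mulrCA [leRHS]mulrC ler_wpM2l ?mulr_ge0 ?(ltW p0)//.
have g1 : `|g z| <= `|C| * ((1 + (sqn z)^-1) * (1 + sqn z) ^+ N).
  apply: (le_trans (gC z)); rewrite ler_wpM2r ?ler_norm//.
  by rewrite mulr_ge0 ?(le_trans ler01 (sqnVD1_ge1 z))// ltW// sq1X_gt0.
apply: (le_trans (ler_pM _ _ g1 f1)) => //.
rewrite /sing sub0r sqnN /wgt (exprD (1 + sqn z)) invfM.
rewrite le_eqVlt; apply/orP; left; apply/eqP.
have r1 := lt0r_neq0 (sq1X_gt0 z N); have r2 := lt0r_neq0 (sq1X_gt0 z n).
move: r1 r2; set A := (1 + sqn z) ^+ N; set B := (1 + sqn z) ^+ n; set s := (sqn z)^-1.
by move=> r1 r2; field; rewrite r1 r2.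
Qed.

Lemma dom_tempered f g : dbound f -> tbound g -> dom f g.
Proof.
move=> df /tbound_ge0[N [C [C0 gC]]]; have [D fD] := df (N + n)%N.
have D0 : 0 <= D.
  by apply: le_trans (fD 0); rewrite mulr_ge0// ltW// sq1X_gt0.
exists N, (C * 2 ^+ N * D), (@wgt R n); split => //.
- exact: itgble_wgt.
- by rewrite !mulr_ge0.
- by move=> z; rewrite ltW// wgt_gt0.
move=> x z; rewrite normrM.
have g1 : `|g (x - z)| <= C * (2 ^+ N * (1 + sqn x) ^+ N * (1 + sqn z) ^+ N).
  by apply: (le_trans (gC _)); rewrite ler_wpM2l// peetreX'.
have f1 : `|f z| <= D / (1 + sqn z) ^+ (N + n).
  by rewrite ler_pdivlMr ?sq1X_gt0.
apply: (le_trans (ler_pM _ _ f1 g1)) => //.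
rewrite /wgt (exprD (1 + sqn z)) invfM.
rewrite le_eqVlt; apply/orP; left; apply/eqP.
have r1 := lt0r_neq0 (sq1X_gt0 z N); have r2 := lt0r_neq0 (sq1X_gt0 z n).
by field; rewrite r1 r2.
Qed.

Lemma mble_convolvand g f x : mble g -> mble f -> mble (fun z => g z * f (x - z)).
Proof. by move=> mg mf; apply: mbleM => //; exact: mble_subl. Qed.

Lemma conv_itgble g f x : mble g -> mble f -> dom g f ->
  itgble (fun z => g z * f (x - z)).
Proof.
move=> mg mf [M [K [H [iH K0 H0 HH]]]].
apply: itgble_le (itgbleZ (K * (1 + sqn x) ^+ M) iH) _; first exact: mble_convolvand.
exact: HH.
Qed.

Lemma conv_tbound g f : mble g -> mble f -> dom g f -> tbound (convol g f).
Proof.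
move=> mg mf [M [K [H [iH K0 H0 HH]]]].
exists M, (K * itg H) => x.
rewrite mulrAC -itgZ//; apply: le_normr_itg => //; [exact: mble_convolvand|].
exact: itgbleZ.
Qed.

Lemma convolC g f : mble g -> mble f -> dom g f -> convol g f = convol f g.
Proof.
move=> mg mf df; apply/funext => x; rewrite /convol.
have N10 : -1 != 0 :> R by rewrite oppr_eq0 oner_eq0.
rewrite (itg_affine x N10 (conv_itgble x mg mf df)) normrN1 expr1n mul1r.
by congr itg; apply/funext => z; rewrite scaleN1r subKr mulrC.
Qed.

Lemma continuous_conv g f : mble g -> continuous f -> dom g f -> continuous (convol g f).
Proof.
move=> mg cf [M [K [H [iH K0 H0 HH]]]].
have mf := mble_continuous cf.
apply: continuous_itg => [x|z|x]; first exact: mble_convolvand.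
  move=> x; apply: continuousM; first exact: cst_continuous.
  apply: (@continuous_comp _ _ _ (fun x => x - z) f); last exact: cf.
  apply: continuousB; [exact: cvg_id|exact: cst_continuous].
exists (fun z => K * ((2 + 2 * n%:R) * (1 + sqn x)) ^+ M * H z); split.
  exact: itgbleZ.
move=> y xy z; apply: (le_trans (HH y z)); rewrite ler_wpM2r// ler_wpM2l//.
rewrite lerXn2r ?nnegrE ?(ltW (sq1_gt0 _))//; last exact: sqn_near_le.
by rewrite mulr_ge0 ?(ltW (sq1_gt0 _))// addr_ge0// mulr_ge0.
Qed.

Lemma pder_convr i g f f' : mble g -> continuous f -> mble f' -> dom g f -> dom g f' ->
  pder i f f' -> pder i (convol g f) (convol g f').
Proof.
move=> mg cf mf' df [M [K [H [iH K0 H0 HH]]]] ff.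
have mf := mble_continuous cf.
apply: pder_itg => [x|z x|x]; first exact: conv_itgble.
  have fz : pder i (fun y => f (y - z)) (fun y => f' (y - z)).
    move=> y; apply: is_derive_of_line.
    have := pder_line (y - z) 0 ff; rewrite scale0r add0r.
    by under eq_fun do rewrite addrA.
  by have := pderZ (g z) fz; exact.
exists (fun z => K * (3 * (1 + sqn x)) ^+ M * H z); split; first exact: itgbleZ.
move=> t t1 z; apply: (le_trans (HH _ z)); rewrite ler_wpM2r// ler_wpM2l//.
rewrite lerXn2r ?nnegrE ?mulr_ge0 ?(ltW (sq1_gt0 _))//; exact: sqn_shift_le.
Qed.

Lemma conv_tempered g f : adm g -> decaying f -> tempered (convol g f).
Proof.
move=> ag [cf df]; have d := dom_adm ag df; have [mg _] := ag.
split; first exact: continuous_conv.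
by apply: conv_tbound => //; exact: mble_continuous.
Qed.

Lemma Ck_conv g k f : adm g -> Ck decaying k f -> Ck tempered k (convol g f).
Proof.
move=> ag; have [mg _] := ag.
elim: k f => [|k ih] f [fd fk]; first by split=> //; exact: conv_tempered.
split=> [|i]; first exact: conv_tempered.
have [f' [ff' fk']] := fk i; exists (convol g f'); split; last exact: ih.
have [cf df] := fd; have [cf' df'] := Ck0 fk'.
by apply: pder_convr => //; [exact: mble_continuous|exact: dom_adm..].
Qed.

Section laplacian_conv.
Context (B : ('rV[R]_n -> R) -> Prop) (g : 'rV[R]_n -> R).
Context (mg : mble g) (Bc : forall h, B h -> continuous h).
Context (Bdom : forall h, B h -> dom g h).
Context (BD : forall f h, B f -> B h -> B (fun x => f x + h x)).
Context (BN : forall f, B f -> B (fun x => - f x)).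

(** The class [B] is abstract because two instances occur: an admissible kernel against decaying
    functions, and a decaying density against tempered functions such as the regularized
    logarithm. *)
Lemma laplacian_conv f : Ck B 2 f -> laplacian (convol g f) = convol g (laplacian f).
Proof.
move=> f2; have [Bf f1] := f2.
have [f' /all_and2[ff' fk']] := choice f1.
have f1' i := (fk' i).2 i.
have [f'' /all_and2[ff'' fk'']] := choice f1'.
have mb h : B h -> mble h by move=> /Bc/mble_continuous.
rewrite (laplacianE (f := f) (g := f') (h := f''))// (laplacianE (f := convol g f)
  (g := fun i => convol g (f' i)) (h := fun i => convol g (f'' i))); last 2 first.
- move=> i; have d' := (fk' i).1.
  by apply: pder_convr => //; [exact: Bc|exact: mb|exact: Bdom|exact: Bdom].
- move=> i; have d' := (fk' i).1; have d'' := (fk'' i).1.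
  by apply: pder_convr => //; [exact: Bc|exact: mb|exact: Bdom|exact: Bdom].
apply/funext => x; rewrite /convol.
have H (s : seq 'I_n) : itgble (fun z => g z * \sum_(i <- s) f'' i (x - z)) /\
   \sum_(i <- s) itg (fun z => g z * f'' i (x - z)) =
   itg (fun z => g z * \sum_(i <- s) f'' i (x - z)); last by have [_] := H (index_enum _).
elim: s => [|i s [si Hs]].
  have E : (fun z : 'rV[R]_n => g z * \sum_(i <- [::]) f'' i (x - z)) = fun=> 0.
    by apply/funext => z; rewrite big_nil mulr0.
  rewrite E big_nil; split; first exact: integrable0.
  by rewrite /itg /Rintegral integral0.
have E : (fun z : 'rV[R]_n => g z * \sum_(j <- i :: s) f'' j (x - z)) =
    fun z => g z * f'' i (x - z) + g z * \sum_(j <- s) f'' j (x - z).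
  by apply/funext => z; rewrite big_cons mulrDr.
have d'' := (fk'' i).1.
have ii : itgble (fun z => g z * f'' i (x - z)).
  by apply: conv_itgble => //; [exact: mb|exact: Bdom].
by rewrite E big_cons Hs -itgD//; split=> //; exact: itgbleD.
Qed.

Lemma convN f : B f -> convol g (fun x => - f x) = fun x => - convol g f x.
Proof.
move=> Bf; apply/funext => x; rewrite /convol -mulN1r -itgZ.
  by congr itg; apply/funext => z; rewrite mulrN mulN1r.
by apply: conv_itgble; [exact: mg|exact: mble_continuous (Bc Bf)|exact: Bdom].
Qed.

Lemma CkN k f : Ck B k f -> Ck B k (fun x => - f x).
Proof.
elim: k f => [f [Bf _]|k ih f [Bf fk]]; split=> //; try exact: BN.
move=> i; have [f' [ff' fk']] := fk i.
exists (fun x => - f' x); split; last exact: ih.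
by move=> x; exact: is_deriveN.
Qed.

(** [B] is closed under addition but is not assumed to contain 0, so the induction starts from a
    single summand; the index type is inhabited because n >= 4. *)
Lemma Ck_sum_nonempty k (F : 'I_n -> 'rV[R]_n -> R) : (forall i, Ck B k (F i)) ->
  Ck B k (fun x => \sum_i F i x).
Proof.
move=> FB; case E : (index_enum 'I_n) => [|i s].
  by have := mem_index_enum (Ordinal n0); rewrite E.
elim: s i {E} => [|j s ih] i.
  by under eq_fun do rewrite big_seq1; exact: FB.
under eq_fun do rewrite big_cons.
by apply: CkD => //; exact: ih.
Qed.

Lemma Ck_laplacian k f : Ck B k.+2 f -> Ck B k (laplacian f).
Proof.
move=> [Bf f1].
have [f' /all_and2[ff' fk']] := choice f1.
have f1' i := (fk' i).2 i.
have [f'' /all_and2[ff'' fk'']] := choice f1'.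
rewrite (laplacianE (f := f) (g := f') (h := f''))//.
exact: Ck_sum_nonempty.
Qed.

Lemma polylaplacian_conv j f : (forall k, Ck B k f) ->
  polylaplacian j (convol g f) = convol g (polylaplacian j f).
Proof.
rewrite /polylaplacian; elim: j f => [//|j ih] f fk; rewrite !iterSr.
rewrite laplacian_conv//; have Bl k : Ck B k (laplacian f) by exact: Ck_laplacian.
rewrite -(convN (f := laplacian f)); last exact: Ck0 (Bl 0%N).
by rewrite ih// => k; exact: CkN.
Qed.

End laplacian_conv.

End convolution.

(** * The logarithmic kernel *)

Section logarithmic_kernel.
Context {R : realType} {n : nat} (n4 : (4 <= n)%N).
Implicit Types (f g : 'rV[R]_n -> R) (x y z : 'rV[R]_n) (e : R).

Let n0 : (0 < n)%N. Proof. exact: leq_trans n4. Qed.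

Definition logk z : R := 2^-1 * ln (sqn z).
Definition logk_eps e z : R := 2^-1 * ln (e ^+ 2 + sqn z).
Definition resk e z : R := (e ^+ 2 + sqn z)^-1.
Definition gradk (i : 'I_n) z : R := z 0 i * (sqn z)^-1.
Definition gradk_eps (i : 'I_n) e z : R := z 0 i * resk e z.

Lemma eps_sqn_gt0 e z : 0 < e -> 0 < e ^+ 2 + sqn z.
Proof. by move=> e0; rewrite ltr_wpDr ?sqn_ge0// exprn_gt0. Qed.

Lemma resk_gt0 e z : 0 < e -> 0 < resk e z.
Proof. by move=> e0; rewrite invr_gt0 eps_sqn_gt0. Qed.

Lemma ln_le_norm (t : R) : 0 < t -> `|ln t| <= t + t^-1.
Proof.
move=> t0; have := ln_sublinear t0; have := @ln_sublinear R t^-1.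
rewrite invr_gt0 lnV ?posrE// => /(_ t0) h1 h2.
have h3 : 0 < t^-1 by rewrite invr_gt0.
by rewrite ler_norml; apply/andP; split; move: h1 h2 h3 t0; lra.
Qed.

Lemma pder_eps_sqn e i : pder i (fun z => e ^+ 2 + sqn z) (fun z => 2 * z 0 i).
Proof.
have := pderD (pder_cst i (e ^+ 2)) (pder_sqn (R := R) (n := n) i).
by move=> H z; apply: (is_derive_eq (H z)); rewrite add0r.
Qed.

Lemma pder_resk e i : 0 < e ->
  pder i (resk e) (fun z => - 2 * (z 0 i * resk e z ^+ 2)).
Proof.
move=> e0; have p z : e ^+ 2 + sqn z != 0 by rewrite gt_eqF// eps_sqn_gt0.
have H := pder_inv p (pder_eps_sqn e i).
by move=> z; apply: (is_derive_eq (H z)); rewrite /resk; ring.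
Qed.

Lemma pder_logk_eps e i : 0 < e -> pder i (logk_eps e) (gradk_eps i e).
Proof.
move=> e0; have p z : 0 < e ^+ 2 + sqn z by exact: eps_sqn_gt0.
have H := pderZ 2^-1 (pder_ln p (pder_eps_sqn e i)).
by move=> z; apply: (is_derive_eq (H z)); rewrite /gradk_eps /resk; field; rewrite gt_eqF.
Qed.

Lemma continuous_eps_sqn e : continuous (fun z => e ^+ 2 + sqn z).
Proof.
move=> z; apply: (@continuousD _ _ _ (fun _ => e ^+ 2) (@sqn R n)).
  exact: cst_continuous.
exact: continuous_sqn.
Qed.

Lemma tempered_resk e : 0 < e -> tempered (resk e).
Proof.
move=> e0; split.
  move=> z; apply: (@continuousV _ _ (fun z => e ^+ 2 + sqn z)); first by rewrite gt_eqF// eps_sqn_gt0.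
  exact: continuous_eps_sqn.
exists 0%N, (e ^+ 2)^-1 => z; rewrite expr0 mulr1 gtr0_norm ?resk_gt0//.
by rewrite lef_pV2 ?posrE ?eps_sqn_gt0 ?exprn_gt0// lerDl sqn_ge0.
Qed.

Lemma tempered_logk_eps e : 0 < e -> tempered (logk_eps e).
Proof.
move=> e0; split.
  move=> z; apply: (@continuousM _ _ (fun _ => 2^-1) (fun z => ln (e ^+ 2 + sqn z))).
    exact: cst_continuous.
  apply: (continuous_comp (g := @ln R)); first exact: continuous_eps_sqn.
  by apply: continuous_ln; exact: eps_sqn_gt0.
exists 1%N, (e ^+ 2 + 1 + (e ^+ 2)^-1) => z; rewrite expr1.
have i1 : (e ^+ 2 + sqn z)^-1 <= (e ^+ 2)^-1.
  by rewrite lef_pV2 ?posrE ?eps_sqn_gt0 ?exprn_gt0// lerDl sqn_ge0.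
have i0 : 0 < (e ^+ 2)^-1 by rewrite invr_gt0 exprn_gt0.
have e2 : 0 < e ^+ 2 by rewrite exprn_gt0.
rewrite normrM gtr0_norm ?invr_gt0//.
have := ln_le_norm (eps_sqn_gt0 z e0); have := sqn_ge0 z.
have := normr_ge0 (ln (e ^+ 2 + sqn z)).
move: i1 i0 e2; set a := (e ^+ 2 + _)^-1; set b := (e ^+ 2)^-1; set c := e ^+ 2.
move=> h1 h2 h3 h4 h5 h6; have : 0 <= b * sqn z by rewrite mulr_ge0// ltW.
have : 0 <= c * sqn z by rewrite mulr_ge0// ltW.
move: h1 h2 h3 h4 h5 h6; nra.
Qed.

Lemma Ck_resk k e : 0 < e -> Ck tempered k (resk e).
Proof.
move=> e0; elim: k => [|k ih]; first by split=> //; exact: tempered_resk.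
split=> [|i]; first exact: tempered_resk.
exists (fun z => - 2 * (z 0 i * resk e z ^+ 2)); split; first exact: pder_resk.
apply: CkM; [exact: temperedM|exact: temperedD|exact: (Ck_cst _ _ tempered_cst)|].
apply: CkM; [exact: temperedM|exact: temperedD|exact: Ck_coord|].
under eq_fun do rewrite expr2.
by apply: (CkM temperedM temperedD).
Qed.

Lemma Ck_gradk_eps k i e : 0 < e -> Ck tempered k (gradk_eps i e).
Proof.
move=> e0; apply: CkM; [exact: temperedM|exact: temperedD|exact: Ck_coord|].
exact: Ck_resk.
Qed.

Lemma Ck_logk_eps k e : 0 < e -> Ck tempered k (logk_eps e).
Proof.
move=> e0; case: k => [|k]; first by split=> //; exact: tempered_logk_eps.
split=> [|i]; first exact: tempered_logk_eps.
by exists (gradk_eps i e); split; [exact: pder_logk_eps|exact: Ck_gradk_eps].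
Qed.

Lemma mble_logk : mble logk.
Proof. by apply: mbleM; [exact: mble_cst|apply: mble_ln; exact: mble_sqn]. Qed.

Lemma mble_sqnV : mble (fun z : 'rV[R]_n => (sqn z)^-1).
Proof. by apply: mbleV; exact: mble_sqn. Qed.

Lemma mble_gradk i : mble (gradk i).
Proof. by apply: mbleM; [exact: mble_coord|exact: mble_sqnV]. Qed.

Lemma adm_sqnV : adm (fun z : 'rV[R]_n => (sqn z)^-1).
Proof.
split; first exact: mble_sqnV.
exists 0%N, 1 => z; rewrite expr0 mulr1 mul1r ger0_norm ?invr_ge0 ?sqn_ge0//.
by rewrite lerDr.
Qed.

Lemma adm_logk : adm logk.
Proof.
split; first exact: mble_logk.
exists 1%N, 1 => z; rewrite expr1 mul1r.
have := sqn_ge0 z; rewrite le_eqVlt => /predU1P[q0|z0].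
  by rewrite /logk -q0 ln0// mulr0 normr0 invr0 !addr0 mulr1.
rewrite normrM gtr0_norm ?invr_gt0//; have := ln_le_norm z0.
have h : 0 < (sqn z)^-1 by rewrite invr_gt0.
have -> : (1 + (sqn z)^-1) * (1 + sqn z) = 2 + sqn z + (sqn z)^-1 by field; rewrite gt_eqF.
by have := normr_ge0 (ln (sqn z)); move: h z0; lra.
Qed.

Lemma coord_le_sqn z (i : 'I_n) : 2 * `|z 0 i| <= 1 + sqn z.
Proof.
have := sqn_coord z i; have := sqr_ge0 (`|z 0 i| - 1).
by rewrite -(real_normK (num_real (z 0 i))) !expr2; nra.
Qed.

Lemma adm_gradk i : adm (gradk i).
Proof.
split; first exact: mble_gradk.
exists 1%N, 1 => z; rewrite expr1 mul1r normrM (ger0_norm (x := _^-1)) ?invr_ge0 ?sqn_ge0//.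
rewrite mulrC; apply: ler_pM => //; first by rewrite invr_ge0 sqn_ge0.
  by rewrite lerDr.
by have := coord_le_sqn z i; have := normr_ge0 (z 0 i); lra.
Qed.

(** The error is measured against |z|^-2, so that [conv_diff] treats the kernel and its gradient
    alike. *)
Lemma logk_eps_diff e z : 0 < e -> z != 0 ->
  `|logk_eps e z - logk z| <= e * (e * (sqn z)^-1).
Proof.
move=> e0 z0; have q0 := sqn_gt0 z0.
rewrite /logk_eps /logk -mulrBr -ln_div ?posrE ?eps_sqn_gt0//.
have -> : (e ^+ 2 + sqn z) / sqn z = 1 + e ^+ 2 / sqn z by field; rewrite gt_eqF.
have p : 0 <= e ^+ 2 / sqn z by rewrite divr_ge0 ?exprn_ge0// ltW.
have l0 : 0 <= ln (1 + e ^+ 2 / sqn z) by rewrite ln_ge0// lerDl.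
have l1 : ln (1 + e ^+ 2 / sqn z) <= e ^+ 2 / sqn z.
  by rewrite le_ln1Dx// (lt_le_trans _ p)// ltrN10.
rewrite ger0_norm ?mulr_ge0//.
by move: l0 l1 p; rewrite (mulrA e) -expr2; lra.
Qed.

(** After a common denominator everything reduces to e |z_i| <= e^2 + |z|^2. *)
Lemma gradk_eps_diff e i z : 0 < e -> z != 0 ->
  `|gradk_eps i e z - gradk i z| <= e * (sqn z)^-1.
Proof.
move=> e0 z0; have q0 := sqn_gt0 z0; have p0 := eps_sqn_gt0 z e0.
rewrite /gradk_eps /gradk /resk.
have -> : z 0 i * (e ^+ 2 + sqn z)^-1 - z 0 i * (sqn z)^-1 =
   - (z 0 i * e ^+ 2 / (e ^+ 2 + sqn z) / sqn z).
  by field; rewrite !gt_eqF.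
rewrite normrN 3!normrM !normfV (gtr0_norm q0) (gtr0_norm p0).
rewrite (ger0_norm (x := e ^+ 2)) ?sqr_ge0// ler_pM2r ?invr_gt0//.
rewrite ler_pdivrMr// expr2 mulrCA ler_wpM2l ?(ltW e0)//.
have := sqn_coord z i; have := sqr_ge0 (`|z 0 i| - e).
rewrite -(real_normK (num_real (z 0 i))) !expr2.
by have := normr_ge0 (z 0 i); nra.
Qed.

(** The constants come from the convolution of |f| with |z|^-2 and hence depend on [f] alone, which
    makes all approximations below locally uniform. *)
Lemma conv_diff f : mble f -> dbound f -> exists M K, 0 <= K /\
  forall g h a, adm g -> adm h -> 0 <= a ->
  (forall z, z != 0 -> `|g z - h z| <= a * (sqn z)^-1) ->
  forall x, `|convol g f x - convol h f x| <= a * (K * (1 + sqn x) ^+ M).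
Proof.
move=> mf df.
have mf' : mble (fun y => `|f y|) by exact: mble_abs.
have df' : dbound (fun y => `|f y|).
  by move=> N; have [C fC] := df N; exists C => y; rewrite normr_id.
have [mq _] := adm_sqnV; have dq := dom_adm n4 adm_sqnV df'.
have [M [K [K0 HK]]] := tbound_ge0 (conv_tbound mq mf' dq).
exists M, K; split=> // g h a ag ah a0 gh x.
have [mg _] := ag; have [mh _] := ah.
have ig := conv_itgble x mg mf (dom_adm n4 ag df).
have ih := conv_itgble x mh mf (dom_adm n4 ah df).
apply: (@le_trans _ _ (a * convol (fun z => (sqn z)^-1) (fun y => `|f y|) x)); last first.
  by rewrite ler_wpM2l//; apply: (le_trans (ler_norm _)).
have iq := conv_itgble x mq mf' dq.
rewrite /convol -itgB// -itgZ//.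
apply: (@le_normr_itg_off _ _ 0) => //.
- by apply: mbleB; exact: mble_convolvand.
- exact: itgbleZ.
move=> z z0; rewrite -mulrBl normrM mulrA ler_wpM2r//; exact: gh.
Qed.

Let eps (k : nat) : R := k.+1%:R^-1.

Lemma eps_gt0 k : 0 < eps k. Proof. by rewrite invr_gt0. Qed.

Lemma eps_le1 k : eps k <= 1. Proof. by rewrite invf_le1// ler1n. Qed.

Lemma cvg_eps : eps k @[k --> \oo] --> (0 : R).
Proof. exact: cvg_harmonic. Qed.

Lemma logk_eps_approx f : mble f -> dbound f -> exists M K, 0 <= K /\
  (forall k x, `|convol (logk_eps (eps k)) f x - convol logk f x| <= eps k * (K * (1 + sqn x) ^+ M)) /\
  (forall i k x, `|convol (gradk_eps i (eps k)) f x - convol (gradk i) f x| <=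
     eps k * (K * (1 + sqn x) ^+ M)).
Proof.
move=> mf df; have [M [K [K0 HK]]] := conv_diff mf df.
have e0 k := eps_gt0 k.
exists M, K; split=> //; split=> [k x|i k x]; apply: HK.
- exact: tempered_adm (tempered_logk_eps (e0 k)).
- exact: adm_logk.
- exact: ltW.
- move=> z z0; apply: (le_trans (logk_eps_diff (e0 k) z0)).
  rewrite ler_wpM2l ?(ltW (e0 k))// ler_piMl ?eps_le1//.
  by rewrite invr_ge0 sqn_ge0.
- exact: tempered_adm (Ck0 (Ck_gradk_eps 0 i (e0 k))).
- exact: adm_gradk.
- exact: ltW.
- by move=> z z0; exact: gradk_eps_diff.
Qed.

Lemma conv_temperedC g f : tempered g -> mble f -> dbound f ->
  convol g f = convol f g /\ dom f g.
Proof.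
move=> tg mf df; have [cg bg] := tg.
split; last exact: dom_tempered.
by apply: convolC => //; [exact: mble_continuous|apply: dom_adm => //; exact: tempered_adm].
Qed.

(** Start of the bootstrap, for a density without any regularity: L_e is continuous and tempered, so
    exchanging the factors makes L_e * f continuous, and the limit is locally uniform. *)
Lemma continuous_conv_logk f : mble f -> dbound f -> continuous (convol logk f).
Proof.
move=> mf df; have [M [K [K0 [HK _]]]] := logk_eps_approx mf df.
apply: (@continuous_limit _ _ (fun k => convol (logk_eps (eps k)) f) _ eps
  (fun x => K * (1 + sqn x) ^+ M)) => //.
- move=> k; have tL := tempered_logk_eps (eps_gt0 k).
  have [-> dL] := conv_temperedC tL mf df; have [cL _] := tL.
  exact: continuous_conv.
- exact: cvg_eps.
- move=> x; exists (K * ((2 + 2 * n%:R) * (1 + sqn x)) ^+ M) => y xy.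
  rewrite ler_wpM2l// lerXn2r ?nnegrE ?(ltW (sq1_gt0 _))//; last exact: sqn_near_le.
  by rewrite mulr_ge0 ?(ltW (sq1_gt0 _))// addr_ge0// mulr_ge0.
- by move=> k; exact/ltW/eps_gt0.
Qed.

(** As [f] is merely continuous, the derivative has to fall on the kernel. This is legitimate for
    the smooth L_e after exchanging the factors, and [pder_limit] carries it to L. *)
Lemma pder_conv_logk i f : decaying f -> pder i (convol logk f) (convol (gradk i) f).
Proof.
move=> [cf df]; have mf := mble_continuous cf.
have [M [K [K0 [HK HG]]]] := logk_eps_approx mf df.
apply: (@pder_limit _ _ _ (fun k => convol (logk_eps (eps k)) f)
  (fun k => convol (gradk_eps i (eps k)) f) _ _ eps (fun x => K * (1 + sqn x) ^+ M)) => //.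
- move=> k; have tL := tempered_logk_eps (eps_gt0 k).
  have tG := Ck0 (Ck_gradk_eps 0 i (eps_gt0 k)).
  have [-> dL] := conv_temperedC tL mf df; have [cL _] := tL.
  have [-> dG] := conv_temperedC tG mf df; have [cG _] := tG.
  apply: pder_convr => //; first exact: mble_continuous.
  exact: pder_logk_eps (eps_gt0 k).
- exact: cvg_eps.
- move=> x; exists (K * (3 * (1 + sqn x)) ^+ M + 1).
    by rewrite ltr_wpDl// mulr_ge0// exprn_ge0// mulr_ge0// ltW// sq1_gt0.
  move=> t t1; rewrite ler_wpDr// ler_wpM2l//.
  rewrite lerXn2r ?nnegrE ?mulr_ge0 ?(ltW (sq1_gt0 _))//; exact: sqn_shift_le.
- by move=> k; exact/ltW/eps_gt0.
- apply: continuous_conv => //; first exact: mble_gradk.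
  by apply: dom_adm => //; exact: adm_gradk.
Qed.

(** The gain of one derivative: the first one falls on the kernel, the remaining k on [f]. *)
Lemma Ck_conv_logk k f : Ck decaying k f -> Ck tempered k.+1 (convol logk f).
Proof.
move=> fk; have fd := Ck0 fk; split.
  by apply: conv_tempered => //; exact: adm_logk.
move=> i; exists (convol (gradk i) f); split; first exact: pder_conv_logk.
by apply: Ck_conv => //; exact: adm_gradk.
Qed.

End logarithmic_kernel.

(** * Powers of the Laplacian of the regularized logarithm *)

Section bubble.
Context {R : realType} {m : nat} (m2 : (2 <= m)%N).
Local Notation n := (2 * m)%N.
Implicit Types (f g : 'rV[R]_n -> R) (x y z : 'rV[R]_n) (e : R).

Let n4 : (4 <= n)%N. Proof. by rewrite -[4%N]/(2 * 2)%N leq_mul2l. Qed.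

Lemma pder_reskX e i k : 0 < e -> pder i (fun z => resk e z ^+ k)
  (fun z => - (2 * k)%:R * (z 0 i * resk e z ^+ k.+1)).
Proof.
move=> e0; case: k => [|k].
  have H := pder_cst (R := R) (n := n) i 1.
  by move=> z; apply: (is_derive_eq (H z)); rewrite muln0 oppr0 mul0r.
have H := pderX k (pder_resk (n := n) i e0).
by move=> z; apply: (is_derive_eq (H z)); rewrite natrM !exprS; ring.
Qed.

Lemma pder2_reskX e i k : 0 < e ->
  pder i (fun z : 'rV[R]_n => - (2 * k)%:R * (z 0 i * resk e z ^+ k.+1))
  (fun z => - (2 * k)%:R * (resk e z ^+ k.+1 - (2 * k.+1)%:R * (z 0 i ^+ 2 * resk e z ^+ k.+2))).
Proof.
move=> e0; have H := pderZ (- (2 * k)%:R) (pderM (pder_coord i i) (pder_reskX i k.+1 e0)).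
by move=> z; apply: (is_derive_eq (H z)); rewrite eqxx/=; ring.
Qed.

(* Coefficients of (-Delta)^j (- ln (e^2 + |z|^2)) along e^(2 i) (e^2 + |z|^2)^-(j+i),
   in dimension 2 m. *)
Definition bubble_coef (j i : nat) : R :=
  4 ^+ j * ((j + i).-1)`!%:R * 'C(j, i)%:R * \prod_(i.+1 <= l < j.+1) (m%:R - l%:R).

(** This is -Delta of (e^2 + |z|^2)^-k in dimension 2 m, after |z|^2 has been replaced by 1 /
    [resk e z] - e^2 so that only powers of [resk] remain. *)
Definition neglap_resk e k z : R :=
  4 * k%:R * (m%:R - k%:R - 1) * resk e z ^+ k.+1 +
  4 * e ^+ 2 * k%:R * k.+1%:R * resk e z ^+ k.+2.

Lemma laplacian_sum_resk e (N : nat) (a : 'I_N -> R) (k : 'I_N -> nat) : 0 < e ->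
  laplacian (fun z : 'rV[R]_n => \sum_i a i * resk e z ^+ k i) =
  fun z => - \sum_i a i * neglap_resk e (k i) z.
Proof.
move=> e0.
rewrite (laplacianE (g := fun l z => \sum_i a i * (- (2 * k i)%:R * (z 0 l * resk e z ^+ (k i).+1)))
 (h := fun l z => \sum_i a i * (- (2 * k i)%:R * (resk e z ^+ (k i).+1 - (2 * (k i).+1)%:R * (z 0 l ^+ 2 * resk e z ^+ (k i).+2))))); last 2 first.
- by move=> l; apply: pder_sum => i; apply: pderZ; exact: pder_reskX.
- by move=> l; apply: pder_sum => i; apply: pderZ; exact: pder2_reskX.
apply/funext => z; rewrite exchange_big/= -sumrN; apply: eq_bigr => i _.
rewrite -mulr_sumr -mulrN; congr (_ * _); rewrite -mulr_sumr sumrB -mulr_sumr -mulr_suml -/(sqn z).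
rewrite sumr_const card_ord /neglap_resk.
have p0 := eps_sqn_gt0 z e0.
have -> : sqn z = (resk e z)^-1 - e ^+ 2 by rewrite /resk invrK addrAC subrr add0r.
have r0 : resk e z != 0 by rewrite gt_eqF// resk_gt0.
rewrite !exprS -mulr_natl !natrM -natr1.
by field.
Qed.

Lemma laplacian_logk_eps e : 0 < e ->
  (fun z : 'rV[R]_n => - laplacian (logk_eps e) z) =
  (fun z => - 2^-1 * \sum_(i < 2) bubble_coef 1 i * e ^+ (2 * i) * resk e z ^+ (1 + i)).
Proof.
move=> e0.
rewrite (laplacianE (g := fun i => gradk_eps i e)
  (h := fun i z => resk e z - 2 * (z 0 i ^+ 2 * resk e z ^+ 2))); last 2 first.
- by move=> i; exact: pder_logk_eps.
- move=> i; have H := pderM (pder_coord i i) (pder_resk (n := n) i e0).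
  by move=> z; apply: (is_derive_eq (H z)); rewrite eqxx/= /gradk_eps; ring.
apply/funext => z; rewrite sumrB -mulr_sumr -mulr_suml -/(sqn z) sumr_const card_ord.
rewrite !big_ord_recl big_ord0 /bubble_coef /= !big_nat1 !big_geq//=.
have p0 := eps_sqn_gt0 z e0.
have -> : sqn z = (resk e z)^-1 - e ^+ 2 by rewrite /resk invrK addrAC subrr add0r.
have r0 : resk e z != 0 by rewrite gt_eqF// resk_gt0.
rewrite -mulr_natl natrM.
by rewrite /bump/= ?factS ?fact0 ?bin0 ?binn; field.
Qed.

(** The two terms are the contributions that [neglap_resk] sends to the same power of e: the first
    summand of index i + 1 and the second summand of index i. *)
Lemma bubble_coef_rec j i : (i <= j)%N -> (0 < j)%N ->
  bubble_coef j.+1 i.+1 =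
  bubble_coef j i.+1 * (4 * (j + i.+1)%:R * (m%:R - (j + i.+1)%:R - 1)) +
  bubble_coef j i * (4 * (j + i)%:R * (j + i).+1%:R).
Proof.
move=> ij j0; rewrite /bubble_coef.
have -> : (j.+1 + i.+1).-1 = (j + i).+1 by rewrite addSn addnS.
have -> : (j + i.+1).-1 = (j + i)%N by rewrite addnS.
have Ef : ((j + i)`!%:R : R) = (j + i)%:R * ((j + i).-1)`!%:R.
  by rewrite -natrM -[in LHS](prednK (n := j + i)) ?addn_gt0 ?j0// factS prednK// addn_gt0 j0.
rewrite factS natrM Ef.
move: ij; rewrite leq_eqVlt => /predU1P[->|ij].
  rewrite (@big_geq _ _ _ j.+2 j.+2)// (@big_geq _ _ _ j.+1 j.+1)// (@bin_small j j.+1)//.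
  by rewrite !binn addnn exprS -natr1; ring.
have -> : \prod_(i.+1 <= l < j.+1) (m%:R - l%:R) =
   (m%:R - i.+1%:R) * \prod_(i.+2 <= l < j.+1) (m%:R - l%:R) :> R.
  by rewrite big_ltn.
have -> : \prod_(i.+2 <= l < j.+2) (m%:R - l%:R) =
   \prod_(i.+2 <= l < j.+1) (m%:R - l%:R) * (m%:R - j.+1%:R) :> R.
  by rewrite big_nat_recr.
set Q := \prod_(_ <= _ < _) _.
have B : (i.+1%:R * 'C(j, i.+1)%:R : R) = (j%:R - i%:R) * 'C(j, i)%:R.
  by rewrite -natrM mul_bin_left natrM natrB// ltnW.
rewrite binS [('C(j, i.+1) + _)%:R]natrD.
set F := (j + i).-1`!%:R; set b := 'C(j, i.+1)%:R in B *; set c := 'C(j, i)%:R in B *.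
have B' : b = b + (j%:R - i%:R) * c - i.+1%:R * b by rewrite B; ring.
apply/eqP; rewrite -subr_eq0; apply/eqP.
(* By Pascal's rule the two sides differ by a multiple of (i+1) C(j, i+1) - (j-i) C(j, i), which is
   0. *)
transitivity (4 ^+ j.+1 * (j + i).+1%:R * (j + i)%:R * F * Q * (i.+1%:R * b - (j%:R - i%:R) * c)).
  rewrite exprS -!natr1 natrD; ring.
by rewrite B subrr mulr0.
Qed.

Lemma bubble_coef_rec0 j : (0 < j)%N ->
  bubble_coef j.+1 0 = bubble_coef j 0 * (4 * j%:R * (m%:R - j%:R - 1)).
Proof.
move=> j0; rewrite /bubble_coef !addn0 /= !bin0.
rewrite -[in LHS](prednK j0) factS (prednK j0) natrM big_nat_recr//= exprS -natr1; ring.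
Qed.

Lemma bubble_coef_last j : bubble_coef j j.+1 = 0.
Proof. by rewrite /bubble_coef bin_small// mulr0 mul0r. Qed.

(** The induction starts at the first power, where the logarithm has become a combination of powers
    of [resk]. The factor -1/2 is there because the coefficients belong to -ln and [logk_eps] is
    half a logarithm. *)
Lemma polylaplacian_logk_eps_sum e j : 0 < e ->
  polylaplacian j.+1 (logk_eps e) = fun z : 'rV[R]_n =>
   - 2^-1 * \sum_(i < j.+2) bubble_coef j.+1 i * e ^+ (2 * i) * resk e z ^+ (j.+1 + i).
Proof.
move=> e0; elim: j => [|j ih]; first exact: laplacian_logk_eps.
rewrite /polylaplacian iterS -/(polylaplacian j.+1 (logk_eps e)) ih.
under [X in laplacian X]eq_fun do rewrite mulr_sumr.
have -> : (fun z : 'rV[R]_n => \sum_(i < j.+2) - 2^-1 * (bubble_coef j.+1 i * e ^+ (2 * i) * resk e z ^+ (j.+1 + i))) =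
   (fun z => \sum_(i < j.+2) (- 2^-1 * bubble_coef j.+1 i * e ^+ (2 * i)) * resk e z ^+ (j.+1 + i)).
  by apply/funext => z; apply: eq_bigr => i _; rewrite !mulrA.
rewrite (@laplacian_sum_resk e j.+2 (fun i => - 2^-1 * bubble_coef j.+1 i * e ^+ (2 * i)) (fun i => j.+1 + i)%N e0).
apply/funext => z; rewrite opprK.
transitivity (- 2^-1 * \sum_(i < j.+2) bubble_coef j.+1 i * e ^+ (2 * i) * neglap_resk e (j.+1 + i) z).
  by rewrite mulr_sumr; apply: eq_bigr => i _; rewrite !mulrA.
congr (_ * _).
pose A i := bubble_coef j.+1 i * (4 * (j.+1 + i)%:R * (m%:R - (j.+1 + i)%:R - 1)) * e ^+ (2 * i) * resk e z ^+ (j.+2 + i).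
pose B i := bubble_coef j.+1 i * (4 * (j.+1 + i)%:R * (j.+1 + i).+1%:R) * e ^+ (2 * i.+1) * resk e z ^+ (j.+2 + i.+1).
transitivity (\sum_(i < j.+2) A i + \sum_(i < j.+2) B i).
  rewrite -big_split/=; apply: eq_bigr => i _.
  rewrite /neglap_resk /A /B !addSn addnS mulnS exprD; ring.
have A0 : A j.+2 = 0 by rewrite /A bubble_coef_last !mul0r.
rewrite big_ord_recl [RHS]big_ord_recl /=.
have -> : \sum_(i < j.+1) A (bump 0 i) = \sum_(i < j.+2) A i.+1.
  by rewrite [RHS]big_ord_recr/= A0 addr0; apply: eq_bigr => i _.
rewrite -addrA -big_split/=; congr (_ + _).
  by rewrite /A (bubble_coef_rec0 (ltn0Sn j)) !addn0 muln0; ring.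
apply: eq_bigr => i _; rewrite /bump/= add1n bubble_coef_rec//; last by rewrite -ltnS.
by rewrite /A /B; ring.
Qed.

Definition bubble e z : R := (2 * e * resk e z) ^+ n.

(** At order m each coefficient with i < m contains the vanishing factor m - m. Only i = m survives,
    and 4^m e^(2m) [resk]^(2m) is the bubble. *)
Lemma polylaplacian_logk_eps e : 0 < e ->
  polylaplacian m (logk_eps e) = fun z => - (2^-1 * (n - 1)`!%:R) * bubble e z.
Proof.
move=> e0; have m0 : (0 < m)%N by apply: leq_trans m2.
have := polylaplacian_logk_eps_sum m.-1 e0; rewrite (prednK m0) => ->.
apply/funext => z; rewrite big_ord_recr/= big1 ?add0r; last first.
  move=> i _; rewrite /bubble_coef (_ : \prod_(_ <= _ < _) _ = 0); first by rewrite mulr0 !mul0r.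
  by rewrite big_nat_recr//= subrr mulr0.
rewrite /bubble_coef binn big_geq// !mulr1 addnn -mul2n -subn1 /bubble !exprMn.
by rewrite [2 ^+ (2 * m)]exprM (_ : 2 ^+ 2 = 4) //; [ring|rewrite expr2 -natrM].
Qed.

Lemma scaled_bubble e z : 0 < e -> e ^+ n * bubble e (e *: z) = bubble 1 z.
Proof.
move=> e0; rewrite /bubble /resk sqnZ -exprMn expr1n mulr1; congr (_ ^+ _).
have p : 0 < 1 + sqn z by rewrite sq1_gt0.
have -> : e ^+ 2 + e ^+ 2 * sqn z = e ^+ 2 * (1 + sqn z) by ring.
by field; rewrite !gt_eqF.
Qed.

Lemma bubble1E z : bubble 1 z = 2 ^+ n * wgt z.
Proof. by rewrite /bubble /resk /wgt mulr1 expr1n exprMn exprVn. Qed.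

Lemma bubble_ge0 e z : 0 < e -> 0 <= bubble e z.
Proof. by move=> e0; rewrite exprn_ge0// !mulr_ge0// ltW// resk_gt0. Qed.

Lemma tempered_bubble e : 0 < e -> tempered (bubble e).
Proof.
move=> e0; rewrite /bubble.
have t1 : tempered (fun z : 'rV[R]_n => 2 * e * resk e z).
  by apply: temperedM; [exact: tempered_cst|exact: tempered_resk].
have H k : tempered (fun z : 'rV[R]_n => (2 * e * resk e z) ^+ k); last exact: H.
elim: k => [|k ih]; first by under eq_fun do rewrite expr0; exact: tempered_cst.
by under eq_fun do rewrite exprS; exact: temperedM.
Qed.

Let eps (k : nat) : R := k.+1%:R^-1.

(** The bubbles are an approximate identity: the substitution z -> e z turns them into the fixed
    [bubble 1], and dominated convergence applies. *)
Lemma cvg_conv_bubble f x : decaying f ->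
  convol (bubble (eps k)) f x @[k --> \oo] --> itg (bubble 1) * f x.
Proof.
move=> [cf df]; have mf := mble_continuous cf.
have e0 k : 0 < eps k by exact: eps_gt0.
have E k : convol (bubble (eps k)) f x = itg (fun z => bubble 1 z * f (x - eps k *: z)).
  have tb := tempered_bubble (e0 k); have [cb bb] := tb.
  have ib := conv_itgble x (mble_continuous cb) mf (dom_adm n4 (tempered_adm tb) df).
  rewrite /convol (itg_affine 0 (lt0r_neq0 (e0 k)) ib) gtr0_norm// -itgZ.
    by congr itg; apply/funext => z; rewrite add0r mulrA scaled_bubble.
  exact: (itgble_affine 0 (lt0r_neq0 (e0 k)) ib).
rewrite (_ : (fun k => _) = fun k => itg (fun z => bubble 1 z * f (x - eps k *: z))); last exact/funext.
have ib1 : itgble (bubble 1).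
  by rewrite (_ : bubble 1 = fun z => 2 ^+ n * wgt z); [apply: itgbleZ; exact: itgble_wgt|
    apply/funext => z; exact: bubble1E].
have [C fC] := df 0%N.
rewrite mulrC -itgZ//.
have cz z : eps k *: z @[k --> \oo] --> (0 : 'rV[R]_n).
  rewrite -(scale0r z); apply: cvgZr_tmp; exact: cvg_harmonic.
apply: (cvg_itg (g := fun z => C * bubble 1 z)).
- move=> k; apply: mbleM; first exact: itgble_mble.
  rewrite (_ : (fun z => _) = fun z => f (x + (- eps k) *: z)); last first.
    by apply/funext => z; rewrite scaleNr.
  exact: mble_affine.
- exact: itgbleZ.
- move=> z; rewrite mulrC; apply: cvgM; first exact: cvg_cst.
  have : x - eps k *: z @[k --> \oo] --> x - 0 by apply: cvgB; [exact: cvg_cst|exact: cz].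
  rewrite subr0 => cx.
  by apply: (cvg_comp _ f cx); exact: cf.
- move=> k z; rewrite normrM ger0_norm; last by rewrite bubble_ge0.
  rewrite mulrC ler_wpM2r ?bubble_ge0//.
  by have := fC (x - eps k *: z); rewrite expr0 mulr1.
Qed.

(** L cannot be differentiated 2 m times, so all derivatives are put on [f]; then L is the limit of
    L_e, and for L_e they are moved back onto the kernel, where they produce a bubble. *)
Lemma polylaplacian_conv_logk f : (forall k, Ck decaying k f) ->
  polylaplacian m (convol logk f) =
  fun x => - (2^-1 * (n - 1)`!%:R * itg (bubble 1)) * f x.
Proof.
move=> fk.
have e0 k : 0 < eps k by exact: eps_gt0.
have decN (h : 'rV[R]_n -> R) : decaying h -> decaying (fun x => - h x).
  move=> [ch dh]; split; first by move=> x; apply: continuousN; exact: ch.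
  by move=> N; have [C HC] := dh N; exists C => x; rewrite normrN.
have decC (h : 'rV[R]_n -> R) : decaying h -> continuous h by case.
have temC (h : 'rV[R]_n -> R) : tempered h -> continuous h by case.
have [cf df] := Ck0 (fk 0%N); have mf := mble_continuous cf.
have Kdom (g : 'rV[R]_n -> R) : adm g -> polylaplacian m (convol g f) = convol g (polylaplacian m f).
  move=> ag; have [mg _] := ag.
  apply: (polylaplacian_conv n4 mg decC _ (@decayingD _ _) decN m fk).
  by move=> h [_ dh]; exact: dom_adm.
set h := polylaplacian m f.
have hd : decaying h.
  have H j : forall k, Ck decaying k (polylaplacian j f).
    rewrite /polylaplacian; elim: j => [//|j ih] k; rewrite iterS.
    apply: (CkN decN); apply: (Ck_laplacian n4 (@decayingD _ _)); exact: ih.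
  exact: Ck0 (H m 0%N).
rewrite Kdom; last exact: adm_logk.
have [ch dh] := hd; have mh := mble_continuous ch.
apply/funext => x.
have [M [K [K0 [HK _]]]] := logk_eps_approx n4 mh dh.
have cv1 : convol (logk_eps (eps k)) h x @[k --> \oo] --> convol logk h x.
  apply/cvgrPdist_le => e ep.
  have : eps k * (K * (1 + sqn x) ^+ M) @[k --> \oo] --> 0 * (K * (1 + sqn x) ^+ M).
    by apply: cvgM; [exact: cvg_harmonic|exact: cvg_cst].
  rewrite mul0r => /cvgr0Pnorm_le/(_ _ ep); apply: filterS => k.
  apply: le_trans; rewrite distrC; apply: (le_trans (HK k x)); exact: ler_norm.
have E k : convol (logk_eps (eps k)) h x =
    - (2^-1 * (n - 1)`!%:R) * convol (bubble (eps k)) f x.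
  have tL := tempered_logk_eps (n := n) (e0 k).
  have tb := tempered_bubble (e0 k).
  rewrite -(Kdom _ (tempered_adm tL)).
  have [-> _] := conv_temperedC n4 tL mf df.
  have [-> db] := conv_temperedC n4 tb mf df.
  rewrite (polylaplacian_conv n4 mf temC _ (@temperedD _ _) (@temperedN _ _) m (fun j => Ck_logk_eps j (e0 k))).
    rewrite polylaplacian_logk_eps// /convol -itgZ; last first.
      by apply: conv_itgble => //; exact: mble_continuous (temC _ tb).
    by congr itg; apply/funext => z; rewrite mulrCA.
  by move=> g [_ bg]; exact: dom_tempered.
have cv2 : convol (logk_eps (eps k)) h x @[k --> \oo] -->
    - (2^-1 * (n - 1)`!%:R) * (itg (bubble 1) * f x).
  rewrite (_ : (fun k => _) = fun k => - (2^-1 * (n - 1)`!%:R) * convol (bubble (eps k)) f x); last exact/funext.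
  apply: cvgM; first exact: cvg_cst.
  by apply: cvg_conv_bubble; exact: Ck0 (fk 0%N).
rewrite -(cvg_lim _ cv1)// (cvg_lim _ cv2)//; ring.
Qed.

End bubble.

(** * The volume of the sphere *)

Section sphere.
Context {R : realType} {n : nat}.
Implicit Types (x y z : 'rV[R]_n).

Lemma differentiable_coords k (F : 'rV[R]_n -> 'rV[R]_k) (x : 'rV[R]_n) :
  (forall j, differentiable (fun y => F y 0 j) x) -> differentiable F x.
Proof.
move=> dF.
have -> : F = \sum_(j < k) (fun y => F y 0 j *: (delta_mx 0 j : 'rV[R]_k)).
  apply/funext => y; rewrite fct_sumE; apply/rowP => j.
  rewrite summxE (bigD1 j)//= !mxE !eqxx mulr1 big1 ?addr0// => i ij.
  by rewrite !mxE eq_sym (negbTE ij) andbF mulr0.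
apply: differentiable_sum => j; exact: differentiableZl.
Qed.

Lemma differentiable_sqn x : differentiable (@sqn R n) x.
Proof.
rewrite (_ : @sqn R n = \sum_(i < n) (fun y : 'rV[R]_n => y 0 i ^+ 2)); last first.
  by apply/funext => y; rewrite fct_sumE.
apply: differentiable_sum => i.
exact: (differentiableM (differentiable_coord x 0 i) (differentiable_coord x 0 i)).
Qed.

Lemma stereoE x : stereo x = row_mx ((2 * resk 1 x) *: x) (const_mx (1 - 2 * resk 1 x)).
Proof.
rewrite /stereo enorm_sqr -/(sqn x) scale_row_mx scalerA [2 * _]mulrC /resk expr1n.
congr row_mx; apply/rowP => i; rewrite !mxE.
have : 1 + sqn x != 0 by rewrite gt_eqF// sq1_gt0.
by move=> h; field.
Qed.

Lemma differentiable_stereo x : differentiable (@stereo R n) x.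
Proof.
have dq : differentiable (fun y : 'rV[R]_n => 1 + sqn y) x.
  exact: (differentiableD (differentiable_cst _ _) (differentiable_sqn x)).
have p : 1 + sqn x != 0 by rewrite gt_eqF// sq1_gt0.
have dr : differentiable (fun y : 'rV[R]_n => 2 * resk 1 y) x.
  rewrite /resk expr1n.
  exact: (differentiableZ 2 (differentiableV dq p)).
apply: differentiable_coords => j; rewrite (_ : (fun y => _) =
  (fun y : 'rV[R]_n => (row_mx ((2 * resk 1 y) *: y) (const_mx (1 - 2 * resk 1 y))) 0 j)); last first.
  by apply/funext => y; rewrite stereoE.
rewrite -(splitK j); case: (fintype.split j) => i /=.
  rewrite (_ : (fun y => _) = (fun y : 'rV[R]_n => 2 * resk 1 y * y 0 i)); last first.
    by apply/funext => y; rewrite row_mxEl mxE.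
  exact: (differentiableM dr (differentiable_coord _ _ _)).
rewrite (_ : (fun y => _) = (fun y : 'rV[R]_n => 1 - 2 * resk 1 y)); last first.
  by apply/funext => y; rewrite row_mxEr mxE.
exact: (differentiableB (differentiable_cst _ _) dr).
Qed.

(** Entries of ['J] are values of the differential, whereas explicit computation goes through
    coordinate partial derivatives; differentiability identifies the two. *)
Lemma jacobian_coord k (F : 'rV[R]_n -> 'rV[R]_k) x i j (g : 'rV[R]_n -> R) :
  differentiable F x -> pder i (fun y => F y 0 j) g -> ('J F x) i j = g x.
Proof.
move=> dF Fg.
have <- : partial i (fun y => F y 0 j) = g by exact: pder_partial.
rewrite /partial.
have dc : differentiable (fun y : 'rV[R]_k => y 0 j) (F x) by exact: differentiable_coord.
have -> : (fun y => F y 0 j) = (fun y : 'rV[R]_k => y 0 j) \o F by [].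
rewrite deriveE; last exact: differentiable_comp.
rewrite diff_comp// /=.
have -> : 'd F x (delta_mx 0 i) = row i ('J F x).
  by rewrite -deriveE// deriveEjacobian// -rowE.
have -> : 'd (fun y : 'rV[R]_k => y 0 j) (F x) = (fun y : 'rV[R]_k => y 0 j) :> (_ -> _).
  have [l El] : exists l : {linear 'rV[R]_k -> R}, (fun y : 'rV[R]_k => y 0 j) = l.
    have lin : linear (fun y : 'rV[R]_k => y 0 j : R^o) by move=> a u v; rewrite !mxE.
    by exists (HB.pack_for {linear 'rV[R]_k -> R^o} (fun y : 'rV[R]_k => y 0 j : R^o)
      (GRing.isLinear.Build _ _ _ _ _ lin)).
  rewrite El diff_lin// -El; exact: coord_continuous.
by rewrite [RHS]mxE.
Qed.

(** Conformality: with r = [resk 1 x] the map is (2 r x, 1 - 2 r), and the terms off the identity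
    cancel once |x|^2 is written as 1/r - 1. *)
Lemma stereo_jacobian x :
  'J (@stereo R n) x *m ('J (@stereo R n) x)^T = ((2 * resk 1 x) ^+ 2)%:M.
Proof.
have e1 : (0 : R) < 1 by [].
apply/matrixP => i l; rewrite !mxE big_split_ord/= big_ord1.
have J1 i' j : ('J (@stereo R n) x) i' (lshift 1 j) =
    2 * resk 1 x * (i' == j)%:R - 4 * (x 0 i' * x 0 j * resk 1 x ^+ 2).
  apply: (jacobian_coord (g := fun y => 2 * resk 1 y * (i' == j)%:R - 4 * (y 0 i' * y 0 j * resk 1 y ^+ 2))).
    exact: differentiable_stereo.
  rewrite (_ : (fun y => _) = (fun y : 'rV[R]_n => 2 * resk 1 y * y 0 j)); last first.
    by apply/funext => y; rewrite stereoE row_mxEl mxE.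
  have H := pderM (pderZ 2 (pder_resk (n := n) i' e1)) (pder_coord i' j).
  by move=> y; apply: (is_derive_eq (H y)); ring.
have J2 i' : ('J (@stereo R n) x) i' (rshift n ord0) = 4 * (x 0 i' * resk 1 x ^+ 2).
  apply: (jacobian_coord (g := fun y => 4 * (y 0 i' * resk 1 y ^+ 2))).
    exact: differentiable_stereo.
  rewrite (_ : (fun y => _) = (fun y : 'rV[R]_n => 1 - 2 * resk 1 y)); last first.
    by apply/funext => y; rewrite stereoE row_mxEr mxE.
  have H := pderB (pder_cst i' 1) (pderZ 2 (pder_resk (n := n) i' e1)).
  by move=> y; apply: (is_derive_eq (H y)); ring.
under eq_bigr => j _ do rewrite [_^T _ _]mxE !J1.
rewrite [_^T _ _]mxE !J2.
set r := resk 1 x.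
have S1 : \sum_(j < n) (i == j)%:R * (l == j)%:R = (i == l)%:R :> R.
  rewrite (bigD1 l)//= eqxx mulr1 big1 ?addr0// => j jl.
  by rewrite eq_sym in jl; rewrite (negbTE jl) mulr0.
have S2 k (y : 'rV[R]_n) : \sum_(j < n) (k == j)%:R * y 0 j = y 0 k.
  rewrite (bigD1 k)//= eqxx mul1r big1 ?addr0// => j jl.
  by rewrite eq_sym in jl; rewrite (negbTE jl) mul0r.
transitivity (\sum_(j < n) (4 * r ^+ 2 * ((i == j)%:R * (l == j)%:R)
   - 8 * r ^+ 3 * x 0 l * ((i == j)%:R * x 0 j) - 8 * r ^+ 3 * x 0 i * ((l == j)%:R * x 0 j)
   + 16 * r ^+ 4 * x 0 i * x 0 l * x 0 j ^+ 2) + 16 * r ^+ 4 * x 0 i * x 0 l).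
  congr (_ + _); last by ring.
  by apply: eq_bigr => j _; ring.
rewrite big_split/= !sumrB -!mulr_sumr S1 !S2 -/(sqn x).
have p : 1 + sqn x != 0 by rewrite gt_eqF// sq1_gt0.
have -> : sqn x = r^-1 - 1 by rewrite /r /resk expr1n invrK addrAC subrr add0r.
have r0 : r != 0 by rewrite /r /resk expr1n invr_eq0.
by rewrite -mulr_natr; field.
Qed.

(** A zero integral would make [f] vanish almost everywhere, hence the whole space would be null,
    although the unit cube has measure 1. *)
Lemma itg_gt0 (f : 'rV[R]_n -> R) : itgble f -> (forall x, 0 < f x) -> 0 < itg f.
Proof.
move=> fi f0; rewrite lt_neqAle itg_ge0 ?andbT; last by move=> x; rewrite ltW.
apply/eqP => I0.
have := itgE fi; rewrite -I0 /integral_Rn => J0.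
have : ae_eq (lebesgue_tuple R n) setT (fun t => (f (row_of_tuple t))%:E) (cst 0%E).
  apply/(ae_eq_integral_abs _ measurableT).
    by apply/measurable_EFinP; exact: itgble_mble.
  rewrite -[RHS]J0; apply: eq_integral => t _.
  by rewrite gee0_abs// lee_fin ltW.
move=> [N [mN N0 sN]].
have NT : N = setT.
  apply/seteqP; split=> // t _; apply: sN => /= /(_ I)[] /eqP.
  by rewrite gt_eqF.
have : lebesgue_tuple R n [set t | forall i : 'I_n, (`[0, 1]%classic : set R) (tnth t i)] = 1%E.
  rewrite [LHS](@lebesgue_tuple_box R n (fun _ => `[0, 1]%classic)); last first.
    by move=> i; exact: measurable_itv.
  rewrite big1// => i _.
  have leb (j : interval R) := lebesgue_measure_itv j.
  by rewrite [LHS]leb/= lte01 sube0.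
move=> B1.
have : (lebesgue_tuple R n [set t | forall i : 'I_n, (`[0%R, 1%R]%classic : set R) (tnth t i)] <= 0)%E.
  rewrite -N0; apply: le_measure; rewrite ?inE ?NT//.
  rewrite (_ : mkset _ = \bigcap_(i in [set: 'I_n]) ((@tnth _ (measurableTypeR R) ^~ i) @^-1` `[0, 1]%classic)).
    apply: fin_bigcap_measurable => // i _; rewrite -[X in measurable X]setTI.
    by apply: measurable_tnth => //; exact: measurable_itv.
  by apply/seteqP; split=> [t tp i _ /=|t /= tp i]; [exact: tp|exact: tp].
by rewrite B1 lee_fin ler10.
Qed.

Lemma sphere_volumeE : (4 <= n)%N ->
  sphere_volume n = itg (fun x : 'rV[R]_n => (2 * resk 1 x) ^+ n) /\ 0 < sphere_volume (R := R) n.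
Proof.
move=> n4.
have E (x : 'rV[R]_n) : Num.sqrt (\det ('J (@stereo R n) x *m ('J (@stereo R n) x)^T)) = (2 * resk 1 x) ^+ n.
  rewrite stereo_jacobian det_scalar exprAC sqrtr_sqr ger0_norm// exprn_ge0// mulr_ge0// ltW//.
  exact: resk_gt0.
have E2 : sphere_volume n = itg (fun x : 'rV[R]_n => (2 * resk 1 x) ^+ n).
  rewrite /sphere_volume /param_volume /integral_Rn /itg /Rintegral; congr fine.
  by apply: eq_integral => t _; rewrite E.
have Ew : (fun x : 'rV[R]_n => (2 * resk 1 x) ^+ n) = fun x => 2 ^+ n * wgt x.
  by apply/funext => x; rewrite /resk /wgt expr1n exprMn exprVn.
split=> //; rewrite E2 Ew itgZ ?mulr_gt0 ?exprn_gt0//; last exact: itgble_wgt.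
by apply: itg_gt0; [exact: itgble_wgt|exact: wgt_gt0].
Qed.

End sphere.

(** * Polynomials *)

Section polynomials.
Context {R : realType} {n : nat}.
Implicit Types (P Q : mpoly.mpoly n R) (x : 'rV[R]_n) (i : 'I_n).

Lemma mpoly_ring_ind (K : mpoly.mpoly n R -> Prop) :
  (forall c, K (mpolyC n c)) ->
  (forall i, K (mpolyX R (mnm1 i))) ->
  (forall P Q, K P -> K Q -> K (P + Q)) ->
  (forall P Q, K P -> K Q -> K (P * Q)) -> forall P, K P.
Proof.
move=> KC KX KD KM; have K1 : K 1 by have := KC 1; rewrite mpolyC1.
have KXm (mo : multinom n) : K (mpolyX R mo).
  rewrite mpolyXE_id; elim/big_rec: _ => // i Q _ KQ; apply: (KM) => //.
  by elim: (mo i) => [|k ih]; rewrite ?expr0// exprS; exact: KM.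
elim/mpolyind => [|c mo P _ _ KP]; first by have := KC 0; rewrite mpolyC0.
by apply: KD => //; rewrite -mul_mpolyC; exact: KM.
Qed.

Lemma is_derive_mpoly_line P (v x : 'rV[R]_n) (t : R) :
  is_derive t 1 (fun s : R => mpoly_fun P (s *: v + x))
    (\sum_i v 0 i * mpoly_fun (mderiv i P) (t *: v + x)).
Proof.
elim/mpoly_ring_ind: P => [c|j|P Q dP dQ|P Q dP dQ]; rewrite /mpoly_fun.
- under eq_fun do rewrite mevalC.
  by rewrite big1 => [|i _]; [exact: is_derive_cst|rewrite mderivC meval0 mulr0].
- under eq_fun do rewrite mevalXU !mxE.
  apply: (is_derive_eq (is_deriveD (is_deriveM (is_derive_id t 1)
    (is_derive_cst (v 0 j) t 1)) (is_derive_cst (x 0 j) t 1))).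
  rewrite scaler0 add0r addr0 /GRing.scale/= mulr1 (bigD1 j)//= big1 ?addr0.
    rewrite mderivX mevalZ mnm1E eqxx.
    have -> : mnm_sub (mnm1 j) (mnm1 j) = (@mnm0 n).
      by apply/mnmP => k; rewrite mnmBE subnn mnm0E.
    by rewrite mpolyX0 meval1 !mulr1.
  by move=> i ij; rewrite mderivX mevalZ mnm1E eq_sym (negbTE ij) mul0r mulr0.
- under eq_fun do rewrite mevalD.
  apply: (is_derive_eq (is_deriveD dP dQ)); rewrite -big_split; apply: eq_bigr => i _.
  by rewrite mderivD mevalD /mpoly_fun/= mulrDr.
- under eq_fun do rewrite mevalM.
  apply: (is_derive_eq (is_deriveM dP dQ)).
  rewrite /GRing.scale/= !mulr_sumr -big_split; apply: eq_bigr => i _.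
  by rewrite mderivM mevalD !mevalM /mpoly_fun/=; ring.
Qed.

Lemma pder_mpoly i P : pder i (mpoly_fun P) (mpoly_fun (mderiv i P)).
Proof.
move=> x; apply: is_derive_of_line; apply: (is_derive_eq (is_derive_mpoly_line _ _ _ _)).
rewrite scale0r add0r (bigD1 i)//= mxE !eqxx mul1r big1 ?addr0// => j ji.
by rewrite mxE (negbTE ji) andbF mul0r.
Qed.

Lemma Ck_mpoly k P : Ck tempered k (mpoly_fun P).
Proof.
elim/mpoly_ring_ind: P => [c|j|P Q dP dQ|P Q dP dQ]; rewrite /mpoly_fun.
- by under eq_fun do rewrite mevalC; apply: Ck_cst; exact: tempered_cst.
- by under eq_fun do rewrite mevalXU; exact: Ck_coord.
- by under eq_fun do rewrite mevalD; apply: CkD => //; exact: temperedD.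
- under eq_fun do rewrite mevalM.
  by apply: (CkM (A := tempered) (B := tempered)) => //; [exact: temperedM|exact: temperedD].
Qed.

Lemma msize_leP k P :
  reflect (forall mo : multinom n, (k <= mdeg mo)%N -> mcoeff mo P = 0)
    (msize P <= k)%N.
Proof.
apply: (iffP idP) => [Pk mo kmo|H].
  apply/eqP; rewrite mcoeff_eq0; apply: msize_mdeg_ge; exact: leq_trans kmo.
rewrite msizeE; apply/bigmax_leqP_seq => mo moP _.
rewrite ltnNge; apply/negP => /H/eqP; rewrite mcoeff_eq0.
by rewrite moP.
Qed.

(** Each Laplacian lowers the degree by two, and [msize P <= 2 * j] means degree below 2 j. *)
Lemma polylaplacian_mpoly0 j P : (msize P <= 2 * j)%N ->
  polylaplacian j (mpoly_fun P) = fun _ => 0.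
Proof.
elim: j P => [|j ih] P Pj.
  have -> : P = 0.
    by apply/mpolyP => mo; rewrite mcoeff0; move/msize_leP : Pj; exact.
  by apply/funext => x; rewrite /= /mpoly_fun meval0.
rewrite /polylaplacian iterSr.
pose Q : mpoly.mpoly n R := - \sum_i mderiv i (mderiv i P).
have QE : (fun x => - laplacian (mpoly_fun P) x) = mpoly_fun Q.
  apply/funext => x.
  rewrite (laplacianE (fun i => pder_mpoly i P) (fun i => pder_mpoly i _)).
  rewrite /mpoly_fun /Q mevalN.
  by congr (- _); rewrite raddf_sum.
rewrite [X in iter j _ X]QE.
apply: (ih Q).
apply/msize_leP => mo jmo; rewrite /Q mcoeffN.
rewrite [X in - X](raddf_sum (mcoeff mo)).
rewrite /= big1 ?oppr0// => i _.
rewrite !mcoeff_mderiv; move/msize_leP : Pj => ->; first by rewrite !mul0rn.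
by rewrite !mdegD !mdeg1 !addn1 mulnS !ltnS.
Qed.

(** Along a ray, phi(t) = P(t x) - K ln (1 + t^2 |x|^2) is nondecreasing once |t x| exceeds a fixed
    radius; inside the corresponding ball P is bounded. *)
Lemma mpoly_growth P (K : R) : 0 <= K ->
  (fun x => \sum_i x 0 i * partial i (mpoly_fun P) x) @ at_infinity R n --> +oo ->
  exists C, forall x, K * ln (1 + sqn x) - C <= mpoly_fun P x.
Proof.
(* The threshold 2 K is the supremum of t times the derivative of K ln (1 + t^2 |x|^2). *)
move=> K0 /cvgryPge/(_ (2 * K))[r _ rP].
have [_ /tbound_ge0[N [D [D0 PD]]]] : tempered (mpoly_fun P) by apply: (@Ck0 _ _ _ 0); exact: Ck_mpoly.
pose r1 := `|r| + 1; have r10 : 0 < r1 by rewrite ltr_wpDl.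
have {}PD x : sqn x <= r1 ^+ 2 -> K * ln (1 + sqn x) - (K * ln (1 + r1 ^+ 2) + D * (1 + r1 ^+ 2) ^+ N) <= mpoly_fun P x.
  move=> xr; have lnr : ln (1 + sqn x) <= ln (1 + r1 ^+ 2).
    by rewrite ler_ln ?posrE ?sq1_gt0// ?lerD2l// ltr_pwDl// sqr_ge0.
  have Pr : `|mpoly_fun P x| <= D * (1 + r1 ^+ 2) ^+ N.
    apply: (le_trans (PD x)); rewrite ler_wpM2l// lerXn2r ?nnegrE ?lerD2l//; first by rewrite ltW// sq1_gt0.
    by rewrite addr_ge0// sqr_ge0.
  move: Pr; rewrite ler_norml => /andP[+ _]; have := ler_wpM2l K0 lnr; lra.
exists (K * ln (1 + r1 ^+ 2) + D * (1 + r1 ^+ 2) ^+ N) => x.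
have [/PD//|xr] := leP (sqn x) (r1 ^+ 2).
have q0 : 0 < sqn x by apply: le_lt_trans xr; exact: sqr_ge0.
(* The parameter at which the ray through x crosses the sphere of radius [r1]. *)
pose t0 := r1 / enorm x.
have e2 : enorm x ^+ 2 = sqn x by rewrite enorm_sqr.
have e0 : 0 < enorm x by rewrite sqrtr_gt0 -/(sqn x).
have ex : r1 < enorm x.
  rewrite ltNge; apply: contraTN xr => h; rewrite -leNgt -e2.
  by rewrite lerXn2r// nnegrE ltW.
have t00 : 0 < t0 by rewrite divr_gt0.
have t01 : t0 < 1 by rewrite ltr_pdivrMr ?mul1r.
have q1 (t : R) : 0 < 1 + t ^+ 2 * sqn x by rewrite ltr_pwDl// mulr_ge0 ?sqr_ge0// ltW.
pose phi (t : R) := mpoly_fun P (t *: x) - K * ln (1 + t ^+ 2 * sqn x).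
pose dphi (t : R) := (\sum_i x 0 i * mpoly_fun (mderiv i P) (t *: x)) - K * ((1 + t ^+ 2 * sqn x)^-1 * (2 * t * sqn x)).
have dp (t : R) : is_derive t 1 phi (dphi t).
  apply: is_deriveB; first by have := is_derive_mpoly_line P x 0 t;
    under eq_fun do rewrite addr0; under eq_bigr do rewrite addr0.
  have dq : is_derive t 1 (fun t : R => 1 + t ^+ 2 * sqn x) (2 * t * sqn x).
    apply: (is_derive_eq (is_deriveD (is_derive_cst (1 : R) t 1)
      (is_deriveM (is_deriveM (is_derive_id t 1) (is_derive_id t 1)) (is_derive_cst (sqn x) t 1)))).
    by rewrite /GRing.scale/=; ring.
  apply: is_deriveZ.
  apply: (is_derive1_comp (f := @ln R) (g := fun t : R => 1 + t ^+ 2 * sqn x)) => //.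
  exact: is_derive1_ln.
have dp0 (t : R) : t0 < t -> 0 <= dphi t.
  move=> tt; have tp : 0 < t by exact: lt_trans tt.
  have : t * (\sum_i x 0 i * mpoly_fun (mderiv i P) (t *: x)) >= 2 * K.
    have /= := rP (t *: x); rewrite mulr_sumr => H.
    rewrite (eq_bigr (fun i => (t *: x) 0 i * partial i (mpoly_fun P) (t *: x))); last first.
      by move=> i _; rewrite (pder_partial (pder_mpoly i P)) mxE mulrA.
    apply: H; rewrite -(@ger0_norm _ (enorm _)) ?sqrtr_ge0//.
    have -> : `|enorm (t *: x)| = t * enorm x.
      rewrite ger0_norm ?sqrtr_ge0//; apply/eqP; rewrite -(@eqrXn2 _ 2) ?sqrtr_ge0 ?mulr_ge0 ?ltW//.
      by rewrite enormZ_sqr exprMn.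
    apply: (@lt_trans _ _ (t0 * enorm x)); last by rewrite ltr_pM2r.
    by rewrite divfK ?gt_eqF// /r1; apply: (le_lt_trans (ler_norm r)); rewrite ltrDl.
  move=> H; rewrite -(pmulr_rge0 _ tp) /dphi mulrBr subr_ge0; apply: le_trans H.
  have -> : t * (K * ((1 + t ^+ 2 * sqn x)^-1 * (2 * t * sqn x))) = 2 * K * ((1 + t ^+ 2 * sqn x)^-1 * (t ^+ 2 * sqn x)) by ring.
  rewrite ler_piMr ?mulr_ge0// mulrC ler_pdivrMr// mul1r; lra.
have cphi : continuous phi.
  by move=> t; apply: differentiable_continuous; apply/derivable1_diffP; have [] := dp t.
have [c cin Ec] := @MVT R phi dphi t0 1 t01 (fun t _ => dp t) (continuous_subspaceT cphi).
move: cin; rewrite in_itv/= => /andP[c0 c1].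
have := PD (t0 *: x).
rewrite sqnZ (_ : t0 ^+ 2 * sqn x = r1 ^+ 2); last first.
  by rewrite -e2 /t0 expr_div_n divfK// expf_neq0// gt_eqF.
move/(_ (lexx _)).
have : 0 <= phi 1 - phi t0 by rewrite Ec mulr_ge0 ?dp0// subr_ge0 ltW.
rewrite /phi scale1r expr1n mul1r (_ : t0 ^+ 2 * sqn x = r1 ^+ 2); last first.
  by rewrite -e2 /t0 expr_div_n divfK// expf_neq0// gt_eqF.
lra.
Qed.

End polynomials.

(** * Existence of the density *)

Section finite_rank.
Context {R : realType} {n : nat}.
Implicit Types (K L : 'rV[R]_n -> 'rV[R]_n -> R) (d phi : 'rV[R]_n -> R) (x y : 'rV[R]_n).

Lemma itgble_sum (I : Type) (r : seq I) (F : I -> 'rV[R]_n -> R) :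
  (forall i, itgble (F i)) -> itgble (fun x => \sum_(i <- r) F i x) /\
  itg (fun x => \sum_(i <- r) F i x) = \sum_(i <- r) itg (F i).
Proof.
move=> iF; elim: r => [|i r [ih1 ih2]].
  have z : itgble (fun _ : 'rV[R]_n => 0 : R).
    exact: integrable0.
  under eq_fun do rewrite big_nil; rewrite big_nil; split => //.
  by have := itgZ 0 z; rewrite !mul0r.
under eq_fun do rewrite big_cons; rewrite big_cons; split; first exact: itgbleD.
by rewrite itgD// ih2.
Qed.

(* A positive semidefinite kernel given by a Gram representation, a class closed
   under products. *)
Definition gram K := exists (I : finType) (F : I -> 'rV[R]_n -> R),
  (forall i, bdd (F i)) /\ forall x y, K x y = \sum_i F i x * F i y.

Lemma gram1 phi : bdd phi -> gram (fun x y => phi x * phi y).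
Proof. by move=> b; exists 'I_1, (fun _ => phi); split=> // x y; rewrite big_ord1. Qed.

Lemma gramD K L : gram K -> gram L -> gram (fun x y => K x y + L x y).
Proof.
move=> [I [F [bF KE]]] [J [G [bG LE]]].
exists (I + J)%type, (fun s => match s with inl i => F i | inr j => G j end).
by split=> [[]//|x y]; rewrite big_sumType/= KE LE.
Qed.

Lemma gram_sum k (K : 'I_k -> 'rV[R]_n -> 'rV[R]_n -> R) :
  (forall i, gram (K i)) -> gram (fun x y => \sum_i K i x y).
Proof.
elim: k K => [|k ih] K gK.
  exists 'I_0, (fun _ _ => 0); split=> [[]//|x y]; by rewrite !big_ord0.
under eq_fun do under eq_fun do rewrite big_ord_recl.
by apply: gramD => //; exact: ih.
Qed.

Lemma gramM K L : gram K -> gram L -> gram (fun x y => K x y * L x y).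
Proof.
move=> [I [F [bF KE]]] [J [G [bG LE]]].
exists (I * J)%type, (fun s x => F s.1 x * G s.2 x); split=> [[i j]|x y]; first exact: bddM.
rewrite KE LE mulr_suml -(pair_bigA _ (fun i j => F i x * G j x * (F i y * G j y)))/=.
apply: eq_bigr => i _; rewrite mulr_sumr; apply: eq_bigr => j _; ring.
Qed.

Lemma gramZ c K : 0 <= c -> gram K -> gram (fun x y => c * K x y).
Proof.
move=> c0 gK; have := gramM (gram1 (bdd_cst n (Num.sqrt c))) gK.
by under eq_fun do under eq_fun do rewrite -expr2 (sqr_sqrtr c0).
Qed.

Lemma gramX K k : gram K -> gram (fun x y => K x y ^+ k.+1).
Proof.
move=> gK; elim: k => [|k ih]; first by under eq_fun do under eq_fun do rewrite expr1.
by under eq_fun do under eq_fun do rewrite exprS; exact: gramM.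
Qed.

(** The quadratic form of a finite Gram kernel is the sum of the squares of the integrals of F_i d
    against [W]. *)
Lemma gram_kop (W : 'rV[R]_n -> R) K d : mble W -> (forall x, 0 < W x) ->
  itgble W -> gram K -> bdd d ->
  mble (kop W K d) /\ 0 <= wint W (fun x => d x * kop W K d x).
Proof.
move=> mW W0 iW [I [F [bF KE]]] bd.
have iFd i : itgble (fun x => F i x * d x * W x).
  by apply: (bdd_int mW W0 iW); exact: bddM.
have kE x : kop W K d x = \sum_i F i x * wint W (fun y => F i y * d y).
  rewrite /kop /wint; under eq_fun do rewrite KE !mulr_suml.
  have := itgble_sum (index_enum I) (fun i => itgbleZ (F i x) (iFd i)).
  move=> [_ E]; rewrite -[RHS](eq_bigr _ (fun i _ => itgZ (F i x) (iFd i))) -E.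
  by congr itg; apply/funext => y; apply: eq_bigr => i _; ring.
split.
  rewrite (_ : kop W K d = fun x => \sum_i F i x * wint W (fun y => F i y * d y)); last exact/funext.
  elim: (index_enum I) => [|i r ih]; first by under eq_fun do rewrite big_nil; exact: mble_cst.
  under eq_fun do rewrite big_cons.
  exact: (mbleD (mbleM (bF i).1 (mble_cst _)) ih).
rewrite /wint; under eq_fun do rewrite kE mulr_sumr mulr_suml.
pose v i := wint W (fun y => F i y * d y).
have [_ E] := itgble_sum (index_enum I) (fun i => itgbleZ (v i) (iFd i)).
rewrite (_ : itg _ = \sum_i itg (fun x => v i * (F i x * d x * W x))); last first.
  by rewrite -E; congr itg; apply/funext => x; apply: eq_bigr => i _; rewrite /v; ring.
by apply: sumr_ge0 => i _; rewrite itgZ// -expr2 sqr_ge0.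
Qed.

End finite_rank.

Section log_series.
Context {R : realType}.
Implicit Types s t : R.

Definition lnser N s : R := \sum_(j < N) (j.+1%:R)^-1 * s ^+ j.+1.

Lemma is_derive_lnser N s : is_derive s 1 (lnser N) (\sum_(j < N) s ^+ j).
Proof.
rewrite /lnser (_ : (fun s => _) = \sum_(j < N) (fun s : R => (j.+1%:R)^-1 * s ^+ j.+1)); last first.
  by apply/funext => u; rewrite fct_sumE.
apply: is_derive_sum => j.
rewrite (_ : (fun s => _) = j.+1%:R^-1 *: ((@id R) ^+ j.+1)); last first.
  by apply/funext => u; rewrite !fctE.
apply: (is_derive_eq (is_deriveZ (j.+1%:R^-1) (is_deriveX j.+1 (is_derive_id s 1)))).
by rewrite /GRing.scale/= mulr1 mulrA mulVf ?mul1r// pnatr_eq0.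
Qed.

(** The remainder has derivative t^N / (1 - t), by the geometric sum, and vanishes at 0; the mean
    value theorem gives s c^N / (1 - c) with 0 < c < s. The case s = 0 has no interior point and is
    treated apart. *)
Lemma lnser_tail N s : 0 <= s -> s < 1 ->
  0 <= - ln (1 - s) - lnser N s <= s ^+ N.+1 / (1 - s).
Proof.
rewrite le_eqVlt => /predU1P[<- _|s0 s1].
  rewrite subr0 ln1 oppr0 sub0r (_ : lnser N 0 = 0) ?oppr0 ?lexx/= ?expr0n/= ?mul0r//.
  by rewrite /lnser big1// => j _; rewrite expr0n/= mulr0.
pose phi t := - ln (1 - t) - lnser N t.
pose dphi t := t ^+ N / (1 - t).
have dp t : t < 1 -> is_derive t 1 phi (dphi t).
  move=> t1; have t0 : 0 < 1 - t by rewrite subr_gt0.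
  have d1 : is_derive t 1 (fun t : R => 1 - t) (-1).
    by apply: (is_derive_eq (is_deriveB (is_derive_cst (1 : R) t 1) (is_derive_id t 1))); rewrite sub0r.
  have d2 : is_derive t 1 (fun t : R => ln (1 - t)) ((1 - t)^-1 * -1).
    by apply: (is_derive1_comp (f := @ln R) (g := fun t : R => 1 - t)) => //; exact: is_derive1_ln.
  apply: (is_derive_eq (is_deriveB (is_deriveN d2) (is_derive_lnser N t))).
  rewrite /dphi mulrN1 opprK.
  have : t ^+ N - 1 = (t - 1) * \sum_(j < N) t ^+ j by exact: subrX1.
  move=> E; have -> : t ^+ N = 1 - (1 - t) * \sum_(j < N) t ^+ j by move: E; lra.
  by field; rewrite gt_eqF.
have cphi : {within `[0, s], continuous phi}.
  apply: derivable_within_continuous => t; rewrite in_itv/= => /andP[_ ts].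
  by have [] := dp t (le_lt_trans ts s1).
have dp' t : t \in `]0, s[ -> is_derive t 1 phi (dphi t).
  by rewrite in_itv/= => /andP[_ ts]; apply: dp; exact: lt_trans s1.
have [c cin Ec] := MVT s0 dp' cphi.
move: cin; rewrite in_itv/= => /andP[c0 cs].
have phi0 : phi 0 = 0.
  rewrite /phi subr0 ln1 oppr0 sub0r (_ : lnser N 0 = 0) ?oppr0//.
  by rewrite /lnser big1// => j _; rewrite expr0n/= mulr0.
move: Ec; rewrite phi0 !subr0 -/(phi s) => ->.
have c1 : 0 < 1 - c by rewrite subr_gt0 (lt_trans cs).
have s1' : 0 < 1 - s by rewrite subr_gt0.
rewrite /dphi mulr_ge0 ?divr_ge0 ?exprn_ge0 ?(ltW c0) ?(ltW c1) ?(ltW s0)//=.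
rewrite exprSr [leRHS]mulrAC ler_pM2r//.
apply: ler_pM; rewrite ?exprn_ge0 ?invr_ge0 ?(ltW c0) ?(ltW c1)//.
  by rewrite lerXn2r ?nnegrE ?(ltW c0) ?(ltW s0) ?(ltW cs).
by rewrite lef_pV2 ?posrE// lerD2l lerN2 ltW.
Qed.

End log_series.

(** * The logarithmic kernel as a function of spherical correlation *)

Section log_kernel.
Context {R : realType} {n : nat}.
Implicit Types (d h : 'rV[R]_n -> R) (x y : 'rV[R]_n).

(** The s of the overview: (1 + p) / 2, where p is the inner product of [stereo x] and [stereo y].
    It lies in [0, 1] and equals 1 only on the diagonal. *)
Definition corr x y : R := 1 - sqn (x - y) / ((1 + sqn x) * (1 + sqn y)).

Definition lker x y : R := ln (1 + sqn x) + ln (1 + sqn y) - ln (sqn (x - y)).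

Let D0 x y : 0 < (1 + sqn x) * (1 + sqn y).
Proof. by rewrite mulr_gt0 ?sq1_gt0. Qed.

Lemma sqnB x y : sqn (x - y) = sqn x + sqn y - 2 * \sum_i x 0 i * y 0 i.
Proof.
rewrite /sqn mulr_sumr -big_split -sumrB; apply: eq_bigr => i _; rewrite !mxE/=; ring.
Qed.

Lemma corrE x y : corr x y =
  (1 + 2 * (\sum_i x 0 i * y 0 i) + sqn x * sqn y) / ((1 + sqn x) * (1 + sqn y)).
Proof.
rewrite /corr sqnB; have := lt0r_neq0 (sq1_gt0 x); have := lt0r_neq0 (sq1_gt0 y).
by move=> *; field; apply/andP.
Qed.

(** For y != 0 the numerator 1 + 2 x.y + |x|^2 |y|^2 is |y|^2 times the squared distance of x to -y
    / |y|^2. *)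
Lemma corr_ge0 x y : 0 <= corr x y.
Proof.
rewrite corrE divr_ge0 ?(ltW (D0 _ _))//.
have [->|y0] := eqVneq y 0.
  rewrite sqn0 mulr0 addr0 big1 ?mulr0 ?addr0// => i _; by rewrite mxE mulr0.
have qy := sqn_gt0 y0.
have : 0 <= sqn y * sqn (x - (- (sqn y)^-1) *: y) by rewrite mulr_ge0 ?sqn_ge0.
rewrite sqnB sqnZ (eq_bigr (fun i => - (sqn y)^-1 * (x 0 i * y 0 i))); last first.
  by move=> i _; rewrite mxE; ring.
rewrite -mulr_sumr; set p := \sum_i _.
have -> : sqn y * (sqn x + (- (sqn y)^-1) ^+ 2 * sqn y - 2 * (- (sqn y)^-1 * p)) =
  1 + 2 * p + sqn x * sqn y by field; rewrite gt_eqF.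
by [].
Qed.

Lemma corr_lt1 x y : y != x -> corr x y < 1.
Proof.
move=> yx; rewrite /corr ltrBlDr ltrDl divr_gt0// sqn_gt0// subr_eq0 eq_sym.
by [].
Qed.

Lemma lkerE x y : y != x -> lker x y = - ln (1 - corr x y).
Proof.
move=> yx; have q0 : 0 < sqn (x - y) by rewrite sqn_gt0// subr_eq0 eq_sym.
by rewrite /corr subKr /lker ln_div ?posrE// lnM ?posrE ?sq1_gt0// opprB.
Qed.

Lemma lker_sym x y : lker x y = lker y x.
Proof.
by rewrite /lker (_ : sqn (x - y) = sqn (y - x)) 1?[ln _ + _]addrC// -sqnN opprB.
Qed.

Lemma lker_ge0 x y : 0 <= lker x y.
Proof.
have [->|yx] := eqVneq y x.
  (* On the diagonal [ln 0 = 0] leaves the value 2 ln (1 + |x|^2). *)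
  rewrite /lker subrr sqn0 (ln0 (lexx 0)) subr0; have : 0 <= ln (1 + sqn x) by rewrite ln_ge0// sq1_ge1.
  lra.
rewrite lkerE// oppr_ge0 ln_le0// gerBl.
exact: corr_ge0.
Qed.

(** The features are 1, |x|^2 and sqrt 2 x_i, each divided by 1 + |x|^2, which makes them
    bounded. *)
Lemma gram_corr : gram corr.
Proof.
have bddV (f : 'rV[R]_n -> R) : mble f -> (forall x, `|f x| <= 1 + sqn x) -> bdd (fun x => f x / (1 + sqn x)).
  move=> mf fb; split.
    apply: mbleM => //; apply: mbleV; apply: mbleD; [exact: mble_cst|exact: mble_sqn].
  exists 1 => x; rewrite normrM [`|_^-1|]ger0_norm ?invr_ge0 ?(ltW (sq1_gt0 _))//.
  by rewrite ler_pdivrMr ?sq1_gt0// mul1r.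
have -> : corr = fun x y => 1 / (1 + sqn x) * (1 / (1 + sqn y)) +
    (sqn x / (1 + sqn x) * (sqn y / (1 + sqn y)) +
     2 * \sum_i x 0 i / (1 + sqn x) * (y 0 i / (1 + sqn y))).
  apply/funext => x; apply/funext => y; rewrite corrE.
  rewrite [X in _ = _ + (_ + 2 * X)](eq_bigr (fun i => ((1 + sqn x) * (1 + sqn y))^-1 * (x 0 i * y 0 i))); last first.
    by move=> i _; rewrite invfM; ring.
  rewrite -mulr_sumr; have := lt0r_neq0 (sq1_gt0 x); have := lt0r_neq0 (sq1_gt0 y).
  by move=> *; field; apply/andP.
apply: gramD.
  by apply: gram1; apply: bddV => [|x]; [exact: mble_cst|rewrite normr1 sq1_ge1].
apply: gramD.
  apply: gram1; apply: bddV => [|x]; first exact: mble_sqn.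
  by rewrite ger0_norm ?sqn_ge0// lerDr.
apply: gramZ => //; apply: gram_sum => i; apply: gram1; apply: bddV => [|x]; first exact: mble_coord.
have := sqn_coord x i; have := sqr_ge0 (`|x 0 i| - 1).
by rewrite -[x 0 i ^+ 2]real_normK ?num_real// => h1 h2; nra.
Qed.

Lemma gram_lnser N : gram (fun x y => lnser N (corr x y)).
Proof.
rewrite /lnser; apply: gram_sum => j; apply: gramZ; first by rewrite invr_ge0.
exact: gramX gram_corr.
Qed.

Lemma mble_lker x : mble (lker x).
Proof.
apply: mbleB; last by apply: (mble_subl (f := fun z => ln (sqn z))); apply: mble_ln; exact: mble_sqn.
apply: mbleD; first exact: mble_cst.
by apply: mble_ln; apply: mbleD; [exact: mble_cst|exact: mble_sqn].
Qed.

(** From ln t = 2 ln (sqrt t) <= 2 sqrt t one gets ln^2 <= 4 t. Peetre's inequality removes the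
    factor 1 + |x|^2 from t, so the bound is uniform in [x] up to the singularity; it also supplies
    the factor 2 in 8. *)
Lemma lker_sqr x y : y != x ->
  lker x y ^+ 2 <= 8 * ((1 + sqn y) ^+ 2 * (1 + (sqn (x - y))^-1)).
Proof.
move=> yx; have q0 : 0 < sqn (x - y) by rewrite sqn_gt0// subr_eq0 eq_sym.
pose t := (1 + sqn x) * (1 + sqn y) / sqn (x - y).
have t0 : 0 < t by rewrite divr_gt0.
have lt : lker x y = ln t by rewrite /lker /t ln_div ?posrE// lnM ?posrE ?sq1_gt0.
have l2 : lker x y <= 2 * Num.sqrt t.
  have -> : lker x y = 2 * ln (Num.sqrt t).
    by rewrite lt -{1}(sqr_sqrtr (ltW t0)) lnXn ?sqrtr_gt0// mulr_natl.
  rewrite ler_wpM2l//.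
  by apply/ltW/ln_sublinear; rewrite sqrtr_gt0.
apply: (@le_trans _ _ ((2 * Num.sqrt t) ^+ 2)).
  by rewrite lerXn2r ?nnegrE ?lker_ge0// mulr_ge0 ?sqrtr_ge0.
rewrite exprMn sqr_sqrtr ?(ltW t0)// /t.
have := peetre y x; rewrite -(sqnN (y - x)) opprB => pe.
have s0 := sq1_gt0 y.
apply: (@le_trans _ _ (4 * ((2 * (1 + sqn y) * (1 + sqn (x - y))) * (1 + sqn y) / sqn (x - y)))).
  rewrite (_ : (2 : R) ^+ 2 = 4); last by ring.
  rewrite ler_wpM2l// ler_wpM2r ?invr_ge0 ?(ltW q0)// ler_wpM2r ?(ltW s0)//.
rewrite le_eqVlt; apply/orP; left; apply/eqP; by field; rewrite gt_eqF.
Qed.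

End log_kernel.

Lemma eq_itg_off {R : realType} {n : nat} (p : 'rV[R]_n) (f f' : 'rV[R]_n -> R) : (0 < n)%N ->
  itgble f -> itgble f' -> (forall x, x != p -> f x = f' x) -> itg f = itg f'.
Proof.
move=> n0 fi gi fg; apply/eqP; rewrite eq_le.
by apply/andP; split; apply: (le_itg_off (p := p)) => // x xp; rewrite fg.
Qed.

Section integrability.
Context {R : realType} {n : nat} (n4 : (4 <= n)%N).
Implicit Types (x y : 'rV[R]_n).

Lemma dbound_itgble (f : 'rV[R]_n -> R) : mble f -> dbound f -> itgble f.
Proof.
move=> mf df; have [C fC] := df n; apply: itgble_le mf (itgbleZ C (itgble_wgt n4)) _ => x.
by rewrite /wgt ler_pdivlMr ?sq1X_gt0.
Qed.

Lemma itgble_logk_sub (f : 'rV[R]_n -> R) x : mble f -> dbound f ->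
  itgble (fun y => f y * logk (x - y)).
Proof.
move=> mf df; have dl : dom (@logk R n) f by apply: dom_adm => //; exact: adm_logk.
have N10 : -1 != 0 :> R by rewrite oppr_eq0 oner_eq0.
have := itgble_affine x N10 (conv_itgble x (@mble_logk R n) mf dl).
rewrite (_ : (fun z => _) = fun y => f y * logk (x - y))//.
by apply/funext => y; rewrite scaleN1r subKr mulrC.
Qed.

End integrability.

(** * Verification of the abstract hypotheses for the logarithmic kernel *)

Section existence.
Context {R : realType} {n : nat} (n4 : (4 <= n)%N) (g : R) (g0 : 0 < g).
Context (W : 'rV[R]_n -> R) (mW : mble W) (W0 : forall x, 0 < W x) (dW : dbound W).
Implicit Types (d h : 'rV[R]_n -> R) (x y : 'rV[R]_n).
Local Notation RT := (measurableTypeR R).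

Let np : (0 < n)%N. Proof. exact: leq_trans n4. Qed.

Let gk x y := g * lker x y.

Let iW : itgble W. Proof. exact: dbound_itgble. Qed.

Let gk_ge0 x y : 0 <= gk x y.
Proof. by rewrite mulr_ge0 ?lker_ge0// ltW. Qed.

Let mgk x : mble (gk x).
Proof. by apply: mbleM; [exact: mble_cst|exact: mble_lker]. Qed.

Let mgk2 x : mble (fun y => gk x y ^+ 2 * W y).
Proof. by apply: mbleM => //; apply: mbleX. Qed.

Let gk_sqr : exists2 C2, 0 < C2 & forall x,
  itgble (fun y => gk x y ^+ 2 * W y) /\ itg (fun y => gk x y ^+ 2 * W y) <= C2.
Proof.
have [CS HS] := itgble_sing (R := R) n4; have [D WD] := dW (2 + n)%N.
have D0 : 0 <= D by apply: le_trans (WD 0); rewrite mulr_ge0// ltW// sq1X_gt0.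
have bnd x y : y != x -> `|gk x y ^+ 2 * W y| <= g ^+ 2 * 8 * D * sing x y.
  move=> yx; rewrite ger0_norm; last by apply: mulr_ge0; [exact: sqr_ge0|exact: ltW].
  have WD' : (1 + sqn y) ^+ 2 * W y <= D * wgt y.
    rewrite /wgt ler_pdivlMr ?sq1X_gt0// mulrAC -exprD mulrC.
    by have := WD y; rewrite ger0_norm// ltW.
  rewrite [leLHS](_ : _ = g ^+ 2 * (lker x y ^+ 2 * W y)); last by rewrite /gk exprMn mulrA.
  rewrite [leRHS](_ : _ = g ^+ 2 * (8 * (D * sing x y))); last by rewrite !mulrA.
  rewrite ler_pM2l ?exprn_gt0//.
  apply: (le_trans (ler_wpM2r (ltW (W0 y)) (lker_sqr yx))).
  rewrite -!mulrA ler_pM2l// /sing.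
  rewrite [leLHS](_ : _ = (1 + (sqn (x - y))^-1) * ((1 + sqn y) ^+ 2 * W y)); last by ring.
  rewrite [leRHS](_ : _ = (1 + (sqn (x - y))^-1) * (D * wgt y)); last by ring.
  by rewrite ler_wpM2l// addr_ge0// invr_ge0 sqn_ge0.
have iS x := itgbleZ (g ^+ 2 * 8 * D) (HS x).1.
(* The added 1 only secures strict positivity. *)
exists (g ^+ 2 * 8 * D * CS + 1).
  have : 0 <= itg (sing (0 : 'rV[R]_n)) by apply: itg_ge0 => y; exact: sing_ge0.
  move=> h; have CS0 := le_trans h (HS 0).2.
  by rewrite ltr_wpDl// !mulr_ge0 ?exprn_ge0// ltW.
move=> x; split; first exact: (itgble_le_off (p := x) np (mgk2 x) (iS x) (bnd x)).
have := le_normr_itg_off (p := x) np (mgk2 x) (iS x) (bnd x).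
rewrite itgZ; last exact: (HS x).1.
move=> h; apply: (le_trans (ler_norm _)); apply: (le_trans h).
have := (HS x).2; have : 0 <= g ^+ 2 * 8 * D by rewrite !mulr_ge0 ?exprn_ge0// ltW.
move=> c0 /(ler_wpM2l c0); lra.
Qed.

Let mgk_pair : measurable_fun setT
  (fun p : n.-tuple RT * n.-tuple RT => gk (row_of_tuple p.1) (row_of_tuple p.2) : RT).
Proof.
apply: measurable_funM => //.
have mc (i : 'I_n) (F : n.-tuple RT * n.-tuple RT -> n.-tuple RT) : measurable_fun setT F ->
    measurable_fun setT (fun p => tnth (F p) i).
  by move=> mF; exact: (measurableT_comp (measurable_tnth i) mF).
have ms (F : n.-tuple RT * n.-tuple RT -> n.-tuple RT) : measurable_fun setT F ->
    measurable_fun setT (fun p => ln (1 + sqn (row_of_tuple (F p))) : RT).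
  have me : mble (fun x : 'rV[R]_n => ln (1 + sqn x)).
    by apply: mble_ln; apply: mbleD; [exact: mble_cst|exact: mble_sqn].
  by move=> mF; exact: (measurableT_comp me mF).
apply: measurable_funB; first by apply: measurable_funD; exact: ms.
apply: (measurableT_comp (@measurable_ln R)).
rewrite (_ : (fun p => _) = fun p : n.-tuple RT * n.-tuple RT => \sum_(i < n) (tnth p.1 i - tnth p.2 i) ^+ 2); last first.
  by apply/funext => p; apply: eq_bigr => i _; rewrite !mxE.
apply: (@measurable_sum _ _ R) => i; apply: measurable_funX; apply: measurable_funB; exact: mc.
Qed.

Let gk2 x : itgble (fun y => gk x y ^+ 2 * W y).
Proof. by have [C2 _ H] := gk_sqr; exact: (H x).1. Qed.

Let gk_int h x : bdd h -> itgble (fun y => gk x y * h y * W y).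
Proof. exact: kop_int. Qed.

Let gk_int1 x : itgble (fun y => gk x y * W y).
Proof. by have := gk_int x (bdd_cst n 1); under eq_fun do rewrite mulr1. Qed.

Let gk_mass1 : exists C1, forall x, kop W gk (fun _ => 1) x <= C1.
Proof.
have [C2 _ H] := gk_sqr; exists (itg W + C2) => x.
apply: (@le_trans _ _ (itg W + itg (fun y => gk x y ^+ 2 * W y))); last by rewrite lerD2l (H x).2.
rewrite -itgD//.
apply: le_itg; [exact: (gk_int x (bdd_cst n 1))|exact: itgbleD iW (H x).1|].
move=> y; rewrite mulr1; have := ltW (W0 y); have := gk_ge0 x y; set k := gk x y => k0 w0.
have : 0 <= (1 + k ^+ 2 - k) * W y by rewrite mulr_ge0//; have := sqr_ge0 (k - 1); nra.
lra.
Qed.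

Let iter_pair h : bdd h -> measurable_fun setT
  (fun p : n.-tuple RT * n.-tuple RT => (W (row_of_tuple p.1) *
    (gk (row_of_tuple p.1) (row_of_tuple p.2) * h (row_of_tuple p.2) * W (row_of_tuple p.2)))%:E).
Proof.
move=> [mh _]; apply/measurable_EFinP; apply: measurable_funM.
  exact: (measurableT_comp mW (@measurable_fst _ _ (n.-tuple RT) (n.-tuple RT))).
apply: measurable_funM; first apply: measurable_funM => //.
  exact: (measurableT_comp mh (@measurable_snd _ _ (n.-tuple RT) (n.-tuple RT))).
exact: (measurableT_comp mW (@measurable_snd _ _ (n.-tuple RT) (n.-tuple RT))).
Qed.

Let iter_ge0 h : (forall x, 0 <= h x) -> forall p : n.-tuple RT * n.-tuple RT, (0 <= (W (row_of_tuple p.1) *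
    (gk (row_of_tuple p.1) (row_of_tuple p.2) * h (row_of_tuple p.2) * W (row_of_tuple p.2)))%:E)%E.
Proof.
move=> h0 p; rewrite lee_fin; apply: mulr_ge0; first exact: ltW.
by apply: mulr_ge0; [apply: mulr_ge0 => //; exact: gk_ge0|exact: ltW].
Qed.

Let iterE h x : bdd h -> integral_Rn (fun y => (W x * (gk x y * h y * W y))%:E) =
  (W x * kop W gk h x)%:E.
Proof. by move=> bh; rewrite (itgE (itgbleZ (W x) (gk_int x bh))) itgZ//; exact: gk_int. Qed.

Let mB h : bdd h -> (forall x, 0 <= h x) -> mble (kop W gk h).
Proof.
move=> bh h0.
have := measurable_fun_fubini_tonelli_F (m2 := lebesgue_tuple R n) _ (iter_pair bh) (iter_ge0 h0).
rewrite (_ : fubini_F _ _ = fun t => (W (row_of_tuple t) * kop W gk h (row_of_tuple t))%:E); last first.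
  by apply/funext => t; rewrite -iterE.
move/measurable_EFinP => m.
(* Tonelli gives measurability of the product W K h; dividing by the positive weight recovers K
   h. *)
rewrite (_ : kop W gk h = fun x => (W x)^-1 * (W x * kop W gk h x)); last first.
  by apply/funext => x; rewrite mulKf// gt_eqF.
by apply: mbleM => //; exact: mbleV.
Qed.

(** Tonelli and the symmetry of the kernel transfer K from [h] to the constant 1. *)
Let kop_mass C1 h : (forall x, kop W gk (fun _ => 1) x <= C1) ->
  bdd h -> (forall x, 0 <= h x) -> wint W (kop W gk h) <= C1 * wint W h.
Proof.
move=> HC bh h0.
have bk : bdd (kop W gk h) by exact: (bdd_kop mW W0 iW mgk gk_ge0 gk2 HC mB).
have iwk := bdd_int mW W0 iW bk.
rewrite -lee_fin -(itgE iwk) /wint -itgZ; last exact: bdd_int.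
rewrite -(itgE (itgbleZ C1 (bdd_int mW W0 iW bh))).
have -> : integral_Rn (fun x => (kop W gk h x * W x)%:E) =
    integral_Rn (fun y => (h y * W y * kop W gk (fun _ => 1) y)%:E).
  transitivity (\int[lebesgue_tuple R n]_s \int[lebesgue_tuple R n]_t (W (row_of_tuple s) *
    (gk (row_of_tuple s) (row_of_tuple t) * h (row_of_tuple t) * W (row_of_tuple t)))%:E)%E.
    by apply: eq_integral => s _; rewrite mulrC -iterE.
  rewrite (fubini_tonelli _ (iter_pair bh) (iter_ge0 h0)).
  apply: eq_integral => t _.
  rewrite /kop /wint -itgZ; last exact: (gk_int _ (bdd_cst n 1)).
  rewrite -(itgE (itgbleZ _ (gk_int _ (bdd_cst n 1)))); apply: eq_integral => s _.
  by rewrite /gk lker_sym; congr (_%:E); ring.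
apply: ge0_le_integral => //.
- move=> t _; rewrite lee_fin; apply: mulr_ge0; first by apply: mulr_ge0 => //; exact: ltW.
  by apply: itg_ge0 => y; rewrite mulr1 mulr_ge0 ?gk_ge0 ?ltW.
- have m1 : mble (kop W gk (fun _ => 1)) by apply: mB; [exact: bdd_cst|].
  by apply/measurable_EFinP; exact: (mbleM (mbleM bh.1 mW) m1).
- by apply/measurable_EFinP; exact: itgble_mble (itgbleZ C1 (bdd_int mW W0 iW bh)).
- move=> t _; rewrite lee_fin mulrC ler_wpM2r//.
  by apply: mulr_ge0 => //; exact: ltW.
Qed.

(* [lker x] differs from the limit of the partial sums only at [x], a null set;
   multiplying by [q / q] with [q = sqn (x - y)], which is [0] at [y = x], makes
   the convergence hold everywhere. *)
Let psd d : bdd d -> 0 <= wint W (fun x => d x * kop W gk d x).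
Proof.
move=> bd; have [md [b db]] := bd; have b0 : 0 <= b by apply: le_trans (db 0).
pose K N x y := g * lnser N (corr x y).
have gK N : gram (K N) by apply: gramZ; [exact: ltW|exact: gram_lnser].
have Kle N x y : y != x -> 0 <= gk x y - K N x y <= g * (corr x y ^+ N.+1 / (1 - corr x y)).
  move=> yx; rewrite /K /gk -mulrBr lkerE//.
  have /andP[h1 h2] := lnser_tail N (corr_ge0 x y) (corr_lt1 yx).
  by apply/andP; split; [apply: mulr_ge0 => //; exact: ltW|rewrite ler_pM2l].
have K0 N x y : 0 <= K N x y.
  apply: mulr_ge0; first exact: ltW.
  by apply: sumr_ge0 => j _; rewrite mulr_ge0 ?invr_ge0 ?exprn_ge0 ?corr_ge0.
pose e x y := sqn (x - y) / sqn (x - y).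
have e1 x y : y != x -> e x y = 1.
  by move=> yx; rewrite /e divff// gt_eqF// sqn_gt0// subr_eq0 eq_sym.
have e0 x : e x x = 0 by rewrite /e subrr sqn0 mul0r.
have me x : mble (e x).
  by apply: mbleM; [|apply: mbleV]; apply: (mble_subl (f := @sqn R n)); exact: mble_sqn.
have mK N x : mble (K N x).
  apply: mbleM; first exact: mble_cst.
  rewrite /lnser; apply: mble_sum => j; apply: mbleM; first exact: mble_cst.
  apply: mbleX; apply: mbleB; first exact: mble_cst.
  apply: mbleM; first by apply: (mble_subl (f := @sqn R n)); exact: mble_sqn.
  apply: mbleV; apply: mbleM; first exact: mble_cst.
  by apply: mbleD; [exact: mble_cst|exact: mble_sqn].
have Kb N x y : y != x -> `|K N x y * d y * W y| <= b * (gk x y * W y).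
  move=> yx; rewrite normrM normrM (ger0_norm (K0 _ _ _)) (gtr0_norm (W0 y)).
  rewrite [leRHS]mulrA ler_pM2r// [leRHS]mulrC ler_pM//.
  by have /andP[+ _] := Kle N x y yx; rewrite subr_ge0.
have iK N x : itgble (fun y => K N x y * d y * W y).
  apply: (itgble_le_off (p := x) np _ (itgbleZ b (gk_int1 x)) (Kb N x)).
  by apply: mbleM => //; exact: mbleM.
pose H x := b * itg (fun y => gk x y * W y).
have KH N x : `|kop W (K N) d x| <= H x.
  rewrite /H -itgZ; last exact: gk_int1.
  apply: (le_normr_itg_off (p := x) np _ (itgbleZ b (gk_int1 x)) (Kb N x)).
  exact: itgble_mble (iK N x).
have cut (L : 'rV[R]_n -> 'rV[R]_n -> R) x : mble (L x) -> itgble (fun y => L x y * d y * W y) ->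
    kop W L d x = itg (fun y => e x y * (L x y * d y * W y)).
  move=> mL iL; apply: (eq_itg_off (p := x)) => //; last by move=> y yx; rewrite e1// mul1r.
  apply: (itgble_le_off (p := x) np _ (itgble_abs iL)).
    by apply: mbleM => //; apply: mbleM => //; apply: mbleM.
  by move=> y yx; rewrite e1// mul1r.
have cK x : kop W (K N) d x @[N --> \oo] --> kop W gk d x.
  rewrite (cut gk)//; last exact: gk_int.
  under eq_fun do rewrite cut//.
  apply: (cvg_itg (g := fun y => b * (gk x y * W y))).
  - by move=> N; apply: mbleM => //; apply: mbleM => //; apply: mbleM.
  - exact: itgbleZ (gk_int1 x).
  - move=> y; have [->|yx] := eqVneq y x.
      by under eq_fun do rewrite e0 mul0r; rewrite e0 mul0r; exact: cvg_cst.
    rewrite e1// mul1r; under eq_fun do rewrite mul1r.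
    apply: cvgMl; apply: cvgMl.
    have c1 := corr_lt1 yx; have c0 := corr_ge0 x y.
    have c00 : (fun N => g * (corr x y ^+ N.+1 / (1 - corr x y))) @ \oo --> (0 : R).
      rewrite -(mulr0 g); apply: cvgMr; rewrite -(mul0r (1 - corr x y)^-1); apply: cvgMl.
      by rewrite (cvg_shiftS (fun N => corr x y ^+ N)); apply: cvg_expr; rewrite ger0_norm.
    have c2 : (fun N => gk x y - K N x y) @ \oo --> (0 : R).
      apply: (squeeze_cvgr _ (cvg_cst 0) c00).
      by apply: nearW => N; exact: Kle.
    rewrite (_ : (fun N => K N x y) = fun N => gk x y - (gk x y - K N x y)); last first.
      by apply/funext => N; rewrite subKr.
    by rewrite -[X in _ --> X]subr0; apply: cvgB => //; exact: cvg_cst.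
  - move=> N y; have [->|yx] := eqVneq y x; last by rewrite e1// mul1r; exact: Kb.
    rewrite e0 mul0r normr0; apply: mulr_ge0 => //.
    by apply: mulr_ge0; [exact: gk_ge0|exact: ltW].
have [C1 HC] := gk_mass1.
have HC1 x : H x <= b * C1.
  rewrite /H ler_wpM2l//; have := HC x; rewrite /kop /wint.
  by under eq_fun do rewrite mulr1.
have cQ : wint W (fun x => d x * kop W (K N) d x) @[N --> \oo] --> wint W (fun x => d x * kop W gk d x).
  apply: (cvg_itg (g := fun x => b * (b * C1) * W x)).
  - move=> N; apply: mbleM => //; apply: mbleM => //.
    by have [] := gram_kop mW W0 iW (gK N) bd.
  - exact: itgbleZ.
  - by move=> x; apply: cvgMl; apply: cvgMr; exact: cK.
  - move=> N x; rewrite normrM normrM (gtr0_norm (W0 x)) ler_pM2r// ler_pM//.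
    exact: le_trans (KH N x) (HC1 x).
rewrite -(cvg_lim _ cQ)//; apply: limr_ge; first exact: cvgP cQ.
by apply: nearW => N; have [] := gram_kop mW W0 iW (gK N) bd.
Qed.

Lemma lker_fixed_point : exists c h, [/\ mble h, (forall x, 0 < h x <= expR c),
  (forall x, ln (h x) + itg (fun y => g * lker x y * h y * W y) = c) &
  itg (fun x => h x * W x) = 1].
Proof.
have [C2 C20 HC2] := gk_sqr; have [C1 HC1] := gk_mass1.
apply: (@normalized_fixed_point R n W gk mW W0 iW C1 C2) => //.
- by move=> x; exact: (HC2 x).2.
- by move=> h; exact: kop_mass.
- by rewrite /wint; under eq_fun do rewrite mul1r; exact: itg_gt0.
Qed.

End existence.

Section self_consistent_density.
Context {R : realType} {n : nat} (n4 : (4 <= n)%N).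
Implicit Types (x y : 'rV[R]_n).

Lemma tbound_ln1sqn : tbound (fun x : 'rV[R]_n => ln (1 + sqn x)).
Proof.
exists 1%N, 1 => x; rewrite mul1r expr1 ger0_norm ?ln_ge0 ?sq1_ge1//.
exact/ltW/ln_sublinear/sq1_gt0.
Qed.

(** The weight W = (1 + |x|^2)^g e^-p decays rapidly because p beats (g + N) ln (1 + |x|^2) for
    every N. The density is rho = h W, and the factor 2 g arises because [logk] is half of ln
    |z|^2. *)
Lemma self_consistent_density (g : R) (p : 'rV[R]_n -> R) : 0 < g -> mble p ->
  (forall K, 0 <= K -> exists C, forall x, K * ln (1 + sqn x) - C <= p x) ->
  exists rho c, [/\ mble rho, dbound rho, itg rho = 1 &
    forall x, rho x = expR (2 * g * convol (@logk R n) rho x - p x + c)].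
Proof.
move=> g0 mp pK.
pose W x := expR (g * ln (1 + sqn x) - p x).
have mell : mble (fun x : 'rV[R]_n => ln (1 + sqn x)).
  by apply: mble_ln; apply: mbleD; [exact: mble_cst|exact: mble_sqn].
have mW : mble W.
  by apply: mble_expR; apply: mbleB => //; apply: mbleM => //; exact: mble_cst.
have dW : dbound W.
  move=> N; have [C HC] := pK (g + N%:R) (addr_ge0 (ltW g0) (ler0n R N)).
  exists (expR C) => x; rewrite gtr0_norm ?expR_gt0//.
  rewrite -[X in _ * X ^+ _](lnK (sq1_gt0 x)) -expRM_natl -expRD ler_expR.
  by have := HC x; lra.
have [c [h [mh hr he hm]]] := lker_fixed_point n4 g0 mW (fun x => expR_gt0 _) dW.
pose rho x := h x * W x.
have mrho : mble rho by exact: mbleM.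
have drho : dbound rho.
  move=> N; have [C HC] := dW N; exists (expR c * C) => x.
  rewrite normrM -mulrA; have /andP[h0 hc] := hr x.
  rewrite gtr0_norm//; apply: ler_pM => //; first exact: ltW.
  by apply: mulr_ge0 => //; rewrite ltW// sq1X_gt0.
have irho := dbound_itgble n4 mrho drho.
have iell : itgble (fun x => ln (1 + sqn x) * rho x).
  by apply: (dbound_itgble n4); [exact: mbleM|exact: dboundM tbound_ln1sqn drho].
have dl : dom (@logk R n) rho by apply: dom_adm => //; exact: adm_logk.
have ilog x := itgble_logk_sub n4 x mrho drho.
exists rho, (c - g * itg (fun x => ln (1 + sqn x) * rho x)); split=> // x.
have E : itg (fun y => g * lker x y * h y * W y) =
    g * ln (1 + sqn x) + g * itg (fun x => ln (1 + sqn x) * rho x) - 2 * g * convol (@logk R n) rho x.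
  rewrite (convolC (@mble_logk R n) mrho dl) /convol.
  (* Mass 1 enters here: it makes the term g ln (1 + |x|^2) of K h cancel exactly against the
     weight. *)
  have -> : g * ln (1 + sqn x) = g * ln (1 + sqn x) * itg rho by rewrite hm mulr1.
  rewrite -!itgZ//.
  rewrite -itgD; [|exact: itgbleZ..].
  rewrite -itgB; [|by apply: itgbleD; exact: itgbleZ|exact: itgbleZ].
  by congr itg; apply/funext => y; rewrite /lker /rho /logk; field.
have /andP[h0 _] := hr x.
rewrite /rho -[h x]lnK ?posrE// -expRD; congr expR.
by have := he x; rewrite E; lra.
Qed.

End self_consistent_density.

(** * The equation and the expansion at infinity *)

Section polylaplacian_linear.
Context {R : realType} {n : nat} (n4 : (4 <= n)%N).
Implicit Types f h : 'rV[R]_n -> R.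

Lemma Ck2_pder (A : ('rV[R]_n -> R) -> Prop) f : Ck A 2 f ->
  exists f' f'' : 'I_n -> 'rV[R]_n -> R,
    (forall i, pder i f (f' i)) /\ (forall i, pder i (f' i) (f'' i)).
Proof.
move=> [Bf f1].
have [f' /all_and2[ff' fk']] := choice f1.
have f1' i := (fk' i).2 i.
have [f'' /all_and2[ff'' fk'']] := choice f1'.
by exists f', f''.
Qed.

Lemma polylaplacian_lin j (a b : R) f h :
  (forall k, Ck tempered k f) -> (forall k, Ck tempered k h) ->
  polylaplacian j (fun x => a * f x + b * h x) =
  fun x => a * polylaplacian j f x + b * polylaplacian j h x.
Proof.
rewrite /polylaplacian; elim: j f h => [//|j ih] f h fk hk; rewrite !iterSr.
have [f' [f'' [ff' ff'']]] := Ck2_pder (fk 2%N).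
have [h' [h'' [hh' hh'']]] := Ck2_pder (hk 2%N).
have E : (fun x => - laplacian (fun x => a * f x + b * h x) x) =
    fun x => a * (- laplacian f x) + b * (- laplacian h x).
  apply/funext => x; rewrite (laplacianE ff' ff'') (laplacianE hh' hh'').
  rewrite (laplacianE (g := fun i x => a * f' i x + b * h' i x)
    (h := fun i x => a * f'' i x + b * h'' i x)).
  - by rewrite !mulrN -opprD !mulr_sumr -big_split.
  - by move=> i; apply: pderD; exact: pderZ.
  - by move=> i; apply: pderD; exact: pderZ.
refine (eq_trans (congr1 (iter j (fun g x => - laplacian g x)) E) _).
apply: (ih (fun x => - laplacian f x) (fun x => - laplacian h x)) => k.
  by apply: (CkN (@temperedN _ _)); apply: (Ck_laplacian n4 (@temperedD _ _)); exact: fk.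
by apply: (CkN (@temperedN _ _)); apply: (Ck_laplacian n4 (@temperedD _ _)); exact: hk.
Qed.

End polylaplacian_linear.

(** * The logarithmic potential at infinity *)

Section asymptotics.
Context {R : realType} {n : nat} (n4 : (4 <= n)%N).
Implicit Types x y : 'rV[R]_n.

Lemma sqnD_young x y (d : R) : 0 < d -> sqn (x + y) <= (1 + d) * sqn x + (1 + d^-1) * sqn y.
Proof.
move=> d0; rewrite /sqn !mulr_sumr -big_split/=; apply: ler_sum => i _; rewrite mxE.
set a := x 0 i; set b := y 0 i.
have : 0 <= (d * a - b) ^+ 2 / d by rewrite divr_ge0 ?sqr_ge0// ltW.
rewrite (_ : (d * a - b) ^+ 2 / d = d * a ^+ 2 - 2 * a * b + d^-1 * b ^+ 2); last by field; rewrite gt_eqF.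
by move=> H; nra.
Qed.

(** Young's inequality with parameter d, used in both directions, gives the small constant d plus
    1/|x|^2 times a function of y whose integral against the density is bounded uniformly in x.
    First d is made small, then |x| large. *)
Lemma ln_sqn_ratio x y (d : R) : 0 < d -> x != 0 -> y != x ->
  `|ln (sqn (x - y)) - ln (sqn x)| <=
  d + (1 + d^-1) * 3 / sqn x * ((1 + sqn y) ^+ 2 * (1 + (sqn (x - y))^-1)).
Proof.
move=> d0 x0 yx.
have qx := sqn_gt0 x0; have qxy : 0 < sqn (x - y) by rewrite sqn_gt0// subr_eq0 eq_sym.
have qy := sqn_ge0 y; have d10 : 0 < 1 + d^-1 by rewrite addr_gt0// invr_gt0.
have h1 : ln (sqn (x - y)) - ln (sqn x) <= d + (1 + d^-1) * (sqn y / sqn x).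
  rewrite -ln_div ?posrE//; have t0 : 0 < sqn (x - y) / sqn x by rewrite divr_gt0.
  have : ln (sqn (x - y) / sqn x) <= sqn (x - y) / sqn x - 1.
    by rewrite -{1}(subrK 1 (_ / _)) addrC le_ln1Dx// ltrBrDl subrr.
  move=> h; apply: (le_trans h); rewrite lerBlDr ler_pdivrMr//.
  have := sqnD_young x (- y) d0; rewrite sqnN => h'; apply: (le_trans h').
  by rewrite le_eqVlt; apply/orP; left; apply/eqP; field; rewrite !gt_eqF.
have h2 : ln (sqn x) - ln (sqn (x - y)) <= d + (1 + d^-1) * (sqn y / sqn (x - y)).
  rewrite -ln_div ?posrE//; have t0 : 0 < sqn x / sqn (x - y) by rewrite divr_gt0.
  have : ln (sqn x / sqn (x - y)) <= sqn x / sqn (x - y) - 1.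
    by rewrite -{1}(subrK 1 (_ / _)) addrC le_ln1Dx// ltrBrDl subrr.
  move=> h; apply: (le_trans h); rewrite lerBlDr ler_pdivrMr//.
  have := sqnD_young (x - y) y d0; rewrite subrK => h'; apply: (le_trans h').
  by rewrite le_eqVlt; apply/orP; left; apply/eqP; field; rewrite !gt_eqF.
(* The lower estimate contains |y|^2 / |x-y|^2, without a factor 1/|x|^2; it is extracted from |x|^2
   <= 2 |x-y|^2 + 2 |y|^2. *)
have h3 : (sqn (x - y))^-1 <= (2 + 2 * (sqn y / sqn (x - y))) / sqn x.
  rewrite ler_pdivlMr// -(ler_pM2l qxy) mulVKf ?gt_eqF//.
  rewrite (_ : sqn (x - y) * _ = 2 * sqn (x - y) + 2 * sqn y); last by field; rewrite gt_eqF.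
  by have := sqnD_le (x - y) y; rewrite subrK.
set B := (1 + sqn y) ^+ 2 * _.
have hB : sqn y <= B.
  rewrite /B -[leLHS]mulr1; apply: ler_pM => //; last by rewrite lerDl invr_ge0 ltW.
  nra.
have hB2 : sqn y * (2 + 2 * (sqn y / sqn (x - y))) <= 3 * B.
  rewrite /B; set r := (sqn (x - y))^-1; have r0 : 0 < r by rewrite invr_gt0.
  set q := sqn y in qy *; have : 0 <= q * r by rewrite mulr_ge0// ltW.
  have : 0 <= q * q * r by rewrite !mulr_ge0// ltW.
  have : 0 <= q * q by rewrite mulr_ge0.
  nra.
have hB3 : 0 <= B by exact: le_trans hB.
have k1 : (1 + d^-1) * (sqn y / sqn x) <= (1 + d^-1) * 3 / sqn x * B.
  rewrite -!mulrA ler_pM2l// mulrCA [leLHS]mulrC ler_pM2l ?invr_gt0//; lra.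
have k2 : (1 + d^-1) * (sqn y / sqn (x - y)) <= (1 + d^-1) * 3 / sqn x * B.
  rewrite -!mulrA ler_pM2l//.
  apply: (le_trans (ler_wpM2l qy h3)); rewrite [leLHS]mulrA.
  by rewrite [leRHS](_ : _ = 3 * B / sqn x); [rewrite ler_pM2r ?invr_gt0|ring].
rewrite ler_norml; apply/andP; split; lra.
Qed.

(** As the density has mass 1, ln |x| can be placed under the integral, and [ln_sqn_ratio] bounds
    the difference. *)
Lemma conv_logk_at_infinity (rho : 'rV[R]_n -> R) : mble rho -> dbound rho ->
  (forall x, 0 <= rho x) -> itg rho = 1 ->
  (fun x => convol (@logk R n) rho x - ln (enorm x)) @ at_infinity R n --> (0 : R).
Proof.
move=> mrho drho rho0 rho1.
have np : (0 < n)%N by exact: leq_trans n4.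
have irho := dbound_itgble n4 mrho drho.
have dl : dom (@logk R n) rho by apply: dom_adm => //; exact: adm_logk.
have [CS HS] := itgble_sing (R := R) n4; have [D rD] := drho (2 + n)%N.
have D0 : 0 <= D by apply: le_trans (rD 0); rewrite mulr_ge0// ltW// sq1X_gt0.
have CS0 : 0 <= CS.
  by apply: le_trans (HS 0).2; apply: itg_ge0 => y; exact: sing_ge0.
have ilog x := itgble_logk_sub n4 x mrho drho.
have key x (d : R) : x != 0 -> 0 < d ->
    `|convol (@logk R n) rho x - logk x| <= 2^-1 * (d + (1 + d^-1) * 3 / sqn x * (D * CS)).
  move=> x0 d0; have qx := sqn_gt0 x0.
  have d10 : 0 < 1 + d^-1 by rewrite addr_gt0// invr_gt0.
  set c := (1 + d^-1) * 3 / sqn x.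
  have c0 : 0 < c by rewrite /c divr_gt0// mulr_gt0.
  rewrite (convolC (@mble_logk R n) mrho dl) /convol -[logk x]mulr1 -{1}rho1 -itgZ// -itgB//; last exact: itgbleZ.
  have iS := HS x.
  have iR : itgble (fun y => 2^-1 * (d * rho y + c * D * sing x y)).
    by apply: itgbleZ; apply: itgbleD; apply: itgbleZ => //; exact: iS.1.
  have mL : mble (fun y => rho y * logk (x - y) - logk x * rho y).
    exact: itgble_mble (itgbleB (ilog x) (itgbleZ _ irho)).
  have := le_normr_itg_off (p := x) np mL iR; move/(_ _)/le_trans; apply.
    move=> y yx; rewrite mulrC -mulrBl normrM (ger0_norm (rho0 y)) /logk -mulrBr normrM gtr0_norm//.
    rewrite -mulrA ler_pM2l//.
    apply: (le_trans (ler_wpM2r (rho0 y) (ln_sqn_ratio d0 x0 yx))).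
    rewrite mulrDl lerD2l -/c -[leLHS]mulrA -[leRHS]mulrA ler_pM2l//.
    have rD' : (1 + sqn y) ^+ 2 * rho y <= D * wgt y.
      rewrite /wgt ler_pdivlMr ?sq1X_gt0// mulrAC -exprD mulrC.
      by have := rD y; rewrite ger0_norm.
    rewrite mulrAC [leRHS](_ : _ = D * wgt y * (1 + (sqn (x - y))^-1)); last by rewrite /sing; ring.
    by rewrite ler_wpM2r// addr_ge0// invr_ge0 sqn_ge0.
  rewrite itgZ; last by apply: itgbleD; apply: itgbleZ => //; exact: iS.1.
  rewrite itgD; [|exact: itgbleZ|by apply: itgbleZ; exact: iS.1].
  rewrite itgZ// itgZ ?rho1; last exact: iS.1.
  rewrite ler_pM2l// mulr1 lerD2l -mulrA ler_pM2l// ler_wpM2l//; exact: iS.2.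
apply/(@cvgrPdist_lt _ _ _ (at_infinity R n)) => e e0.
(* With d = e the bound is (e + B / |x|^2) / 2. For |x| > 1 + B / e one has |x|^2 > |x|, so the
   second term is below e. *)
pose B := (1 + e^-1) * 3 * (D * CS).
have B0 : 0 <= B.
  by rewrite /B mulr_ge0 ?mulr_ge0// addr_ge0// invr_ge0 ltW.
exists (1 + B / e) => // x /= xM.
have M1 : 1 <= 1 + B / e by rewrite lerDl divr_ge0// ltW.
have ex : 0 < enorm x by apply: lt_trans xM; apply: lt_le_trans M1.
have e2 : enorm x ^+ 2 = sqn x by rewrite enorm_sqr.
have qx : 0 < sqn x by rewrite -e2 exprn_gt0.
have x0 : x != 0 by apply: contraTneq qx => ->; rewrite sqn0 ltxx.
have -> : ln (enorm x) = logk x.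
  by rewrite /logk -e2 lnXn// mulr2n; field.
rewrite sub0r normrN; apply: (le_lt_trans (key x e x0 e0)).
have qM : 1 + B / e < sqn x.
  rewrite -e2 expr2; apply: (lt_trans xM); rewrite ltr_pMr//; exact: le_lt_trans xM.
have : B / sqn x < e.
  rewrite ltr_pdivrMr// mulrC -ltr_pdivrMr//; apply: lt_trans qM; lra.
rewrite (_ : (1 + e^-1) * 3 / sqn x * (D * CS) = B / sqn x); last by rewrite /B; ring.
lra.
Qed.

End asymptotics.

(** Bootstrap: order k for rho gives order k + 1 for its potential, hence for the exponent and for
    rho again. Decay is needed for rho alone, since its derivatives are rho times tempered
    functions. *)
Lemma Ck_decaying_density {R : realType} {n : nat} (n4 : (4 <= n)%N) (rho p : 'rV[R]_n -> R) (a c : R) :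
  dbound rho -> (forall k, Ck tempered k p) -> mble rho ->
  (forall x, rho x = expR (a * convol (@logk R n) rho x - p x + c)) ->
  (forall k, Ck decaying k rho) /\ (forall k, Ck tempered k (convol (@logk R n) rho)).
Proof.
move=> drho pk mrho rhoE.
pose F x := a * convol (@logk R n) rho x + -1 * p x + c.
have rhoF : rho = fun x => expR (F x).
  by apply/funext => x; rewrite rhoE /F mulN1r.
have cstk k b : Ck tempered k (fun _ : 'rV[R]_n => b) by apply: Ck_cst; exact: tempered_cst.
have kZ k b (f : 'rV[R]_n -> R) : Ck tempered k f -> Ck tempered k (fun x => b * f x).
  by move=> fk; exact: (CkM (@temperedM _ _) (@temperedD _ _) (cstk k b) fk).
have Fk k : Ck tempered k (convol (@logk R n) rho) -> Ck tempered k F.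
  move=> Lk; apply: (CkD (@temperedD _ _) _ (cstk k c)).
  by apply: (CkD (@temperedD _ _)); exact: kZ.
have dr : decaying rho.
  split=> //; have cL := continuous_conv_logk n4 mrho drho.
  rewrite rhoF => x; apply: (continuous_comp (f := F)); last exact: continuous_expR.
  have cp : continuous p by have [] := Ck0 (pk 0%N).
  apply: continuousD; last exact: cst_continuous.
  apply: continuousD; apply: continuousM.
  - exact: cst_continuous.
  - exact: cL.
  - exact: cst_continuous.
  - exact: cp.
have rk k : Ck decaying k rho.
  elim: k => [|k ih]; first by split.
  rewrite rhoF; apply: Ck_expR; last by rewrite -rhoF.
  by apply: Fk; exact: Ck_conv_logk.
by split=> // k; apply: CkS; exact: Ck_conv_logk.
Qed.

Theorem theorem1p2 (R : realType) (m : nat) (P : mpoly.mpoly (2 * m) R) (V : R) :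
  (2 <= m)%N -> admissible_poly P -> 0 < V ->
  exists u : 'rV[R]_(2 * m) -> R,
    [/\ smooth u,
        (forall x, polylaplacian m u x =
           - ((2 * m - 1)`!%:R * expR ((2 * m)%:R * u x))),
        integral_Rn (fun x => (expR ((2 * m)%:R * u x))%:E) = V%:E
      & let alpha := - (2 * V / sphere_volume (2 * m)) in
        exists C : R,
          (fun x => u x - (- alpha * ln (enorm x) - mpoly_fun P x + C))
            @ at_infinity R (2 * m) --> (0 : R)].
Proof.
move=> m2 [degP Pinf] V0.
have n4 : (4 <= 2 * m)%N by rewrite -[4%N]/(2 * 2)%N leq_mul2l.
have [SE S0] := sphere_volumeE (R := R) n4.
set S := sphere_volume (2 * m) in SE S0 *.
pose beta := 2 * V / S; have beta0 : 0 < beta by rewrite divr_gt0// mulr_gt0.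
pose N : R := (2 * m)%:R; have N0 : 0 < N by rewrite ltr0n (leq_trans _ n4).
pose p x := N * mpoly_fun P x.
have tM k (f g : 'rV[R]_(2 * m) -> R) : Ck tempered k f -> Ck tempered k g -> Ck tempered k (fun x => f x * g x).
  exact: (CkM (@temperedM _ _) (@temperedD _ _)).
have cstk k b : Ck tempered k (fun _ : 'rV[R]_(2 * m) => b) by apply: Ck_cst; exact: tempered_cst.
have pk k : Ck tempered k p by apply: tM => //; exact: Ck_mpoly.
have mp : mble p by apply: mble_continuous; have [] := Ck0 (pk 0%N).
have pK K : 0 <= K -> exists C, forall x, K * ln (1 + sqn x) - C <= p x.
  move=> K0; have KN : 0 <= K / N by rewrite divr_ge0// ltW.
  have [C HC] := mpoly_growth KN Pinf; exists (N * C) => x.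
  have := ler_wpM2l (ltW N0) (HC x); rewrite mulrBr mulrA mulrCA divff ?gt_eqF// mulr1.
  by [].
(* The equation for rho has coefficient 2 g in front of the potential; e^(2 m u) requires 2 m
   beta. *)
have g0 : 0 < beta * m%:R by rewrite mulr_gt0// ltr0n (leq_trans _ m2).
have [rho [c [mrho drho rho1 rhoE]]] := self_consistent_density n4 g0 mp pK.
have [rk Lk] := Ck_decaying_density n4 drho pk mrho rhoE.
pose L := convol (@logk R (2 * m)) rho.
(* This value makes e^(2 m u) = V rho; the constant is merged into the polynomial [Q], which leaves
   [u] a combination of two functions. *)
pose c0 := (c + ln V) / N.
pose Q := P - mpolyC (2 * m) c0.
pose u x := beta * L x + -1 * mpoly_fun Q x.
have uE x : u x = beta * L x - mpoly_fun P x + c0.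
  by rewrite /u /mpoly_fun /Q mevalB mevalC; ring.
have uV x : expR (N * u x) = V * rho x.
  rewrite uE rhoE -[V in RHS]lnK ?posrE// -expRD; congr expR.
  rewrite /p /c0 -/L (_ : 2 * (beta * m%:R) = N * beta); last by rewrite /N natrM; ring.
  by rewrite mulrDr [N * (_ / N)]mulrC divfK ?gt_eqF//; ring.
exists u; split.
- apply: (@Ck_smooth _ _ tempered); first by move=> f [].
  move=> k; apply: (CkD (@temperedD _ _)); apply: tM => //; exact: Ck_mpoly.
- move=> x; rewrite /u (polylaplacian_lin n4 _ _ _ Lk (fun k => Ck_mpoly k Q)).
  (* Subtracting a constant changes the coefficient of degree 0 only, so [Q] still has degree below
     2 m. *)
  rewrite polylaplacian_mpoly0 ?mulr0 ?addr0; last first.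
    apply/msize_leP => mo hmo; rewrite /Q mcoeffB mcoeffC.
    have -> : mcoeff mo P = 0.
      have H : (msize P <= 2 * m)%N.
        move: degP; case: (msize P) => // d; move=> /leq_ltn_trans; apply.
        by rewrite ltn_subrL/= (leq_trans _ n4).
      by move/msize_leP : H; apply.
    case: eqVneq => [E|_]; last by rewrite mulr0 subr0.
    by move: hmo; rewrite E mdeg0 leqNgt (leq_trans _ n4).
  rewrite (polylaplacian_conv_logk m2 rk) -/N -[beta * L x + _]/(u x) uV.
  rewrite (_ : itg (bubble 1) = S); last first.
    by rewrite SE /bubble; under eq_fun do rewrite mulr1.
  (* Here beta S / 2 = V, which fixes the coefficient of the logarithm. *)
  by rewrite /beta; field; rewrite gt_eqF.
- rewrite (_ : (fun x => _) = fun x => (V * rho x)%:E); last first.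
    by apply/funext => x; rewrite -uV.
  have irho := dbound_itgble n4 mrho drho.
  by rewrite itgE ?itgZ ?rho1 ?mulr1//; exact: itgbleZ.
- move=> alpha; exists c0.
  rewrite (_ : (fun x => _) = fun x => beta * (L x - ln (enorm x))); last first.
    by apply/funext => x; rewrite uE /alpha -/beta; ring.
  rewrite -(mulr0 beta); apply: cvgMr; apply: conv_logk_at_infinity => // x.
  by rewrite rhoE expR_ge0.
Qed.
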